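(* Let $p,q\in(0,1)$ with $p\neq q$ be fixed, and let $$t_c(p,q)=\frac{2}{(\sqrt p-\sqrt q)^2+(\sqrt{1-q}-\sqrt{1-p})^2}.$$ For any fixed $t>0$, in the model $\mathrm{CSBM}(p,q,\alpha)$ with $\alpha=t\log n/n$, the spectral estimator $\hat\sigma_{\mathrm{Spec}}$ and the genie-aided estimator $\hat\sigma_{\mathrm{Best}}$ satisfy, as $n\to\infty$, $$\mathrm{Err}(\hat\sigma_{\mathrm{Spec}})=n^{o(1)}\,\mathrm{Err}(\hat\sigma_{\mathrm{Best}})+O(n^{-3})=n^{-(1+o(1))\,t/t_c(p,q)}+O(n^{-3}).$$
   Context: Symmetric censored stochastic block model $\mathrm{CSBM}(p,q,\alpha)$ on vertex set $[n]$: the labels $\sigma_0(i)\in\{\pm1\}$, $i\in[n]$, are i.i.d. uniform. Given $\sigma_0$, independently over unordered pairs $i\ne j$, there is an edge between $i$ and $j$ with probability $p$ if $\sigma_0(i)=\sigma_0(j)$ and with probability $q$ if $\sigma_0(i)\neq\sigma_0(j)$ (no self-loops). Independently over pairs, the status of each pair is revealed with probability $\alpha=t\log n/n$ ($n$ large enough that $\alpha\le 1$). The observation $G$ assigns to each pair a status in {present, absent, censored}: ''present'' if revealed and an edge, ''absent'' if revealed and a non-edge, ''censored'' if not revealed. Spectral estimator: let $y=\log\frac{1-q}{1-p}\big/\log\frac pq$ and let $A$ be the symmetric $n\times n$ matrix with zero diagonal and, for $i\ne j$, $A_{ij}=1$ if $\{i,j\}$ is present, $-y$ if absent, $0$ if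 censored. Let $u_1$ be a unit eigenvector for the largest eigenvalue of $A$ if $p>q$, and of $-A$ if $p<q$. Then $\hat\sigma_{\mathrm{Spec}}=\mathrm{sign}(u_1)$ entrywise. Genie-aided estimator: $\hat\sigma_{\mathrm{Best}}(u)=\arg\max_{r\in\{\pm1\}}\mathbb{P}\big(\sigma_0(u)=r\mid G,(\sigma_0(v))_{v\in[n]\setminus\{u\}}\big)$ for each $u\in[n]$, ties broken in favour of $+1$. Error rate: $\mathrm{Err}(\hat\sigma)=\mathbb{E}\Big[\min_{s\in\{-1,+1\}}\frac1n\sum_{i=1}^n\mathbf 1\{\hat\sigma(i)\neq s\,\sigma_0(i)\}\Big]$. Each $o(1)$ denotes some real sequence tending to $0$ as $n\to\infty$, and $O(n^{-3})$ some real sequence bounded in absolute value by a constant times $n^{-3}$. $\log$ is the natural logarithm. *)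

(* Defs.v *)
From mathcomp Require Import all_boot all_order all_algebra.
From mathcomp Require Import all_classical all_reals all_analysis.

Set Implicit Arguments.
Unset Strict Implicit.
Unset Printing Implicit Defensive.

Import Order.TTheory GRing.Theory Num.Theory.
Import numFieldNormedType.Exports.

Local Open Scope ring_scope.

Notation upair n := {e : {set 'I_n} | #|e| == 2%N}.

(* [true] stands for the label +1 and [false] for -1 (see [spin]). *)
Notation labels n := {ffun 'I_n -> bool}.

(* Status of each pair: [Some true] = present, [Some false] = absent,
   [None] = censored. *)
Notation observation n := {ffun upair n -> option bool}.

(* A sample point: the labels, the edge indicators of the uncensored graph,
   and the indicators of the pairs whose status is revealed. *)
Notation sample n :=
  (labels n * {ffun upair n -> bool} * {ffun upair n -> bool})%type.

Definition lab (n : nat) (w : sample n) : labels n := w.1.1.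
Definition edge (n : nat) (w : sample n) : {ffun upair n -> bool} := w.1.2.
Definition revealed (n : nat) (w : sample n) : {ffun upair n -> bool} := w.2.

Definition observe (n : nat) (w : sample n) : observation n :=
  [ffun e => if revealed w e then Some (edge w e) else None].

Definition spin (R : realType) (b : bool) : R := if b then 1 else -1.

Section CSBM.
Variables (R : realType) (p q alpha : R).

Definition edge_prob (n : nat) (s : labels n) (e : upair n) : R :=
  if [forall i in val e, forall j in val e, s i == s j] then p else q.

(* This is a probability mass function only when 0 <= alpha <= 1. *)
Definition csbm_pmf (n : nat) (w : sample n) : R :=
  (\prod_(i < n) bernoulli_pmf 2^-1 (lab w i)) *
  (\prod_(e : upair n) bernoulli_pmf (edge_prob (lab w) e) (edge w e)) *
  (\prod_(e : upair n) bernoulli_pmf alpha (revealed w e)).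

Definition csbm_Pr (n : nat) (B : pred (sample n)) : R :=
  \sum_(w : sample n | B w) csbm_pmf w.

Definition csbm_condPr (n : nat) (B C : pred (sample n)) : R :=
  csbm_Pr [pred w | B w && C w] / csbm_Pr C.

Definition csbm_E (n : nat) (X : sample n -> R) : R :=
  \sum_(w : sample n) csbm_pmf w * X w.

Definition mismatch (n : nat) (est : 'I_n -> R) (l : labels n) (s : R) : R :=
  n%:R^-1 * \sum_(i < n) (est i != s * spin R (l i))%:R.

(* The estimator may use the whole sample point, since the genie-aided one
   depends on the true labels. *)
Definition Err (n : nat) (est : sample n -> 'I_n -> R) : R :=
  csbm_E (fun w => Num.min (mismatch (est w) (lab w) 1)
                           (mismatch (est w) (lab w) (-1))).

Definition genie_event (n : nat) (w : sample n) (u : 'I_n) : pred (sample n) :=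
  [pred w' | (observe w' == observe w) &&
             [forall v, (v != u) ==> (lab w' v == lab w v)]].

Definition genie_posterior (n : nat) (w : sample n) (u : 'I_n) (r : bool) : R :=
  csbm_condPr [pred w' | lab w' u == r] (genie_event w u).

Definition sigma_best (n : nat) (w : sample n) (u : 'I_n) : R :=
  if genie_posterior w u false <= genie_posterior w u true then 1 else -1.

End CSBM.

Section Spectral.
Variables (R : realType) (p q : R).

Definition spec_y : R := ln ((1 - q) / (1 - p)) / ln (p / q).

(* On the diagonal [set i; i] is not a pair, so [insub] returns [None]. *)
Definition spec_mx (n : nat) (g : observation n) : 'M[R]_n :=
  \matrix_(i, j)
    if (insub [set i; j]%SET : option (upair n)) is Some e then
      match g e with
      | Some true => 1
      | Some false => - spec_y
      | None => 0
      end
    else 0.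

Definition signed_spec_mx (n : nat) (g : observation n) : 'M[R]_n :=
  if q < p then spec_mx g else - spec_mx g.

(* Row eigenvectors, as in the library; the matrices used are symmetric.  The
   norm is written out because the library norm on matrices is the sup norm. *)
Definition top_unit_eigenvector (n : nat) (A : 'M[R]_n) (u : 'rV[R]_n) : Prop :=
  exists a : R, [/\ eigenvalue A a,
    forall b : R, eigenvalue A b -> b <= a,
    (u <= eigenspace A a)%MS &
    \sum_(i < n) u 0 i ^+ 2 = 1].

(* [Num.sg 0 = 0], so a zero coordinate counts as an error in [Err]. *)
Definition sigma_spec (n : nat) (u1 : observation n -> 'rV[R]_n)
    (w : sample n) (i : 'I_n) : R :=
  Num.sg (u1 (observe w) 0 i).

Definition t_c : R :=
  2 / ((Num.sqrt p - Num.sqrt q) ^+ 2 +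
       (Num.sqrt (1 - q) - Num.sqrt (1 - p)) ^+ 2).

End Spectral.

Definition reveal_prob (R : realType) (t : R) (n : nat) : R :=
  t * ln n%:R / n%:R.

(* Main.v *)
(* Let rho = sqrt(pq) + sqrt((1-p)(1-q)), so that 1 - rho = 1/t_c.  Flipping the
   label of one vertex changes the law of the n - 1 pairs at that vertex, with
   Bhattacharyya affinity (1 - alpha(1-rho))^(n-1) = n^(-t/t_c + o(1)).  The genie
   errs when the log-likelihood ratio of a vertex is nonpositive, so Chernoff's
   bound gives the upper bound for its error; tilting by the square root of the
   likelihoods gives the matching lower bound on the Bayes risk, for the genie and
   for the relative sign of two vertices under any estimator.

   Up to the positive factor |log(p/q)|, the signed spectral matrix is the matrix B
   of log-likelihood ratios of the pairs, and the row of B applied to the labels s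
   is the log-likelihood ratio of the vertex times its label.  With probability
   1 - O(n^-4), for balanced s, <x, Bx> is at most l (gam <x,s>^2 / n + (c + eps) |x|^2) for all x,
   where l = log n: the coordinates of x are split into light ones, rounded to a
   grid and controlled by a union bound, and heavy ones, which span a sparse graph.
   Hence the top eigenvector U, normalised by |U|^2 = n, is close to s, and so is
   the top eigenvector V of B with row and column j erased; comparing the two
   eigenequations gives |U - V| <= const |U_j|.  As V is independent of row j,
   U_j has the sign of s_j as soon as s_j (B s)_j > del l; replacing the genie's
   threshold 0 by del l costs only a factor n^O(del). *)
Require Import Defs.
From mathcomp Require Import all_boot all_order all_algebra.
From mathcomp Require Import all_classical all_reals all_analysis.
From mathcomp Require Import ring lra.

Set Implicit Arguments.
Unset Strict Implicit.
Unset Printing Implicit Defensive.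

Import Order.TTheory GRing.Theory Num.Theory.
Import numFieldNormedType.Exports.

Local Open Scope classical_set_scope.
Local Open Scope ring_scope.

(** * Finite product measures *)

(** The exponent 3 of the remainder is free: each Chernoff parameter below is tuned to give n^-4
    after its union bound. As t/t_c may exceed 3, the spectral error itself need not be n^(-t/t_c +
    o(1)), so the last step splits off a part that is. Off the diagonal, the conditional mean of B
    is a combination of s s^T and the all-ones matrix. A positive coefficient of the latter competes
    with the signal: this is the source of c, and balance is what makes s and the all-ones vector
    almost orthogonal. The signal gam l has the order of the degrees, so errors eps l in the
    quadratic form are harmless and no sharp norm estimate is needed. It is essential that |U - V|
    is bounded relative to |U_j|: row j turns an l2 error into an entry with a factor of order sqrt
    l only, while the eigenvalue has order l, so the loss is absorbed in half of lam |U_j| and the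
    sign survives however small U_j is. The entrywise bound on V - s that remains is bootstrapped
    from the largest entry of U. *)

Lemma ler_of_eq (R : numDomainType) (x y : R) : x = y -> x <= y.
Proof. by move=> ->. Qed.

Lemma ler_sqr_of_norm (R : realDomainType) (x y : R) : `|x| <= `|y| -> x ^+ 2 <= y ^+ 2.
Proof.
by move=> xy; rewrite -(real_normK (num_real x)) -(real_normK (num_real y)) lerXn2r ?nnegrE.
Qed.

Lemma sum_prod_ffun (R : realType) (I V : finType) (f : I -> V -> R) :
  \sum_(g : {ffun I -> V}) \prod_i f i (g i) = \prod_i \sum_v f i v.
Proof. by rewrite bigA_distr_bigA. Qed.

Definition pmass (R : realType) (I V : finType) (f : I -> V -> R)
  (g : {ffun I -> V}) : R := \prod_i f i (g i).

(** The law of a coordinatewise function of two independent product vectors is again a product. It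
    serves twice: for resampling coordinates and for merging edges with revealing into statuses. *)
Lemma pmass_image (R : realType) (I V V' V'' : finType) (f : I -> V -> R)
    (f' : I -> V' -> R) (h : I -> V -> V' -> V'') (x : {ffun I -> V''}) :
  \sum_(g : {ffun I -> V}) \sum_(k : {ffun I -> V'})
    pmass f g * pmass f' k * ([ffun i => h i (g i) (k i)] == x)%:R =
  \prod_i \sum_v \sum_v' f i v * f' i v' * (h i v v' == x i)%:R.
Proof.
pose G i v v' := f i v * f' i v' * (h i v v' == x i)%:R.
transitivity (\sum_(g : {ffun I -> V}) \sum_(k : {ffun I -> V'})
    \prod_i G i (g i) (k i)).
  apply: eq_bigr => g _; apply: eq_bigr => k _.
  rewrite !big_split /=; congr (_ * _); case: eqP => [<-|/eqP nx].
    by rewrite big1 // => i _; rewrite ffunE eqxx.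
  have [i xi] : exists i, [ffun i => h i (g i) (k i)] i != x i.
    apply/existsP; apply: contraR nx; rewrite negb_exists => /forallP e.
    by apply/eqP/ffunP => i; have := e i; rewrite negbK => /eqP.
  by rewrite ffunE in xi; rewrite (bigD1 i) //= (negPf xi) mul0r.
under [LHS]eq_bigr => g _ do rewrite (sum_prod_ffun (fun i (v' : V') => G i (g i) v')).
by rewrite (sum_prod_ffun (fun i v => \sum_v' G i v v')).
Qed.

Section ProductMeasure.
Context {R : realType} {I V : finType}.
Implicit Types (f : I -> V -> R) (g k : {ffun I -> V}) (A B : pred {ffun I -> V}).

Definition is_pmf f := (forall i v, 0 <= f i v) /\ (forall i, \sum_v f i v = 1).

Definition prodE f (F : {ffun I -> V} -> R) : R := \sum_g pmass f g * F g.

Definition prodPr f A : R := \sum_(g | A g) pmass f g.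

Lemma pmass_ge0 f g : is_pmf f -> 0 <= pmass f g.
Proof. by move=> [f0 _]; apply: prodr_ge0 => i _. Qed.

Lemma pmass_sum f : is_pmf f -> \sum_(g : {ffun I -> V}) pmass f g = 1.
Proof. by case=> _ f1; rewrite sum_prod_ffun big1. Qed.

Lemma prodE_prod f (h : I -> V -> R) :
  prodE f (fun g => \prod_i h i (g i)) = \prod_i \sum_v f i v * h i v.
Proof.
rewrite -(sum_prod_ffun (fun i v => f i v * h i v)).
by apply: eq_bigr => g _; rewrite -big_split.
Qed.

Lemma prodPrE f A : prodPr f A = prodE f (fun g => (A g)%:R).
Proof.
rewrite /prodPr /prodE big_mkcond; apply: eq_bigr => g _.
by case: (A g); rewrite ?mulr1 ?mulr0.
Qed.

Lemma prodPr_ge0 f A : is_pmf f -> 0 <= prodPr f A.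
Proof. by move=> f_pmf; apply: sumr_ge0 => g _; exact: pmass_ge0. Qed.

Lemma ler_prodE f F G : is_pmf f -> (forall g, F g <= G g) ->
  prodE f F <= prodE f G.
Proof.
by move=> fP FG; apply: ler_sum => g _; apply: ler_wpM2l; [exact: pmass_ge0|].
Qed.

Lemma prodEZ f c F : prodE f (fun g => c * F g) = c * prodE f F.
Proof. by rewrite /prodE mulr_sumr; apply: eq_bigr => g _; rewrite mulrCA. Qed.

Lemma prodE_cst f c : is_pmf f -> prodE f (fun=> c) = c.
Proof. by move=> fP; rewrite /prodE -mulr_suml pmass_sum // mul1r. Qed.

Lemma ler_prodPr f A B : is_pmf f -> (forall g, A g -> B g) ->
  prodPr f A <= prodPr f B.
Proof.
move=> fP AB; rewrite !prodPrE; apply: ler_prodE => // g.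
by case: (boolP (A g)) => [/AB -> //|_]; exact: ler0n.
Qed.

Lemma prodPr_union (J : finType) f (A : J -> pred {ffun I -> V}) : is_pmf f ->
  prodPr f (fun g => [exists j, A j g]) <= \sum_j prodPr f (A j).
Proof.
move=> fP; under eq_bigr do rewrite prodPrE.
rewrite prodPrE exchange_big /=; apply: ler_sum => g _.
rewrite -mulr_sumr; apply: ler_wpM2l; first exact: pmass_ge0.
case: existsP => [[j Aj]|_]; last by apply: sumr_ge0 => j _; exact: ler0n.
by rewrite (bigD1 j) //= Aj lerDl sumr_ge0.
Qed.

Lemma prodPr_markov f A F : is_pmf f -> (forall g, 0 <= F g) ->
  (forall g, A g -> 1 <= F g) -> prodPr f A <= prodE f F.
Proof.
move=> fP F0 AF; rewrite prodPrE; apply: ler_prodE => // g.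
by case: (boolP (A g)) => [/AF //|_]; exact: F0.
Qed.

(* Resampling the coordinates in J preserves the product measure; this is how
   the independence of disjoint sets of coordinates is used. *)
Definition mix (J : pred I) g k : {ffun I -> V} :=
  [ffun i => if J i then k i else g i].

Lemma pmass_mix (J : pred I) f x : is_pmf f ->
  \sum_g \sum_k pmass f g * pmass f k * (mix J g k == x)%:R = pmass f x.
Proof.
move=> [f0 f1].
rewrite (pmass_image f f (fun i v v' => if J i then v' else v)) /pmass.
apply: eq_bigr => i _; case: (J i).
  rewrite -[RHS]mul1r -{2}(f1 i) mulr_suml; apply: eq_bigr => v _.
  by rewrite (bigD1 (x i)) //= eqxx mulr1 big1 ?addr0 // => v' /negPf->; rewrite mulr0.
rewrite (bigD1 (x i)) //= eqxx [X in _ + X]big1 ?addr0 => [|v /negPf vx].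
  by under eq_bigr do rewrite mulr1; rewrite -mulr_sumr f1 mulr1.
by rewrite big1 // => v' _; rewrite vx mulr0.
Qed.

Lemma prodE_mix (J : pred I) f F : is_pmf f ->
  prodE f F = prodE f (fun g => prodE f (fun k => F (mix J g k))).
Proof.
move=> fP; rewrite /prodE.
under eq_bigr => x _ do rewrite -(pmass_mix J x fP) mulr_suml.
rewrite exchange_big; apply: eq_bigr => g _ /=.
under eq_bigr => x _ do rewrite mulr_suml.
rewrite exchange_big mulr_sumr; apply: eq_bigr => k _ /=.
rewrite (bigD1 (mix J g k)) //= eqxx mulr1 big1 ?addr0 ?mulrA // => x.
by rewrite eq_sym => /negPf->; rewrite mulr0 mul0r.
Qed.

(** The weights [H g] do not see the coordinates in [J], so after resampling these the inner
    expectation factors with [g] frozen, and the bound is uniform in [g]. *)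
Lemma prodE_indep_le (J : pred I) f (H : {ffun I -> V} -> I -> V -> R) c :
  is_pmf f ->
  (forall g k i v, H (mix J g k) i v = H g i v) ->
  (forall g i v, ~~ J i -> H g i v = 1) ->
  (forall g, \prod_i (\sum_v f i v * H g i v) <= c) ->
  prodE f (fun g => \prod_i H g i (g i)) <= c.
Proof.
move=> fP Hmix H1 Hc; rewrite (prodE_mix J) // -[leRHS](prodE_cst c fP).
apply: ler_prodE => // g; apply: le_trans (Hc g).
rewrite -prodE_prod; apply: ler_prodE => // k.
apply: ler_of_eq; apply: eq_bigr => i _.
by rewrite Hmix ffunE; case: ifPn => // Ji; rewrite !H1.
Qed.

End ProductMeasure.

(** * Unordered pairs and sums over the pairs at a vertex *)

Section Pairs.
Context {n : nat}.
Implicit Types (i j k : 'I_n) (e : upair n) (S : {set 'I_n}).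

(** [F] takes a bare set, so that [[set i; j]] can be used without a proof that it is a pair. *)
Lemma big_upair_row (T : Type) (idx : T) (op : Monoid.com_law idx)
    (F : {set 'I_n} -> T) i :
  \big[op/idx]_(e : upair n | i \in val e) F (val e) =
  \big[op/idx]_(j | j != i) F [set i; j]%SET.
Proof.
transitivity (\big[op/idx]_(S : {set 'I_n} | (#|S| == 2%N) && (i \in S)) F S).
  rewrite [RHS](reindex_omap (val : upair n -> {set 'I_n}) insub) /=; last first.
    by move=> S /andP[S2 _]; rewrite insubT.
  apply: eq_bigl => -[S S2] /=; rewrite insubT S2 /=.
  suff -> : (Some (exist _ S S2 : upair n) == Some (exist _ S S2)) by rewrite andbT.
  exact: eqxx.
pose other S := odflt i [pick j in (S :\ i)%SET].
rewrite (reindex_onto (fun j => [set i; j]%SET) other) /=; last first.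
  move=> S /andP[/cards2P[x [y [xy ->]]] iS]; rewrite /other.
  case: pickP => [j|nj] /=.
    rewrite !inE => /andP[ji jS]; apply/setP => z; rewrite !inE.
    move: iS; rewrite !inE => /orP[] /eqP ei; move: jS ji; rewrite ei.
      by case: (eqVneq j x) => [-> //|_] /= /eqP-> _.
    by case: (eqVneq j y) => [-> //|_]; rewrite orbF => /eqP-> _; rewrite orbC.
  move: iS; rewrite !inE => /orP[] /eqP ei.
    by have := nj y; rewrite !inE ei eqxx eq_sym xy orbT.
  by have := nj x; rewrite !inE ei eqxx xy.
apply: eq_bigl => j; rewrite !inE eqxx cards2.
case: (eqVneq j i) => [->|ji] //=; apply/eqP; rewrite /other.
case: pickP => [k|/(_ j)]; rewrite !inE; last by rewrite eqxx ji orbT.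
by move=> /andP[/negPf->] /= /eqP.
Qed.

Lemma upair_double_sum (V : nmodType) (F : {set 'I_n} -> V) :
  \sum_i \sum_(j | j != i) F [set i; j]%SET = (\sum_(e : upair n) F (val e)) *+ 2.
Proof.
under eq_bigr => i _ do rewrite -big_upair_row.
rewrite (exchange_big_dep predT) //= -sumrMnl; apply: eq_bigr => e _.
by rewrite sumr_const; congr (_ *+ _); apply/eqP; exact: valP e.
Qed.

(** Total version of an observation, which lets matrix entries be indexed by arbitrary [i] and [j];
    the diagonal reads as censored, whence a zero diagonal. *)
Definition status (g : observation n) (S : {set 'I_n}) : option bool :=
  if insub S : option (upair n) is Some e then g e else None.

Lemma status_val g e : status g (val e) = g e.
Proof. by rewrite /status valK. Qed.

Lemma status_diag g i : status g [set i; i]%SET = None.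
Proof. by rewrite /status insubF // finset.setUid cards1. Qed.

Lemma upair_card2 i j : j != i -> #|[set i; j]%SET| == 2%N.
Proof. by rewrite cards2 eq_sym => ->. Qed.

Lemma upair_setP e : exists i j, j != i /\ val e = [set i; j]%SET.
Proof.
have /cards2P[x [y [xy E]]] := valP e; exists x, y; split => //.
by rewrite eq_sym.
Qed.

End Pairs.

Lemma sum_option_bool (V : nmodType) (F : option bool -> V) :
  \sum_v F v = F None + (F (Some true) + F (Some false)).
Proof.
rewrite (bigD1 None) //= (bigD1 (Some true)) //= (bigD1 (Some false)) //=.
by rewrite big1 ?addr0 // => -[[]|].
Qed.

(** * The observation given the labels *)

Section Model.
Context {R : realType} (p q alpha : R) {n : nat}.
Implicit Types (s : labels n) (g : observation n) (e : upair n) (u : 'I_n).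

Definition obs_pmf s e (v : option bool) : R :=
  if v is Some b then alpha * bernoulli_pmf (edge_prob p q s e) b else 1 - alpha.

Definition lik s g : R := pmass (obs_pmf s) g.

(** Integrating out edges and revealing leaves statuses that are independent over pairs given the
    labels. Both estimators depend on labels and statuses only, so from here on the law is
    [prodE (obs_pmf s)] averaged over [s]. *)
Lemma csbm_E_lab (F : labels n -> observation n -> R) :
  csbm_E p q alpha (fun w => F (lab w) (observe w)) =
  2^-1 ^+ n * \sum_s prodE (obs_pmf s) (F s).
Proof.
pose W s (k1 k2 : {ffun upair n -> bool}) : R :=
  pmass (fun e => bernoulli_pmf (edge_prob p q s e)) k1 *
  pmass (fun=> bernoulli_pmf alpha) k2.
have half b : bernoulli_pmf (2^-1 : R) b = 2^-1 by case: b => //=; rewrite /bernoulli_pmf; lra.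
transitivity (\sum_s \sum_(k1 : {ffun upair n -> bool})
    \sum_(k2 : {ffun upair n -> bool})
    2^-1 ^+ n * (W s k1 k2 * F s [ffun e => if k2 e then Some (k1 e) else None])).
  rewrite /csbm_E pair_bigA pair_bigA; apply: eq_bigr => -[[s k1] k2] _ /=.
  rewrite /csbm_pmf /W /lab /edge /revealed /observe /= !mulrA.
  congr (_ * _ * _ * _); under eq_bigr do rewrite half.
  by rewrite prodr_const card_ord.
rewrite mulr_sumr; apply: eq_bigr => s _.
under eq_bigr do rewrite -mulr_sumr; rewrite -mulr_sumr; congr (_ * _).
rewrite /prodE.
transitivity (\sum_g (\sum_(k1 : {ffun upair n -> bool})
    \sum_(k2 : {ffun upair n -> bool}) W s k1 k2 *
    ([ffun e => if k2 e then Some (k1 e) else None] == g)%:R) * F s g).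
  under [RHS]eq_bigr do rewrite mulr_suml.
  rewrite [RHS]exchange_big; apply: eq_bigr => k1 _ /=.
  under [RHS]eq_bigr do rewrite mulr_suml.
  rewrite [RHS]exchange_big; apply: eq_bigr => k2 _ /=.
  set g0 := [ffun e => _].
  rewrite (bigD1 g0) //= eqxx mulr1 big1 ?addr0 // => g.
  by rewrite eq_sym => /negPf->; rewrite mulr0 mul0r.
apply: eq_bigr => g _; congr (_ * _).
rewrite (pmass_image (fun e => bernoulli_pmf (edge_prob p q s e))
  (fun=> bernoulli_pmf alpha) (fun e b r => if r then Some b else None) g).
apply: eq_bigr => e _; rewrite !big_bool /= /obs_pmf /bernoulli_pmf.
by case: (g e) => [[]|] /=; ring.
Qed.

Lemma Err_lab (est : labels n -> observation n -> 'I_n -> R) :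
  Err p q alpha (fun w => est (lab w) (observe w)) =
  2^-1 ^+ n * \sum_s prodE (obs_pmf s)
    (fun g => Num.min (mismatch (est s g) s 1) (mismatch (est s g) s (-1))).
Proof.
exact: (csbm_E_lab (fun s g =>
  Num.min (mismatch (est s g) s 1) (mismatch (est s g) s (-1)))).
Qed.

Definition set_label s u (b : bool) : labels n :=
  [ffun v => if v == u then b else s v].

Definition flip s u : labels n := set_label s u (~~ s u).

Lemma set_label_id s u : set_label s u (s u) = s.
Proof. by apply/ffunP => v; rewrite ffunE; case: eqP => [->|]. Qed.

Lemma flipK u : involutive (fun s => flip s u).
Proof.
move=> s; apply/ffunP => v; rewrite !ffunE eqxx negbK.
by case: eqP => [->|].
Qed.

Definition best_label s g u : bool :=
  lik (set_label s u false) g <= lik (set_label s u true) g.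

(** The genie does not look at the label of [u]; this is what makes its error at [u] switch when
    that label is flipped. *)
Lemma best_label_flip s g u : best_label (flip s u) g u = best_label s g u.
Proof.
have E b : set_label (flip s u) u b = set_label s u b.
  by apply/ffunP => v; rewrite !ffunE; case: eqP.
by rewrite /best_label !E.
Qed.

Hypotheses (p01 : 0 < p < 1) (q01 : 0 < q < 1) (a01 : 0 < alpha < 1).

Lemma edge_prob01 s e : 0 < edge_prob p q s e < 1.
Proof. by rewrite /edge_prob; case: ifP. Qed.

Lemma obs_pmf_gt0 s e v : 0 < obs_pmf s e v.
Proof.
have /andP[e0 e1] := edge_prob01 s e; have /andP[al0 al1] := a01.
case: v => [[]|] /=; rewrite /bernoulli_pmf ?subr_gt0 //; apply: mulr_gt0 => //.
by rewrite subr_gt0.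
Qed.

Lemma obs_pmfP s : is_pmf (obs_pmf s).
Proof.
split=> [e v|e]; first exact/ltW/obs_pmf_gt0.
by rewrite sum_option_bool /= /bernoulli_pmf; ring.
Qed.

Lemma lik_gt0 s g : 0 < lik s g.
Proof. by apply: prodr_gt0 => e _; exact: obs_pmf_gt0. Qed.

Lemma genie_Pr w u b :
  csbm_Pr p q alpha [pred w' | (lab w' u == b) && genie_event w u w'] =
  2^-1 ^+ n * lik (set_label (lab w) u b) (observe w).
Proof.
transitivity (csbm_E p q alpha (fun w' => ((lab w' == set_label (lab w) u b) &&
    (observe w' == observe w))%:R)).
  rewrite /csbm_Pr /csbm_E big_mkcond; apply: eq_bigr => w' _ /=.
  set c := (X in if X then _ else _).
  suff -> : (lab w' == set_label (lab w) u b) && (observe w' == observe w) = c.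
    by case: c; rewrite ?mulr1 ?mulr0.
  rewrite /c /genie_event /= andbCA andbC; congr (_ && _).
  apply/eqP/andP => [->|[/eqP lb /forallP lE]].
    split; first by rewrite ffunE eqxx.
    by apply/forallP => v; rewrite ffunE; case: (v == u) => /=.
  apply/ffunP => v; rewrite ffunE; case: eqP => [->//|/eqP vu].
  by have := lE v; rewrite vu => /eqP.
rewrite (csbm_E_lab (fun s g => ((s == set_label (lab w) u b) && (g == observe w))%:R)).
congr (_ * _); rewrite (bigD1 (set_label (lab w) u b)) //= eqxx big1 ?addr0.
  rewrite /prodE (bigD1 (observe w)) //= eqxx mulr1 big1 ?addr0 // => g.
  by move=> /negPf->; rewrite mulr0.
by move=> s /negPf->; rewrite /prodE big1 // => g _; rewrite mulr0.
Qed.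

(** Labels are uniform, so the two posteriors share the prior factor and the normalisation, and
    comparing them is comparing likelihoods. Positivity of all statuses makes the conditioning event
    non-null. *)
Lemma sigma_bestE w u :
  sigma_best p q alpha w u = spin R (best_label (lab w) (observe w) u).
Proof.
have Pr_gt0 : 0 < csbm_Pr p q alpha (genie_event w u).
  have := genie_Pr w u true => H.
  apply: (@lt_le_trans _ _ (2^-1 ^+ n * lik (set_label (lab w) u true) (observe w))).
    by apply: mulr_gt0; [apply: exprn_gt0; lra|exact: lik_gt0].
  rewrite -H /csbm_Pr big_mkcond [leRHS]big_mkcond /=; apply: ler_sum => w' _.
  case: (genie_event w u w'); rewrite ?andbF // andbT; case: ifP => // _.
  have /andP[al0 al1] := a01.
  rewrite /csbm_pmf !mulr_ge0 //; apply: prodr_ge0 => i _;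
    apply: bernoulli_pmf_ge0.
  - by apply/andP; split; lra.
  - by have /andP[/ltW-> /ltW->] := edge_prob01 (lab w') i.
  - by rewrite !ltW.
rewrite /sigma_best /genie_posterior /csbm_condPr !genie_Pr ler_pdivrMr //.
rewrite divfK ?gt_eqF // ler_pM2l; last by apply: exprn_gt0; lra.
by rewrite /best_label /spin.
Qed.

End Model.

(** * Likelihood ratios *)

(** Invert [1 - z <= expR (- z)] and use (1 - z)(1 + z + 2 z^2) = 1 + z^2 (1 - 2 z). No lower bound
    on [z] is required. *)
Lemma expR_le_quad (R : realType) (z : R) : z <= 2^-1 ->
  expR z <= 1 + z + 2 * z ^+ 2.
Proof.
move=> z2; have h := expR_ge1Dx (- z).
have p1 : 0 < 1 - z by lra.
have : expR z <= (1 - z)^-1.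
  by rewrite -[expR z]invrK lef_pV2 ?posrE ?invr_gt0 ?expR_gt0 // -expRN.
move=> /le_trans; apply; rewrite -div1r ler_pdivrMr //.
have : 0 <= z ^+ 2 * (1 - 2 * z) by apply: mulr_ge0; [exact: sqr_ge0|lra].
nra.
Qed.

Lemma expR_tails (R : realType) (h a x : R) : 0 <= h -> a <= `|x| ->
  1 <= expR (- (h * a)) * (expR (h * x) + expR (- h * x)).
Proof.
move=> h0 ax; have ha : 0 <= h * (`|x| - a) by rewrite mulr_ge0 ?subr_ge0.
rewrite mulrDr -!expRD -[leLHS]expR0; have [x0|x0] := leP 0 x.
  by rewrite ger0_norm // in ha; apply: ler_wpDr; rewrite ?expR_ge0 // ler_expR; lra.
by rewrite ltr0_norm // in ha; apply: ler_wpDl; rewrite ?expR_ge0 // ler_expR; lra.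
Qed.

Lemma sqrtr_prod (R : rcfType) (I : finType) (P : pred I) (F : I -> R) :
  (forall i, 0 <= F i) -> Num.sqrt (\prod_(i | P i) F i) = \prod_(i | P i) Num.sqrt (F i).
Proof.
move=> F0; suff [] : Num.sqrt (\prod_(i | P i) F i) = \prod_(i | P i) Num.sqrt (F i)
  /\ 0 <= \prod_(i | P i) F i by [].
apply: (big_rec2 (fun x y => Num.sqrt y = x /\ 0 <= y)).
  by rewrite sqrtr1.
by move=> i x y _ [<- y0]; rewrite sqrtrM // mulr_ge0.
Qed.

Section Likelihood.
Context {R : realType} (p q : R).

Definition affinity : R := Num.sqrt (p * q) + Num.sqrt ((1 - p) * (1 - q)).

Definition llr (v : option bool) : R :=
  match v with
  | Some true => ln (p / q)
  | Some false => ln ((1 - p) / (1 - q))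
  | None => 0
  end.

Definition llr_bound : R := `|ln (p / q)| + `|ln ((1 - p) / (1 - q))|.

Lemma llr_boundP v : `|llr v| <= llr_bound.
Proof.
by case: v => [[]|] /=; rewrite /llr_bound ?normr0 ?lerDl ?lerDr ?addr_ge0.
Qed.

Notation same_labels s e := [forall i in val e, forall j in val e, s i == s j].

Definition pair_sign n (s : labels n) (e : upair n) : R :=
  if same_labels s e then 1 else -1.

(** The log-likelihood ratio of [s] against [flip s u]: pairs away from [u] cancel, and a pair
    joining different labels enters with the opposite sign. *)
Definition vertex_llr n (s : labels n) (g : observation n) (u : 'I_n) : R :=
  \sum_(e : upair n | u \in val e) pair_sign s e * llr (g e).

Section FixedSize.
Context {n : nat}.
Implicit Types (s : labels n) (g : observation n) (e : upair n) (u : 'I_n).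

Lemma same_labels_set s i j :
  [forall k in [set i; j]%SET, forall l in [set i; j]%SET, s k == s l] = (s i == s j).
Proof.
apply/forall_inP/eqP => [H|ij x].
  by have /forall_inP/(_ j) := H i (set21 _ _); rewrite set22 => /(_ isT)/eqP.
rewrite !inE => /orP[] /eqP->; apply/forall_inP => y; rewrite !inE => /orP[] /eqP->;
  by rewrite ?ij ?eqxx.
Qed.

Lemma same_labelsP s e i j : val e = [set i; j]%SET ->
  same_labels s e = (s i == s j).
Proof. by move=> ->; exact: same_labels_set. Qed.

Lemma same_labels_flip s u e :
  same_labels (flip s u) e = same_labels s e (+) (u \in val e).
Proof.
have [i [j [ji E]]] := upair_setP e.
rewrite !(same_labelsP _ E) E !inE !ffunE ![u == _]eq_sym.
case: (eqVneq i u) => [iu|iu]; case: (eqVneq j u) => [ju|ju] //=.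
- by rewrite iu ju eqxx in ji.
- by subst u; case: (s i); case: (s j).
- by subst u; case: (s i); case: (s j).
- by rewrite addbF.
Qed.

Lemma pair_signE s e i j : val e = [set i; j]%SET ->
  pair_sign s e = spin R (s i) * spin R (s j).
Proof.
move=> E; rewrite /pair_sign (same_labelsP _ E) /spin.
by case: (s i); case: (s j) => /=; rewrite ?mulr1 ?mul1r ?mulN1r ?opprK.
Qed.

Lemma sum_pair_sign s u (F : {set 'I_n} -> R) :
  \sum_(e : upair n | u \in val e) pair_sign s e * F (val e) =
  spin R (s u) * \sum_(j | j != u) spin R (s j) * F [set u; j]%SET.
Proof.
pose P (S : {set 'I_n}) : R :=
  if [forall i in S, forall j in S, s i == s j] then 1 else -1.
rewrite (big_upair_row _ (fun S => P S * F S)) mulr_sumr; apply: eq_bigr => j _.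
rewrite mulrA; congr (_ * _); rewrite /P same_labels_set /spin.
by case: (s u); case: (s j) => /=; rewrite ?mulr1 ?mul1r ?mulN1r ?opprK.
Qed.

Lemma vertex_llrE s g u : vertex_llr s g u =
  spin R (s u) * \sum_(j | j != u) spin R (s j) * llr (status g [set u; j]%SET).
Proof.
rewrite -(sum_pair_sign s u (fun S => llr (status g S))).
by apply: eq_bigr => e _; rewrite status_val.
Qed.

Lemma card_upair_row u : #|[pred e : upair n | u \in val e]| = n.-1.
Proof.
rewrite -sum1_card (big_upair_row _ (fun=> 1%N)) sum1_card.
by have := cardC1 u; rewrite card_ord => <-; apply: eq_card => j; rewrite !inE.
Qed.

Lemma card_upair_row2 u v : u != v ->
  #|[pred e : upair n | (u \in val e) (+) (v \in val e)]| = (n.-2).*2.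
Proof.
have half a b : a != b ->
    #|[pred e : upair n | (a \in val e) && (b \notin val e)]| = n.-2.
  move=> ab; rewrite -sum1_card big_mkcondr /=.
  rewrite (big_upair_row _ (fun S => if b \notin S then 1%N else 0%N)) /=.
  rewrite -big_mkcondr /= sum1_card.
  have := cardD1 b (predC1 a); rewrite cardC1 card_ord !inE eq_sym ab /=.
  move=> /(congr1 predn) /= ->; apply: eq_card => j; rewrite !inE /=.
  by rewrite unfold_in !inE negb_or [b == a]eq_sym ab /= [b == j]eq_sym andbC.
move=> uv; rewrite -addnn -{1}(half u v uv) -(half v u) 1?eq_sym //.
rewrite -!sum1_card (bigID (fun e : upair n => u \in val e)) /=.
by congr (_ + _)%N; apply: eq_bigl => e; rewrite !inE;
  case: (u \in val e); case: (v \in val e).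
Qed.

Context (alpha : R).
Hypotheses (p01 : 0 < p < 1) (q01 : 0 < q < 1) (a01 : 0 < alpha < 1).

Let p0 : 0 < p. Proof. by case/andP: p01. Qed.
Let p1 : 0 < 1 - p. Proof. by case/andP: p01; rewrite subr_gt0. Qed.
Let q0 : 0 < q. Proof. by case/andP: q01. Qed.
Let q1 : 0 < 1 - q. Proof. by case/andP: q01; rewrite subr_gt0. Qed.
Let a0 : 0 < alpha. Proof. by case/andP: a01. Qed.
Let a1 : 0 < 1 - alpha. Proof. by case/andP: a01; rewrite subr_gt0. Qed.

Notation pmf := (obs_pmf p q alpha).
Notation L := (lik p q alpha).

Lemma obs_pmf_flip s u e v : obs_pmf p q alpha s e v =
  obs_pmf p q alpha (flip s u) e v *
  expR (if u \in val e then pair_sign s e * llr v else 0).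
Proof.
rewrite /obs_pmf /edge_prob same_labels_flip /pair_sign.
case: (u \in val e); last by rewrite addbF expR0 mulr1.
rewrite addbT; case: ifP => _ /=; case: v => [[]|] /=;
  rewrite /bernoulli_pmf ?mulr0 ?mul1r ?mulN1r ?expR0 ?mulr1 // ?expRN.
- by rewrite lnK ?posrE ?divr_gt0 // -mulrA; congr (_ * _); rewrite mulrC divfK ?gt_eqF.
- by rewrite lnK ?posrE ?divr_gt0 // -mulrA; congr (_ * _); rewrite mulrC divfK ?gt_eqF.
- rewrite lnK ?posrE ?divr_gt0 // -mulrA; congr (_ * _).
  by rewrite invf_div mulrC divfK ?gt_eqF.
- rewrite lnK ?posrE ?divr_gt0 // -mulrA; congr (_ * _).
  by rewrite invf_div mulrC divfK ?gt_eqF.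
Qed.

Lemma lik_flip s g u : L s g = L (flip s u) g * expR (vertex_llr s g u).
Proof.
rewrite /lik /pmass; under eq_bigr => e _ do rewrite (obs_pmf_flip s u).
by rewrite big_split /= -expR_sum -big_mkcond.
Qed.

Lemma lik_flipN s g u : L (flip s u) g = L s g * expR (- vertex_llr s g u).
Proof. by rewrite (lik_flip s g u) -mulrA -expRD subrr expR0 mulr1. Qed.

Lemma sum_sqrt_obs_pmf s s' e :
  \sum_v Num.sqrt (pmf s e v * pmf s' e v) =
  if same_labels s e (+) same_labels s' e then 1 - alpha * (1 - affinity) else 1.
Proof.
have sq (x : R) : 0 < x -> Num.sqrt (x * x) = x.
  by move=> x0; rewrite -expr2 sqrtr_sqr gtr0_norm.
have sqa (x y : R) : 0 < x -> 0 < y ->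
    Num.sqrt (alpha * x * (alpha * y)) = alpha * Num.sqrt (x * y).
  by move=> x0 y0; rewrite mulrACA sqrtrM ?sq // mulr_ge0 // ltW.
rewrite sum_option_bool /obs_pmf /edge_prob /affinity.
by do 2 case: ifP => _ /=; rewrite /bernoulli_pmf /= sq // !sqa // ?sq //;
  rewrite ?[q * p]mulrC ?[(1 - q) * (1 - p)]mulrC; ring.
Qed.

Lemma sum_sqrt_lik s s' : \sum_g Num.sqrt (L s g * L s' g) =
  (1 - alpha * (1 - affinity)) ^+ #|[pred e : upair n |
     same_labels s e (+) same_labels s' e]|.
Proof.
transitivity (\sum_(g : observation n) \prod_e Num.sqrt (pmf s e (g e) * pmf s' e (g e))).
  apply: eq_bigr => g _; rewrite /lik /pmass -big_split sqrtr_prod //= => e.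
  by apply: mulr_ge0; apply/ltW/obs_pmf_gt0.
rewrite (sum_prod_ffun (fun e v => Num.sqrt (pmf s e v * pmf s' e v))).
under eq_bigr do rewrite sum_sqrt_obs_pmf.
by rewrite -big_mkcond prodr_const.
Qed.

Lemma sum_sqrt_lik_flip s u : \sum_g Num.sqrt (L s g * L (flip s u) g) =
  (1 - alpha * (1 - affinity)) ^+ n.-1.
Proof.
rewrite sum_sqrt_lik -(card_upair_row u); congr (_ ^+ _); apply: eq_card => e.
by rewrite !inE same_labels_flip addKb.
Qed.

(** The pair {u, v} is affected by both flips, so the two labelings agree on it. The other 2(n - 2)
    pairs at [u] or [v] give almost the square of the affinity of one flip. *)
Lemma sum_sqrt_lik_flip2 s u v : u != v ->
  \sum_g Num.sqrt (L (flip s u) g * L (flip s v) g) =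
  (1 - alpha * (1 - affinity)) ^+ (n.-2).*2.
Proof.
move=> uv; rewrite sum_sqrt_lik -(card_upair_row2 uv); congr (_ ^+ _); apply: eq_card => e.
by rewrite !inE !same_labels_flip addbACA addbb.
Qed.

Lemma sqrt_lik_flip s g u :
  Num.sqrt (L s g * L (flip s u) g) = L s g * expR (- (vertex_llr s g u / 2)).
Proof.
have L0 : 0 <= L s g by apply/ltW/lik_gt0.
rewrite lik_flipN mulrA sqrtrM ?mulr_ge0 // -expr2 sqrtr_sqr ger0_norm //.
congr (_ * _); rewrite [X in - X](splitr (vertex_llr s g u)) opprD expRD -expr2.
by rewrite sqrtr_sqr ger0_norm // expR_ge0.
Qed.

(** Chernoff's bound with exponent one half, where the moment generating function is exactly the
    affinity; a threshold [c] costs only [expR (c / 2)]. *)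
Lemma vertex_llr_tail s u (c : R) :
  prodPr (pmf s) (fun g => vertex_llr s g u <= c) <=
  expR (c / 2) * (1 - alpha * (1 - affinity)) ^+ n.-1.
Proof.
have -> : expR (c / 2) * (1 - alpha * (1 - affinity)) ^+ n.-1 =
    prodE (pmf s) (fun g => expR (c / 2) * expR (- (vertex_llr s g u / 2))).
  rewrite -(sum_sqrt_lik_flip s u) mulr_sumr; apply: eq_bigr => g _.
  by rewrite sqrt_lik_flip mulrCA.
apply: prodPr_markov => [|g|g gc]; first exact: obs_pmfP.
  by rewrite mulr_ge0 // expR_ge0.
by rewrite -expRD -[leLHS]expR0 ler_expR; move: gc => /=; lra.
Qed.

Definition genie_wrong s u g : bool := best_label p q alpha s g u != s u.

Lemma genie_wrong_llr s u g : genie_wrong s u g -> vertex_llr s g u <= 0.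
Proof.
rewrite /genie_wrong /best_label => H.
suff : L s g <= L (flip s u) g.
  by rewrite lik_flipN -[leLHS]mulr1 ler_pM2l ?lik_gt0 // -expR0 ler_expR oppr_ge0.
have := set_label_id s u; move: H; rewrite /flip.
case E: (s u) => /= H sE; rewrite sE in H; move: H.
  by rewrite eqb_id -ltNge => /ltW.
by rewrite eqbF_neg negbK.
Qed.

End FixedSize.
End Likelihood.

Lemma norm_spin (R : realType) b : `|spin R b| = 1.
Proof. by case: b; rewrite /spin ?normrN normr1. Qed.

Lemma spin_sqr (R : realType) b : spin R b ^+ 2 = 1.
Proof. by case: b; rewrite /spin ?sqrrN expr1n. Qed.

(** * The affinity and the threshold [t_c] *)

Section Affinity.
Context {R : realType} (p q : R).
Hypotheses (p01 : 0 < p < 1) (q01 : 0 < q < 1).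

Lemma affinityE : 1 - affinity p q =
  ((Num.sqrt p - Num.sqrt q) ^+ 2 +
   (Num.sqrt (1 - q) - Num.sqrt (1 - p)) ^+ 2) / 2.
Proof.
have /andP[p0 p1] := p01; have /andP[q0 q1] := q01.
rewrite /affinity !sqrtrM; [|lra..].
have := sqr_sqrtr (ltW p0); have := sqr_sqrtr (ltW q0).
have /sqr_sqrtr : 0 <= 1 - p by lra.
have /sqr_sqrtr : 0 <= 1 - q by lra.
nra.
Qed.

Lemma affinity_le1 : affinity p q <= 1.
Proof. by rewrite -subr_ge0 affinityE divr_ge0 // addr_ge0 ?sqr_ge0. Qed.

Lemma affinity_ge0 : 0 <= affinity p q.
Proof. by rewrite /affinity addr_ge0 ?sqrtr_ge0. Qed.

Lemma affinity_lt1 : p != q -> affinity p q < 1.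
Proof.
move=> pq; rewrite -subr_gt0 affinityE divr_gt0 // ltr_wpDr ?sqr_ge0 //.
rewrite exprn_even_gt0 //= subr_eq0; apply: contra pq.
have /andP[p0 p1] := p01; have /andP[q0 q1] := q01.
by rewrite eqr_sqrt // ltW.
Qed.

Lemma div_t_c (t : R) : p != q -> t / t_c p q = t * (1 - affinity p q).
Proof.
move=> pq; have := affinity_lt1 pq; rewrite -subr_gt0 affinityE /t_c => H.
set x := _ + _ in H *; have x0 : 0 < x by lra.
by rewrite invf_div mulrA.
Qed.

End Affinity.

(** * Lower bound for the Bayes risk of one label *)

Section MinLikelihood.
Context {R : realType} (p q alpha : R) {n : nat}.
Hypotheses (p01 : 0 < p < 1) (q01 : 0 < q < 1) (a01 : 0 < alpha < 1).
Implicit Types (s : labels n) (g : observation n) (e : upair n) (u : 'I_n).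
Notation pmf := (obs_pmf p q alpha).
Notation L := (lik p q alpha).
Notation beta := (1 - alpha * (1 - affinity p q)).

(** With X the log-likelihood ratio, the minimum is the geometric mean times exp(-|X|/2), hence at
    least exp(-S/2) times it when |X| <= S. When |X| > S the bracket is nonpositive by [expR_tails].
    Replacing the indicator of |X| <= S by exponentials keeps the sum over [g] computable. *)
Lemma min_lik_ge s g u (S th : R) : 0 <= S -> 0 <= th ->
  expR (- S / 2) * (Num.sqrt (L s g * L (flip s u) g) *
    (1 - expR (- (th * S)) * (expR (th * vertex_llr p q s g u) +
       expR (- th * vertex_llr p q s g u)))) <=
  Num.min (L s g) (L (flip s u) g).
Proof.
move=> S0 th0; rewrite sqrt_lik_flip //; set X := vertex_llr p q s g u.
have L0 : 0 < L s g by apply/lik_gt0.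
have Lf0 : 0 < L (flip s u) g by apply/lik_gt0.
set E := expR (- (th * S)) * _.
have [XS|XS] := leP `|X| S; last first.
  apply: (@le_trans _ _ 0); last by rewrite le_min !ltW.
  apply: mulr_ge0_le0; first exact: expR_ge0.
  apply: mulr_ge0_le0; first by rewrite mulr_ge0 ?expR_ge0 // ltW.
  by rewrite subr_le0 expR_tails // ltW.
have E0 : 0 <= E by rewrite mulr_ge0 ?addr_ge0 ?expR_ge0.
apply: (@le_trans _ _ (expR (- S / 2) * (L s g * expR (- (X / 2))))).
  rewrite ler_wpM2l ?expR_ge0 // -[leRHS]mulr1 ler_wpM2l //; last lra.
  by rewrite mulr_ge0 ?expR_ge0 // ltW.
move: XS; rewrite ler_norml => /andP[X1 X2].
rewrite lik_flipN // -/X mulrCA -expRD le_min; apply/andP; split.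
  rewrite -[leRHS]mulr1 ler_pM2l // -[leRHS]expR0 ler_expR; lra.
rewrite ler_pM2l // ler_expR; lra.
Qed.

(** The moment generating function of the log-likelihood ratio under the tilted law, proportional to
    the geometric mean of the two likelihoods. Each pair at [u] contributes a first-order term whose
    sign is [pair_sign], so these terms add up to the imbalance of [s] only; the second-order terms
    give the part with [n%:R]. *)
Lemma sqrt_lik_mgf s u (th : R) : alpha <= 2^-1 -> `|th| * llr_bound p q <= 2^-1 ->
  \sum_g Num.sqrt (L s g * L (flip s u) g) * expR (th * vertex_llr p q s g u) <=
  beta ^+ n.-1 * expR (2 * alpha * (`|th| * llr_bound p q *
    (`|\sum_i spin R (s i)| + 1) + 2 * (th * llr_bound p q) ^+ 2 * n%:R)).
Proof.
move=> a2 thb; set b := llr_bound p q.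
have /andP[a0 a1] := a01.
have aff0 := affinity_ge0 p q; have aff1 := affinity_le1 p01 q01.
have b0 : 0 <= b by rewrite addr_ge0.
have beta2 : 2^-1 <= beta by nra.
have beta0 : 0 < beta by lra.
(* [m] is the tilted, unnormalised mean log-ratio of a revealed pair at [u], up to the sign of the
   pair. *)
pose m : R := Num.sqrt (p * q) * ln (p / q) +
  Num.sqrt ((1 - p) * (1 - q)) * ln ((1 - p) / (1 - q)).
have sq0 (x : R) := sqrtr_ge0 x.
have mb : `|m| <= b.
  apply: (le_trans (ler_normD _ _)); rewrite !normrM !(ger0_norm (sqrtr_ge0 _)).
  apply: lerD; rewrite -[leRHS]mul1r ler_wpM2r //;
    apply: le_trans aff1; rewrite /affinity ?lerDl ?lerDr //.
have step e : u \in val e ->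
    \sum_v Num.sqrt (pmf s e v * pmf (flip s u) e v) *
      expR (th * (pair_sign s e * llr p q v)) <=
    beta * expR (alpha / beta * (th * m * pair_sign s e + 2 * (th * b) ^+ 2)).
  move=> ue.
  have ps : `|pair_sign s e : R| = 1.
    by rewrite /pair_sign; case: ifP; rewrite ?normrN normr1.
  set z := (pair_sign s e : R) in ps *.
  have quad v : expR (th * (z * llr p q v)) <= 1 + th * z * llr p q v + 2 * (th * b) ^+ 2.
    have lv : `|th * (z * llr p q v)| <= `|th * b|.
      by rewrite !normrM ps mul1r ler_wpM2l // (ger0_norm b0) llr_boundP.
    have lv2 := ler_sqr_of_norm lv.
    apply: le_trans (expR_le_quad _) _.
      by apply: le_trans (ler_norm _) _; apply: (le_trans lv); rewrite normrM (ger0_norm b0).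
    lra.
  have sameE (x : R) : 0 < x -> Num.sqrt (alpha * x * (alpha * x)) = alpha * x.
    by move=> x0; rewrite -expr2 sqrtr_sqr ger0_norm // mulr_ge0 // ltW.
  have sqa (x y : R) : Num.sqrt (alpha * x * (alpha * y)) = alpha * Num.sqrt (x * y).
    by rewrite mulrACA sqrtrM ?mulr_ge0 ?(ltW a0) // -expr2 sqrtr_sqr ger0_norm // ltW.
  have -> : \sum_v Num.sqrt (pmf s e v * pmf (flip s u) e v) * expR (th * (z * llr p q v)) =
      (1 - alpha) + alpha * (Num.sqrt (p * q) * expR (th * (z * llr p q (Some true))) +
       Num.sqrt ((1 - p) * (1 - q)) * expR (th * (z * llr p q (Some false)))).
    rewrite sum_option_bool /obs_pmf /edge_prob same_labels_flip ue addbT !mulr0 expR0 mulr1.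
    rewrite -expr2 sqrtr_sqr ger0_norm; last lra.
    by case: ifP => _ /=; rewrite /bernoulli_pmf !sqa ?[q * p]mulrC ?[(1 - q) * (1 - p)]mulrC; ring.
  apply: (@le_trans _ _ (beta + alpha * (th * m * z + 2 * (th * b) ^+ 2))).
    have q1 := quad (Some true); have q2 := quad (Some false).
    have := ler_wpM2l (sq0 (p * q)) q1; have := ler_wpM2l (sq0 ((1 - p) * (1 - q))) q2.
    set e2 := expR _; set e1 := expR _; rewrite /= => h1 h2.
    set A1 := Num.sqrt (p * q) in h2 *; set A2 := Num.sqrt _ in h1 *.
    have T0 : 0 <= 2 * (th * b) ^+ 2 by rewrite mulr_ge0 // sqr_ge0.
    have affT : (A1 + A2) * (2 * (th * b) ^+ 2) <= 2 * (th * b) ^+ 2.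
      by rewrite -[leRHS]mul1r ler_wpM2r.
    have : A1 * e1 + A2 * e2 <= A1 + A2 + (th * m * z + 2 * (th * b) ^+ 2).
      by rewrite /m -/A1 -/A2; lra.
    move=> /(ler_wpM2l (ltW a0)); rewrite /affinity -/A1 -/A2; lra.
  apply: le_trans (_ : beta * (1 + alpha / beta * (th * m * z + 2 * (th * b) ^+ 2)) <= _).
    by rewrite [leRHS](mulrDr beta) mulr1 (mulrA beta) (mulrC beta (alpha / beta)) divfK ?gt_eqF.
  by rewrite ler_pM2l // expR_ge1Dx.
apply: (@le_trans _ _ (\prod_e \sum_v (Num.sqrt (pmf s e v * pmf (flip s u) e v) *
   (if u \in val e then expR (th * (pair_sign s e * llr p q v)) else 1)))).
  apply: ler_of_eq.
  rewrite -(sum_prod_ffun (fun e v => Num.sqrt (pmf s e v * pmf (flip s u) e v) *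
   (if u \in val e then expR (th * (pair_sign s e * llr p q v)) else 1))).
  apply: eq_bigr => g _; rewrite big_split /=; congr (_ * _).
    rewrite /lik /pmass -big_split sqrtr_prod //= => e.
    by apply: mulr_ge0; apply/ltW/obs_pmf_gt0.
  by rewrite -big_mkcond /vertex_llr mulr_sumr expR_sum.
rewrite (bigID (fun e : upair n => u \in val e)) /= [X in _ * X]big1 ?mulr1; last first.
  move=> e /negPf ue; under eq_bigr do rewrite ue mulr1.
  by rewrite sum_sqrt_obs_pmf // same_labels_flip ue addbF addbb.
apply: (@le_trans _ _ (\prod_(e : upair n | u \in val e)
  (beta * expR (alpha / beta * (th * m * pair_sign s e + 2 * (th * b) ^+ 2))))).
  apply: ler_prod => e ue; rewrite {1}ue; apply/andP; split.
    by apply: sumr_ge0 => v _; rewrite mulr_ge0 ?sqrtr_ge0 ?expR_ge0.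
  by under eq_bigr do rewrite ue; exact: step.
rewrite big_split /= prodr_const card_upair_row ler_pM2l ?exprn_gt0 //.
rewrite -expR_sum ler_expR -mulr_sumr.
rewrite big_split /= sumr_const card_upair_row -mulr_sumr.
have -> : \sum_(e : upair n | u \in val e) (pair_sign s e : R) =
    spin R (s u) * ((\sum_i spin R (s i)) - spin R (s u)).
  have := sum_pair_sign s u (fun=> 1 : R).
  under eq_bigr do rewrite mulr1; move=> ->; congr (_ * _).
  by rewrite [in RHS](bigD1 u) //= addrC addrK; under eq_bigr do rewrite mulr1.
set Z := spin R (s u) * _.
have ZB : `|Z| <= `|\sum_i spin R (s i)| + 1.
  by rewrite normrM norm_spin mul1r (le_trans (ler_normB _ _)) // norm_spin.
have n1 : (n.-1)%:R <= n%:R :> R by rewrite ler_nat leq_pred.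
have T0 : 0 <= 2 * (th * b) ^+ 2 by rewrite mulr_ge0 // sqr_ge0.
have ab : 0 <= alpha / beta <= 2 * alpha.
  rewrite divr_ge0 ?(ltW a0) ?(ltW beta0) //= ler_pdivrMr //; nra.
apply: (@le_trans _ _ (alpha / beta * (`|th| * b * (`|\sum_i spin R (s i)| + 1) +
   2 * (th * b) ^+ 2 * n%:R))).
  apply: ler_wpM2l; first by case/andP: ab.
  apply: lerD; last by rewrite -(mulr_natr (2 * (th * b) ^+ 2)) ler_wpM2l.
  apply: le_trans (ler_norm _) _; rewrite (normrM (th * m)) (normrM th) -!mulrA ler_wpM2l //.
  by rewrite ler_pM.
apply: ler_wpM2r; last by case/andP: ab.
have T1 := mulr_ge0 T0 (ler0n R n); rewrite addr_ge0 //; apply: mulr_ge0; by rewrite ?addr_ge0 ?mulr_ge0.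
Qed.

Lemma sum_min_lik_ge s u (S th : R) : 0 <= S -> 0 <= th -> alpha <= 2^-1 ->
  th * llr_bound p q <= 2^-1 ->
  expR (- S / 2) * beta ^+ n.-1 * (1 - 2 * expR (2 * alpha * (th * llr_bound p q *
    (`|\sum_i spin R (s i)| + 1) + 2 * (th * llr_bound p q) ^+ 2 * n%:R) - th * S))
  <= \sum_g Num.min (L s g) (L (flip s u) g).
Proof.
move=> S0 th0 a2 thb.
apply: (@le_trans _ _ (\sum_g expR (- S / 2) * (Num.sqrt (L s g * L (flip s u) g) *
    (1 - expR (- (th * S)) * (expR (th * vertex_llr p q s g u) +
       expR (- th * vertex_llr p q s g u)))))); last first.
  by apply: ler_sum => g _; exact: min_lik_ge.
rewrite -mulr_sumr -mulrA ler_wpM2l ?expR_ge0 //.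
have m1 := @sqrt_lik_mgf s u th a2; have m2 := @sqrt_lik_mgf s u (- th) a2.
rewrite normrN mulNr sqrrN (ger0_norm th0) in m1 m2.
have := m1 thb; have := m2 thb => {m1 m2}.
set E := expR _; set M1 := \sum_g _; set M2 := \sum_g _ => h2 h1.
have -> : \sum_g (Num.sqrt (L s g * L (flip s u) g) *
    (1 - expR (- (th * S)) * (expR (th * vertex_llr p q s g u) +
       expR (- th * vertex_llr p q s g u)))) =
    beta ^+ n.-1 - expR (- (th * S)) * (M2 + M1).
  rewrite -(sum_sqrt_lik_flip p01 q01 a01 s u) /M1 /M2 mulrDr !mulr_sumr -big_split /=.
  by rewrite -sumrB; apply: eq_bigr => g _; ring.
rewrite expRD -/E.
have := ler_wpM2l (expR_ge0 (- (th * S))) h1.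
have := ler_wpM2l (expR_ge0 (- (th * S))) h2.
lra.
Qed.

End MinLikelihood.

(** * Growth of [ln n] and decay of the revealing probability *)

Section Asymptotics.
Context {R : realType}.

Lemma near_natr_ge (c : R) : \forall n \near \oo, c <= n%:R.
Proof. exact: nbhs_infty_ger. Qed.

Lemma near_ln_ge (c : R) : \forall n \near \oo, c <= ln (n%:R : R).
Proof.
near=> n.
have n0 : expR c <= n%:R :> R by near: n; exact: near_natr_ge.
by rewrite -[leLHS]expRK ler_ln ?posrE ?expR_gt0 ?(lt_le_trans (expR_gt0 c)).
Unshelve. all: by end_near. Qed.

Lemma ln_le_sqrt (x : R) : 0 < x -> ln x <= 2 * Num.sqrt x.
Proof.
move=> x0; have s0 : 0 < Num.sqrt x by rewrite sqrtr_gt0.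
rewrite -{1}(sqr_sqrtr (ltW x0)) lnXn // -(mulr_natl (ln _)) ler_wpM2l //.
have := expR_ge1Dx (ln (Num.sqrt x)); rewrite lnK ?posrE //; lra.
Qed.

Lemma near_ln_le (c : R) : 0 < c -> \forall n \near \oo, ln (n%:R : R) <= c * n%:R.
Proof.
move=> c0; near=> n.
have n1 : 1 <= n%:R :> R by near: n; exact: near_natr_ge.
have nc : (2 / c) ^+ 2 <= n%:R :> R by near: n; exact: near_natr_ge.
have n0 : 0 < n%:R :> R by lra.
apply: (le_trans (ln_le_sqrt n0)).
rewrite -{2}(sqr_sqrtr (ltW n0)) expr2 mulrA ler_wpM2r ?sqrtr_ge0 //.
rewrite -ler_pdivrMl // mulrC -[leLHS]ger0_norm ?divr_ge0 ?(ltW c0) // -sqrtr_sqr.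
by rewrite ler_sqrt.
Unshelve. all: by end_near. Qed.

Lemma near_reveal_prob (t : R) : 0 < t -> forall c, 0 < c -> \forall n \near \oo,
  0 < reveal_prob t n <= c.
Proof.
move=> t0 c c0; near=> n.
have n2 : 2 <= n%:R :> R by near: n; exact: near_natr_ge.
have l1 : 1 <= ln n%:R :> R by near: n; exact: near_ln_ge.
have lc : ln n%:R <= (c / t) * n%:R :> R.
  by near: n; apply: near_ln_le; rewrite divr_gt0.
have n0 : 0 < n%:R :> R by lra.
rewrite /reveal_prob divr_gt0 ?mulr_gt0 //=; last lra.
by rewrite ler_pdivrMr //; have := ler_wpM2l (ltW t0) lc; rewrite mulrA (mulrC t (c / t)) divfK ?gt_eqF.
Unshelve. all: by end_near. Qed.

End Asymptotics.

(** * Averages over uniform labels and balance *)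

Section Labels.
Context {R : realType} {n : nat}.

Definition labE (F : labels n -> R) : R := 2^-1 ^+ n * \sum_s F s.

Lemma ler_labE F G : (forall s, F s <= G s) -> labE F <= labE G.
Proof. by move=> FG; rewrite ler_wpM2l ?exprn_ge0 ?ler_sum // invr_ge0. Qed.

Lemma labE_cst c : labE (fun=> c) = c.
Proof.
rewrite /labE sumr_const card_ffun card_bool card_ord -(mulr_natl c) mulrA natrX.
by rewrite -exprMn mulVf ?expr1n ?mul1r // pnatr_eq0.
Qed.

Lemma labED F G : labE (fun s => F s + G s) = labE F + labE G.
Proof. by rewrite /labE big_split mulrDr. Qed.

Lemma labEZ c F : labE (fun s => c * F s) = c * labE F.
Proof. by rewrite /labE -mulr_sumr mulrCA. Qed.

Lemma labE_sum (J : finType) (P : pred J) (F : J -> labels n -> R) :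
  labE (fun s => \sum_(j | P j) F j s) = \sum_(j | P j) labE (F j).
Proof. by rewrite /labE exchange_big mulr_sumr. Qed.

Lemma labE_flip u F : labE (fun s => F (flip s u)) = labE F.
Proof.
by congr (_ * _); rewrite [RHS](reindex_inj (inv_inj (flipK u))).
Qed.

Lemma labE_mgf (h : R) : `|h| <= 2^-1 ->
  labE (fun s => expR (h * \sum_i spin R (s i))) <= expR (2 * h ^+ 2 * n%:R).
Proof.
move=> h2; rewrite /labE.
have -> : \sum_(s : labels n) expR (h * \sum_i spin R (s i)) =
    (expR h + expR (- h)) ^+ n.
  transitivity (\sum_(s : labels n) \prod_i expR (h * spin R (s i))).
    by apply: eq_bigr => s _; rewrite mulr_sumr expR_sum.
  rewrite (sum_prod_ffun (fun _ b => expR (h * spin R b))).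
  under eq_bigr do rewrite big_bool /= /spin mulr1 mulrN1.
  by rewrite prodr_const card_ord.
rewrite -exprMn (mulrC _ n%:R) expRM_natl.
have eD : 0 <= expR h + expR (- h) by rewrite addr_ge0 ?expR_ge0.
rewrite lerXn2r ?nnegrE ?expR_ge0 ?mulr_ge0 ?invr_ge0 //.
move: h2; rewrite ler_norml => /andP[h1 h2].
apply: le_trans (expR_ge1Dx _).
have := @expR_le_quad R h h2; have := @expR_le_quad R (- h); rewrite sqrrN; lra.
Qed.

Definition balanced (eps : R) (s : labels n) : bool :=
  `|\sum_i spin R (s i)| <= eps * n%:R.

Lemma labE_unbalanced (eps : R) : 0 < eps <= 1 ->
  labE (fun s => (~~ balanced eps s)%:R) <= 2 * expR (- (eps ^+ 2 / 8) * n%:R).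
Proof.
(* [eps / 4] minimises 2 h^2 - h eps, with value - eps^2 / 8. *)
move=> /andP[e0 e1]; pose h := eps / 4.
apply: (@le_trans _ _ (expR (- (h * eps * n%:R)) *
   (labE (fun s => expR (h * \sum_i spin R (s i))) +
    labE (fun s => expR (- h * \sum_i spin R (s i)))))).
  rewrite -labED -labEZ; apply: ler_labE => s; rewrite /balanced -ltNge.
  set x := \sum_i _; case: ltP => [xe|_] /=; last first.
    by rewrite mulr_ge0 ?addr_ge0 ?expR_ge0.
  by rewrite -mulrA expR_tails ?(ltW xe) // /h; lra.
have hh : `|h| <= 2^-1 by rewrite ger0_norm /h; lra.
have H1 := labE_mgf hh; have := @labE_mgf (- h); rewrite normrN sqrrN => /(_ hh) H2.
apply: (@le_trans _ _ (expR (- (h * eps * n%:R)) * (2 * expR (2 * h ^+ 2 * n%:R)))).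
  by rewrite ler_wpM2l ?expR_ge0 //; lra.
rewrite mulrCA -expRD ler_pM2l // ler_expR /h; lra.
Qed.

End Labels.

(** * The genie-aided estimator *)

Lemma prodE_linear (R : realType) (I V : finType) (f : I -> V -> R)
  (J : finType) (P : pred J) (c : R) (F : J -> {ffun I -> V} -> R) :
  prodE f (fun g => c * \sum_(j | P j) F j g) = c * \sum_(j | P j) prodE f (F j).
Proof.
rewrite /prodE exchange_big mulr_sumr; apply: eq_bigr => g _ /=.
by rewrite mulrCA -mulr_sumr.
Qed.

Lemma prodEB (R : realType) (I V : finType) (f : I -> V -> R)
  (F G : {ffun I -> V} -> R) :
  prodE f (fun g => F g - G g) = prodE f F - prodE f G.
Proof. by rewrite /prodE -sumrB; apply: eq_bigr => g _; rewrite mulrBr. Qed.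

Lemma expRN_le_inv (R : realType) (c x : R) : 0 < c -> c <= 1 + x -> expR (- x) <= c^-1.
Proof.
move=> c0 cx; rewrite expRN lef_pV2 ?posrE ?expR_gt0 //.
by apply: le_trans cx _; exact: expR_ge1Dx.
Qed.

Lemma spin_gt0 (R : realType) b : (0 < spin R b) = b.
Proof. by case: b; rewrite /spin ?ltr01 // oppr_gt0 ltr10. Qed.

Lemma spinN (R : realType) b : spin R (~~ b) = - 1 * spin R b.
Proof. by case: b; rewrite /spin /= ?mulrN1 ?mulr1 ?opprK. Qed.

Section GenieError.
Context {R : realType} (p q t : R).
Hypotheses (p01 : 0 < p < 1) (q01 : 0 < q < 1) (t0 : 0 < t).
Let tau := t * (1 - affinity p q).
Notation al n := (reveal_prob t n).
Notation pmf n := (obs_pmf p q (al n)).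
Notation L n := (lik p q (al n)).
Notation beta n := (1 - reveal_prob t n * (1 - affinity p q)).

(** One vertex involves n - 1 pairs and the joint error of two vertices n - 2 pairs for each, hence
    the uniformity in [k <= 2]. *)
Lemma near_affinity_pow_le (d : R) : 0 < d ->
  \forall n \near \oo, forall k : nat, (k <= 2)%N ->
    beta n ^+ (n - k) <= expR (- (tau - d) * ln n%:R).
Proof.
move=> d0; near=> n => k k2.
have n2 : 2 <= n%:R :> R by near: n; exact: near_natr_ge.
have nd : 2 * tau / d <= n%:R by near: n; exact: near_natr_ge.
have l0 : 0 <= ln n%:R :> R by near: n; exact: near_ln_ge.
have /andP[a0 a1] : 0 < reveal_prob t n <= 1 by near: n; exact: near_reveal_prob.
have aff0 := affinity_ge0 p q; have aff1 := affinity_le1 p01 q01.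
have b0 : 0 <= beta n by nra.
have n0 : 0 < n%:R :> R by lra.
have kn : (k <= n)%N by apply: leq_trans k2 _; rewrite -(ler_nat R).
apply: (@le_trans _ _ (expR (- (reveal_prob t n * (1 - affinity p q))) ^+ (n - k))).
  by rewrite lerXn2r ?nnegrE ?expR_ge0 // expR_ge1Dx.
rewrite -expRM_natl ler_expR natrB // /reveal_prob.
have -> : (n%:R - k%:R) * - (t * ln n%:R / n%:R * (1 - affinity p q)) =
   - ((1 - k%:R / n%:R) * tau) * ln n%:R.
  by rewrite /tau; field; rewrite gt_eqF.
rewrite ler_wpM2r // lerN2.
have k2R : k%:R <= 2 :> R by rewrite ler_nat.
have tau0 : 0 <= tau by rewrite mulr_ge0 ?(ltW t0) // subr_ge0.
have H : 2 * tau <= n%:R * d by rewrite -ler_pdivrMr.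
have : k%:R / n%:R * tau <= d by rewrite mulrAC ler_pdivrMr //; nra.
lra.
Unshelve. all: by end_near. Qed.

Lemma near_affinity_pow_ge (d : R) : 0 < d ->
  \forall n \near \oo, expR (- (tau + d) * ln n%:R) <= beta n ^+ n.-1.
Proof.
move=> d0; have aff0 := affinity_ge0 p q; have aff1 := affinity_le1 p01 q01.
have tau0 : 0 <= tau by rewrite mulr_ge0 ?(ltW t0) // subr_ge0.
pose c := d / (tau + d).
have c0 : 0 < c by rewrite divr_gt0 // ltr_wpDl.
near=> n.
have l0 : 0 <= ln n%:R :> R by near: n; exact: near_ln_ge.
have n2 : 2 <= n%:R :> R by near: n; exact: near_natr_ge.
have /andP[a0 ac] : 0 < reveal_prob t n <= c by near: n; exact: near_reveal_prob.
have /andP[_ a1] : 0 < reveal_prob t n <= 2^-1.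
  by near: n; apply: near_reveal_prob => //; rewrite invr_gt0.
set x := reveal_prob t n * (1 - affinity p q).
have x0 : 0 <= x by rewrite mulr_ge0 ?(ltW a0) // subr_ge0.
have x2 : x <= 2^-1 by rewrite /x; nra.
have xc : x <= c by rewrite /x; nra.
have n0 : 0 < n%:R :> R by lra.
have y0 : 0 < 1 - x by lra.
apply: (@le_trans _ _ ((1 - x) ^+ n)); last first.
  have npos : (0 < n)%N by rewrite -(ltr_nat R).
  have -> : (1 - x) ^+ n = (1 - x) * (1 - x) ^+ n.-1 by rewrite -exprS prednK.
  by rewrite ler_piMl ?exprn_ge0 ?(ltW y0) //; lra.
have step : expR (- (x / (1 - x))) <= 1 - x.
  rewrite expRN -[leRHS]invrK lef_pV2 ?posrE ?invr_gt0 ?expR_gt0 //.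
  apply: le_trans (expR_ge1Dx _).
  by rewrite -[leLHS]mul1r ler_pdivrMr // mulrDl divfK ?gt_eqF //; lra.
apply: (@le_trans _ _ (expR (- (x / (1 - x))) ^+ n)); last first.
  by rewrite lerXn2r ?nnegrE ?expR_ge0 ?(ltW y0).
rewrite -expRM_natl ler_expR mulrN mulNr lerN2.
have -> : n%:R * (x / (1 - x)) = tau / (1 - x) * ln n%:R.
  have E : n%:R * x = tau * ln n%:R.
    by rewrite /x /reveal_prob /tau; field; rewrite gt_eqF.
  by rewrite mulrA E mulrAC.
rewrite ler_wpM2r // ler_pdivrMr //.
have : (tau + d) * x <= d.
  by rewrite mulrC -ler_pdivlMr // ltr_wpDl.
lra.
Unshelve. all: by end_near. Qed.

(** [sum_min_lik_ge] is applied with window S = d l, which costs n^(-d/2). On balanced labels the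
    tilted law leaves the window with small probability: the bias and the variance each take at most
    a quarter of th S. Unbalanced labels are rare and contribute a nonnegative amount. *)
Lemma near_sum_min_lik_ge (d : R) : 0 < d ->
  \forall n \near \oo, forall u : 'I_n,
    expR (- (tau + d) * ln n%:R) <=
    labE (fun s => \sum_g Num.min (L n s g) (L n (flip s u) g)).
Proof.
move=> d0; pose B := llr_bound p q + 1.
have b0 : 0 <= llr_bound p q by rewrite addr_ge0.
have B0 : 0 < B by rewrite /B; lra.
(* The first bound keeps the exponents in the range of [expR_le_quad]; the second makes the variance
   term at most th d l / 4. *)
pose th := Num.min (2 * B)^-1 (d / (16 * t * B ^+ 2)).
have tB : 0 < 16 * t * B ^+ 2 by rewrite !mulr_gt0 ?exprn_gt0.
have th0 : 0 < th by rewrite lt_min invr_gt0 divr_gt0 // mulr_gt0.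
have thB : th * B <= 2^-1.
  apply: le_trans (_ : (2 * B)^-1 * B <= _); last by rewrite invfM mulrVK ?unitfE ?gt_eqF.
  by rewrite ler_wpM2r ?(ltW B0) // ge_min lexx.
have thd : 16 * t * B ^+ 2 * th <= d.
  by rewrite mulrC -ler_pdivlMr // ge_min lexx orbT.
pose eps := Num.min 1 (d / (16 * t * B)).
have tB1 : 0 < 16 * t * B by rewrite !mulr_gt0.
have e01 : 0 < eps <= 1 by rewrite lt_min ltr01 divr_gt0 //= ge_min lexx.
have ed : 16 * t * B * eps <= d.
  by rewrite mulrC -ler_pdivlMr // ge_min lexx orbT.
have [e0 e1] := andP e01.
near=> n => u.
have n2 : 2 <= n%:R :> R by near: n; exact: near_natr_ge.
have n3 : 16 * t * B / d <= n%:R by near: n; exact: near_natr_ge.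
have n4 : 24 / eps ^+ 2 <= n%:R by near: n; exact: near_natr_ge.
have l1 : 1 <= ln n%:R :> R by near: n; exact: near_ln_ge.
have l2 : 6 / (th * d) <= ln n%:R by near: n; exact: near_ln_ge.
have l3 : 16 / d <= ln n%:R by near: n; exact: near_ln_ge.
have /andP[a0 a1] : 0 < al n <= 2^-1.
  by near: n; apply: near_reveal_prob => //; rewrite invr_gt0.
have bpow : expR (- (tau + d / 4) * ln n%:R) <= beta n ^+ n.-1.
  by near: n; apply: near_affinity_pow_ge => //; rewrite divr_gt0.
have a01 : 0 < al n < 1 by rewrite a0 /=; clear -p01 q01 t0 tau a1; lra.
have n0 : 0 < n%:R :> R by apply: lt_le_trans n2.
set l := ln n%:R in l1 l2 l3 bpow *.
have aln : al n * n%:R = t * l by rewrite /reveal_prob divfK ?gt_eqF.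
have bpow0 : 0 <= beta n ^+ n.-1 by apply: le_trans bpow; rewrite expR_ge0.
pose c := expR (- (d * l) / 2) * beta n ^+ n.-1.
have c0 : 0 <= c by rewrite mulr_ge0 ?expR_ge0.
have min0 s : 0 <= \sum_g Num.min (L n s g) (L n (flip s u) g).
  by apply: sumr_ge0 => g _; rewrite le_min !ltW ?lik_gt0.
have bal s : balanced eps s -> c / 2 <=
    \sum_g Num.min (L n s g) (L n (flip s u) g).
  move=> bs.
  have S0 : 0 <= d * l by rewrite mulr_ge0 ?(ltW d0) // (le_trans ler01).
  have thb : th * llr_bound p q <= 2^-1 by apply: le_trans thB; rewrite ler_pM2l // lerDl.
  apply: le_trans (sum_min_lik_ge p01 q01 a01 s u S0 (ltW th0) a1 thb).
  rewrite -/c ler_wpM2l //.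
  have x1 : th * d * l >= 6 by rewrite mulrC -ler_pdivrMr // mulr_gt0.
  set X := expR _; suff : X <= 4^-1 by clear -p01 q01 t0 tau; lra.
  apply: (@le_trans _ _ (expR (- (th * d * l / 2)))); last first.
    by apply: expRN_le_inv => //; clear -p01 q01 t0 tau x1; lra.
  rewrite ler_expR.
  set Sg := `|_|; have Sg0 : 0 <= Sg by exact: normr_ge0.
  have Sgn : Sg <= eps * n%:R by exact: bs.
  have h1 : 16 * t * B <= d * n%:R by rewrite mulrC [d * _]mulrC -ler_pdivrMr // mulrC.
  have bB : llr_bound p q <= B by rewrite lerDl.
  have u1 : 2 * al n * (th * llr_bound p q * (Sg + 1)) <= th * d / 4 * l.
    apply: (@le_trans _ _ (2 * al n * (th * B * (eps * n%:R + 1)))).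
      apply: ler_wpM2l; first by rewrite mulr_ge0 // ltW.
      apply: ler_pM; [by rewrite mulr_ge0 // ltW|by rewrite addr_ge0| |by rewrite lerD2r].
      by rewrite ler_wpM2l ?(ltW th0).
    have -> : 2 * al n * (th * B * (eps * n%:R + 1)) =
      th * (2 * B * eps * (al n * n%:R) + 2 * B * al n) by ring.
    rewrite aln -!mulrA ler_pM2l // mulrA.
    have : 16 * t * B * eps * l <= d * l by rewrite ler_wpM2r // (le_trans ler01).
    have : 16 * t * B * al n <= d * (t * l).
      by have := ler_wpM2r (ltW a0) h1; rewrite -(mulrA d) (mulrC n%:R) aln.
    move=> h2 h3; have : 16 * B * al n <= d * l.
      by rewrite -(ler_pM2l t0); clear -p01 q01 t0 tau h2; lra.
    by move=> h4; clear -p01 q01 t0 tau h3 h4; lra.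
  have u2 : 2 * al n * (2 * (th * llr_bound p q) ^+ 2 * n%:R) <= th * d / 4 * l.
    have -> : 2 * al n * (2 * (th * llr_bound p q) ^+ 2 * n%:R) =
      4 * (th * llr_bound p q) ^+ 2 * (al n * n%:R) by ring.
    rewrite aln; have : (th * llr_bound p q) ^+ 2 <= (th * B) ^+ 2.
      by rewrite lerXn2r ?nnegrE ?mulr_ge0 ?(ltW th0) ?(ltW B0) // ler_pM2l.
    have tl : 0 <= 4 * (t * l).
      by rewrite mulr_ge0 // mulr_ge0 ?(ltW t0) // (le_trans ler01).
    move=> /(ler_wpM2l tl).
    have l0 : 0 <= th * l / 4.
      by rewrite divr_ge0 // mulr_ge0 ?(ltW th0) // (le_trans ler01).
    by have := ler_wpM2l l0 thd; clear -p01 q01 t0 tau; lra.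
  by clear -p01 q01 t0 tau u1 u2; lra.
apply: (@le_trans _ _ (c / 4)).
  have -> : - (tau + d) * l = - (tau + d / 4) * l + (- (d * l) / 2 - d / 4 * l).
    by clear -p01 q01 t0 tau; lra.
  rewrite expRD /c [expR (- (d * l) / 2) * _]mulrC -(mulrA (beta n ^+ n.-1)).
  apply: ler_pM; [exact: expR_ge0|exact: expR_ge0|exact: bpow|].
  rewrite expRD ler_wpM2l ?expR_ge0 //.
  apply: expRN_le_inv => //.
  have : 16 <= d * l by rewrite mulrC -ler_pdivrMr.
  by clear -p01 q01 t0 tau; lra.
(* At most half of the labels are unbalanced, so at least half of [c / 2] remains. *)
apply: (@le_trans _ _ (labE (fun s : labels n => c / 2 + - (c / 2) * (~~ balanced eps s)%:R))).
  rewrite labED labE_cst labEZ.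
  have := @labE_unbalanced R n eps e01.
  set U := labE _; have : expR (- (eps ^+ 2 / 8) * n%:R) <= 4^-1.
    rewrite mulNr; apply: expRN_le_inv => //.
    have : 24 <= n%:R * eps ^+ 2 by rewrite -ler_pdivrMr // exprn_gt0.
    by clear -p01 q01 t0 tau; lra.
  move=> h1 h2; have : U <= 2^-1 by clear -p01 q01 t0 tau h1 h2; lra.
  by move=> /(ler_wpM2l c0); clear -p01 q01 t0 tau; lra.
apply: ler_labE => s; case: (boolP (balanced eps s)) => [/bal|_] /=.
  by rewrite mulr0 addr0.
by rewrite mulr1 subrr.
Unshelve. all: by end_near. Qed.

(* [wrong] flips together with the label of u, so on each pair s, flip s u it
   is wrong on exactly one side, and Bayes risk is bounded below by min. *)
Lemma labE_wrong_ge n (al : R) (al01 : 0 < al < 1) (u : 'I_n)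
    (wrong : labels n -> pred (observation n)) :
  (forall s g, wrong (flip s u) g = ~~ wrong s g) ->
  labE (fun s => \sum_g Num.min (lik p q al s g) (lik p q al (flip s u) g)) <=
  2 * labE (fun s => prodPr (obs_pmf p q al s) (wrong s)).
Proof.
move=> wf; rewrite mulr_natl mulr2n -[X in _ <= _ + X](labE_flip u) -labED.
apply: ler_labE => s; rewrite !prodPrE /prodE -big_split; apply: ler_sum => g _ /=.
rewrite -!/(lik _ _ _ _ _) wf; case: (wrong s g); rewrite ?mulr0 ?mulr1 ?addr0 ?add0r.
  by rewrite ge_min lexx.
by rewrite ge_min lexx orbT.
Qed.

(** [wrong] is left abstract for two uses: the error of the genie at [u], and the event that an
    arbitrary estimator errs at exactly one of two vertices. *)
Lemma near_labE_wrong_ge (d : R) : 0 < d ->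
  \forall n \near \oo, forall (u : 'I_n) (wrong : labels n -> pred (observation n)),
    (forall s g, wrong (flip s u) g = ~~ wrong s g) ->
    expR (- (tau + d) * ln n%:R) <=
    labE (fun s => prodPr (pmf n s) (wrong s)).
Proof.
move=> d0; have d2 : 0 < d / 2 by rewrite divr_gt0.
near=> n => u wrong wf.
have l2 : 2 / d <= ln n%:R :> R by near: n; exact: near_ln_ge.
have /andP[a0 a1] : 0 < al n <= 2^-1.
  by near: n; apply: near_reveal_prob => //; rewrite invr_gt0.
have a01 : 0 < al n < 1 by rewrite a0 /=; lra.
have H : expR (- (tau + d / 2) * ln n%:R) <=
    labE (fun s => \sum_g Num.min (L n s g) (L n (flip s u) g)).
  by move: u {wf wrong}; near: n; exact: near_sum_min_lik_ge.
have := le_trans H (labE_wrong_ge a01 wf).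
rewrite -ler_pdivrMl // => /(le_trans _); apply.
have -> : - (tau + d) * ln n%:R = - (d / 2 * ln n%:R) + - (tau + d / 2) * ln n%:R by lra.
rewrite expRD ler_wpM2r ?expR_ge0 //.
have h : 2 <= d * ln n%:R by rewrite mulrC -ler_pdivrMr.
by apply: expRN_le_inv => //; lra.
Unshelve. all: by end_near. Qed.

Lemma genie_wrong_le n (a : R) (a01 : 0 < a < 1) (s : labels n) u :
  prodPr (obs_pmf p q a s) (genie_wrong p q a s u) <=
  (1 - a * (1 - affinity p q)) ^+ n.-1.
Proof.
have := vertex_llr_tail p01 q01 a01 s u 0; rewrite mul0r expR0 mul1r.
apply: le_trans; apply: ler_prodPr; first exact: obs_pmfP.
by move=> g; exact: genie_wrong_llr.
Qed.

(** Two errors force both log-likelihood ratios to be nonpositive. Chernoff with exponent one half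
    on each turns the likelihood of [s] into the geometric mean of those of [flip s u] and
    [flip s v], so the affinity of these two labelings appears, without any independence
    argument. *)
Lemma genie_wrong2_le n (a : R) (a01 : 0 < a < 1) (s : labels n) u v : u != v ->
  prodPr (obs_pmf p q a s) (fun g => genie_wrong p q a s u g && genie_wrong p q a s v g) <=
  (1 - a * (1 - affinity p q)) ^+ (n.-2).*2.
Proof.
move=> uv; rewrite -(sum_sqrt_lik_flip2 p01 q01 a01 s uv).
pose F g := expR (- (vertex_llr p q s g u / 2)) * expR (- (vertex_llr p q s g v / 2)).
have -> : \sum_g Num.sqrt (lik p q a (flip s u) g * lik p q a (flip s v) g) =
    prodE (obs_pmf p q a s) F.
  apply: eq_bigr => g _; rewrite -/(lik p q a s g).
  have L0 : 0 < lik p q a s g by exact: lik_gt0.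
  have L0' : 0 <= lik p q a s g := ltW L0.
  apply: (mulfI (lt0r_neq0 L0)).
  have Lf w : 0 <= lik p q a (flip s w) g by apply/ltW/lik_gt0.
  have sq w : Num.sqrt (lik p q a s g) * Num.sqrt (lik p q a (flip s w) g) =
      lik p q a s g * expR (- (vertex_llr p q s g w / 2)).
    by rewrite -sqrtrM // sqrt_lik_flip.
  by rewrite -{1}(sqr_sqrtr L0') expr2 sqrtrM // mulrACA !sq mulrACA -mulrA.
apply: prodPr_markov => [|g|g /andP[/genie_wrong_llr hu /genie_wrong_llr hv]].
- exact: obs_pmfP.
- by rewrite mulr_ge0 ?expR_ge0.
have {}hu := hu p01 q01 a01; have {}hv := hv p01 q01 a01.
by rewrite /F -expRD -[leLHS]expR0 ler_expR; lra.
Qed.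

Lemma mismatch_label n (est : labels n) (s : labels n) :
  mismatch (fun i => spin R (est i)) s 1 = n%:R^-1 * \sum_i (est i != s i)%:R :> R.
Proof.
rewrite /mismatch; congr (_ * _); apply: eq_bigr => i _; rewrite mul1r.
congr (_ %:R); congr nat_of_bool; rewrite /spin.
by case: (est i); case: (s i); rewrite ?eqxx //= ?[-1 == _]eq_sym -subr_eq0 opprK
  -(natrD _ 1 1) pnatr_eq0.
Qed.

Lemma mismatch_labelN n (est : labels n) (s : labels n) : (0 < n)%N ->
  mismatch (fun i => spin R (est i)) s (-1) =
  1 - n%:R^-1 * \sum_i (est i != s i)%:R :> R.
Proof.
move=> n0; rewrite /mismatch.
have n0R : n%:R != 0 :> R by rewrite pnatr_eq0 -lt0n.
rewrite -[X in X - _](mulVf n0R) -mulrBr; congr (_ * _).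
have -> : n%:R = \sum_(i < n) (1 : R) by rewrite sumr_const card_ord.
rewrite -sumrB; apply: eq_bigr => i _; rewrite /spin.
by case: (est i); case: (s i); rewrite /= ?mulr1 ?mulrN1 ?opprK ?eqxx ?subr0 ?subrr //
  ?[-1 == _]eq_sym -subr_eq0 opprK -(natrD _ 1 1) pnatr_eq0.
Qed.

Lemma mismatch01 n (est : labels n) (s : labels n) :
  0 <= (n%:R^-1 * \sum_i (est i != s i)%:R : R) <= 1.
Proof.
rewrite mulr_ge0 ?invr_ge0 ?sumr_ge0 //=.
case: n est s => [|n] est s; first by rewrite big_ord0 mulr0.
rewrite mulrC ler_pdivrMr // mul1r -[in leRHS](card_ord n.+1) -sumr_const.
by apply: ler_sum => i _; case: (_ == _).
Qed.

Lemma Err_bestE n (a01 : 0 < al n < 1) : (0 < n)%N ->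
  Err p q (al n) (@sigma_best R p q (al n) n) =
  labE (fun s : labels n => prodE (pmf n s) (fun g =>
    Num.min (n%:R^-1 * \sum_u (genie_wrong p q (al n) s u g)%:R)
     (1 - n%:R^-1 * \sum_u (genie_wrong p q (al n) s u g)%:R))).
Proof.
move=> n0.
pose est (s : labels n) (g : observation n) i := spin R (best_label p q (al n) s g i).
transitivity (Err p q (al n) (fun w : sample n => est (lab w) (observe w))).
  rewrite /Err /csbm_E; apply: eq_bigr => w _; congr (_ * Num.min _ _);
  rewrite /mismatch; congr (_ * _); apply: eq_bigr => i _;
    by rewrite sigma_bestE.
rewrite (Err_lab p q (al n) est); congr (_ * _); apply: eq_bigr => s _.
apply: eq_bigr => g _; rewrite /est.
have E : (fun i => spin R (best_label p q (al n) s g i)) =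
    (fun i => spin R ([ffun i => best_label p q (al n) s g i] i)).
  by apply/funext => i; rewrite ffunE.
rewrite E mismatch_label mismatch_labelN //.
have -> : \sum_i ([ffun i => best_label p q (al n) s g i] i != s i)%:R =
   \sum_u (genie_wrong p q (al n) s u g)%:R :> R.
  by apply: eq_bigr => i _; rewrite ffunE.
by [].
Qed.

Lemma near_Err_best_le (d : R) : 0 < d -> \forall n \near \oo,
  Err p q (al n) (@sigma_best R p q (al n) n) <= expR (- (tau - d) * ln n%:R).
Proof.
move=> d0; near=> n.
have n2 : 2 <= n%:R :> R by near: n; exact: near_natr_ge.
have /andP[a0 a1] : 0 < al n <= 2^-1.
  by near: n; apply: near_reveal_prob => //; rewrite invr_gt0.
have a01 : 0 < al n < 1 by rewrite a0 /=; clear -p01 q01 t0 tau a1; lra.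
have bpow : forall k, (k <= 2)%N -> beta n ^+ (n - k) <= expR (- (tau - d) * ln n%:R).
  by near: n; exact: near_affinity_pow_le.
have n0 : 0 < n%:R :> R by apply: lt_le_trans n2.
rewrite Err_bestE //; last by rewrite -(ltr_nat R).
apply: le_trans (bpow 1%N isT); rewrite subn1 -[leRHS](@labE_cst R n).
apply: ler_labE => s.
apply: (@le_trans _ _ (prodE (pmf n s) (fun g =>
   n%:R^-1 * \sum_u (genie_wrong p q (al n) s u g)%:R))).
  apply: ler_prodE => [|g]; first exact: obs_pmfP.
  by rewrite ge_min lexx.
rewrite prodE_linear mulrC ler_pdivrMr // mulr_natr.
rewrite -[X in _ *+ X]card_ord -sumr_const; apply: ler_sum => u _.
by rewrite -prodPrE; exact: genie_wrong_le.
Unshelve. all: by end_near. Qed.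

(** With m the fraction of genie errors, min(m, 1 - m) >= m - m^2, so the minimum over the global
    sign costs a second moment. Its diagonal is at most half of the first moment, and its
    off-diagonal part is at most [B], of smaller order because tau > 0. *)
Lemma near_Err_best_ge (d : R) : p != q -> 0 < d -> \forall n \near \oo,
  expR (- (tau + d) * ln n%:R) <= Err p q (al n) (@sigma_best R p q (al n) n).
Proof.
move=> pq d0.
have tau0 : 0 < tau by rewrite mulr_gt0 // subr_gt0 affinity_lt1.
have d2 : 0 < d / 2 by rewrite divr_gt0.
near=> n.
have n2 : 2 <= n%:R :> R by near: n; exact: near_natr_ge.
have l1 : 18 / d <= ln n%:R :> R by near: n; exact: near_ln_ge.
have l2 : 6 / tau <= ln n%:R :> R by near: n; exact: near_ln_ge.
have /andP[a0 a1] : 0 < al n <= 2^-1.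
  by near: n; apply: near_reveal_prob => //; rewrite invr_gt0.
have a01 : 0 < al n < 1 by rewrite a0 /=; clear -p01 q01 t0 tau a1; lra.
have bpow : forall k, (k <= 2)%N -> beta n ^+ (n - k) <= expR (- (tau - tau / 4) * ln n%:R).
  by near: n; apply: near_affinity_pow_le => //; rewrite divr_gt0.
(* The slack is below [d / 2] to leave room for constants, and below [tau / 4] so that the first
   moment dominates [B], which is at most n^(-3 tau / 2). *)
have Hw : forall (u : 'I_n) (wrong : labels n -> pred (observation n)),
    (forall s g, wrong (flip s u) g = ~~ wrong s g) ->
    expR (- (tau + Num.min (d / 2) (tau / 4)) * ln n%:R) <=
    labE (fun s => prodPr (pmf n s) (wrong s)).
  near: n; apply: near_labE_wrong_ge => //.
  by rewrite lt_min d2 divr_gt0.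
have n0 : 0 < n%:R :> R by apply: lt_le_trans n2.
have npos : (0 < n)%N by rewrite -(ltr_nat R).
rewrite Err_bestE //.
set l := ln n%:R in l1 l2 bpow Hw *.
set d' := Num.min _ _ in Hw.
pose w (s : labels n) u := genie_wrong p q (al n) s u.
have B0 : 0 <= beta n.
  have := affinity_ge0 p q; have := affinity_le1 p01 q01; nra.
set B := beta n ^+ (n.-2).*2.
have B0' : 0 <= B by rewrite exprn_ge0.
have Ble : B <= expR (- (tau + tau / 2) * l).
  have := bpow 2%N isT; rewrite subn2 => h.
  rewrite /B -muln2 exprM -(_ : expR (- (tau - tau / 4) * l) ^+ 2 = expR (- (tau + tau / 2) * l)).
    by rewrite lerXn2r ?nnegrE ?expR_ge0 ?exprn_ge0.
  by rewrite -expRM_natl; congr expR; clear -p01 q01 t0 tau; lra.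
have pointwise s : (n%:R^-1 / 2) * \sum_u prodPr (pmf n s) (w s u) - B <=
   prodE (pmf n s) (fun g =>
    Num.min (n%:R^-1 * \sum_u (w s u g)%:R) (1 - n%:R^-1 * \sum_u (w s u g)%:R)).
  have fP := obs_pmfP p01 q01 a01 s.
  apply: (@le_trans _ _ (prodE (pmf n s) (fun g =>
     n%:R^-1 * \sum_u (w s u g)%:R -
     (n%:R^-1 ^+ 2) * \sum_u \sum_v (w s u g && w s v g)%:R))); last first.
    apply: ler_prodE => // g.
    set m := n%:R^-1 * _.
    have m01 : 0 <= m <= 1.
      have := @mismatch01 n [ffun i => best_label p q (al n) s g i] s.
      by under eq_bigr do rewrite ffunE.
    have -> : n%:R^-1 ^+ 2 * (\sum_u \sum_v (w s u g && w s v g)%:R) = m ^+ 2.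
      rewrite /m exprMn; congr (_ * _); rewrite expr2 mulr_suml; apply: eq_bigr => u _.
      by rewrite mulr_sumr; apply: eq_bigr => v _; rewrite -natrM mulnb.
    have m2 : m ^+ 2 <= m by case/andP: m01 => m0 m1; rewrite expr2 ler_piMr.
    rewrite le_min; apply/andP; split; first by rewrite gerBl sqr_ge0.
    by have := sqr_ge0 (1 - m); clear -p01 q01 t0 tau; lra.
  rewrite prodEB !prodE_linear.
  have -> : \sum_u prodE (pmf n s) (fun g => (w s u g)%:R) =
    \sum_u prodPr (pmf n s) (w s u).
    by apply: eq_bigr => u _; rewrite prodPrE.
  set P := \sum_u prodPr _ _.
  have P0 : 0 <= P by apply: sumr_ge0 => u _; exact: prodPr_ge0.
  have H : \sum_u prodE (pmf n s) (fun g => \sum_v (w s u g && w s v g)%:R) <=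
      P + n%:R ^+ 2 * B.
    apply: (@le_trans _ _ (\sum_(u < n) (prodPr (pmf n s) (w s u) + n%:R * B))).
      apply: ler_sum => u _.
      have -> : prodE (pmf n s) (fun g => \sum_v (w s u g && w s v g)%:R) =
        \sum_v prodPr (pmf n s) (fun g => w s u g && w s v g).
        have := prodE_linear (pmf n s) xpredT 1
          (fun (v : 'I_n) g => (w s u g && w s v g)%:R).
        rewrite mul1r => h; under [RHS]eq_bigr do rewrite prodPrE.
        by rewrite -h; apply: eq_bigr => g _; rewrite mul1r.
      rewrite (bigD1 u) //=; apply: lerD.
        by apply: ler_prodPr => // g /andP[].
      apply: (@le_trans _ _ (\sum_(v < n | v != u) B)).
        by apply: ler_sum => v vu; apply: genie_wrong2_le => //; rewrite eq_sym.
      rewrite sumr_const -(mulr_natl B) ler_wpM2r // ler_nat.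
      by rewrite -[leqRHS](card_ord n) max_card.
    rewrite big_split /= -/P sumr_const card_ord lerD2l -(mulr_natl (n%:R * B)) mulrA -expr2 //.
  have ni0 : 0 < n%:R^-1 :> R by rewrite invr_gt0.
  have nn : n%:R^-1 * n%:R = 1 :> R by rewrite mulVf ?gt_eqF.
  have ni2 : n%:R^-1 <= 2^-1 :> R by rewrite lef_pV2 ?posrE.
  have := ler_wpM2l (sqr_ge0 n%:R^-1) H.
  have -> : n%:R^-1 ^+ 2 * (P + n%:R ^+ 2 * B) = n%:R^-1 ^+ 2 * P + B.
    by rewrite mulrDr mulrA -exprMn nn expr1n mul1r.
  have : n%:R^-1 ^+ 2 * P <= n%:R^-1 / 2 * P by rewrite ler_wpM2r // expr2 ler_wpM2l // ltW.
  by clear -p01 q01 t0 tau; lra.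
have := ler_labE pointwise; apply: le_trans.
rewrite labED labE_cst labEZ labE_sum.
have Pu : n%:R * expR (- (tau + d') * l) <=
    \sum_u labE (fun s => prodPr (pmf n s) (w s u)).
  rewrite mulr_natl -[X in _ *+ X]card_ord -sumr_const; apply: ler_sum => u _.
  apply: (Hw u (fun s => w s u)) => s g; rewrite /w /genie_wrong best_label_flip ffunE eqxx.
  by case: (best_label _ _ _ _ _ _); case: (s u).
have : expR (- (tau + d') * l) / 2 <= n%:R^-1 / 2 *
    \sum_u labE (fun s => prodPr (pmf n s) (w s u)).
  have -> : expR (- (tau + d') * l) / 2 = n%:R^-1 / 2 * (n%:R * expR (- (tau + d') * l)).
    by rewrite mulrAC mulrA mulVf ?gt_eqF // mul1r.
  by rewrite ler_wpM2l // divr_ge0 // invr_ge0 ltW.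
have d1 : d' <= d / 2 by rewrite /d' ge_min lexx.
have d4 : d' <= tau / 4 by rewrite /d' ge_min lexx orbT.
have dl : 18 <= d * l by rewrite mulrC -ler_pdivrMr.
have tl : 6 <= tau * l by rewrite mulrC -ler_pdivrMr.
have l0 : 0 < l by apply: lt_le_trans l1; rewrite divr_gt0.
(* Half of the first moment is available; [B] takes 2/5 of it at most, and the tenth that is left
   dominates the claimed bound. *)
have E1 : B <= expR (- (tau + d') * l) * (2 / 5).
  apply: le_trans Ble _.
  have -> : - (tau + tau / 2) * l = - (tau + d') * l + - ((tau / 2 - d') * l) by clear -p01 q01 t0 tau; lra.
  rewrite expRD ler_wpM2l ?expR_ge0 // -[2 / 5](_ : (5 / 2)^-1 = _); last by rewrite invf_div.
  apply: expRN_le_inv; first by rewrite divr_gt0.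
  by have := ler_wpM2r (ltW l0) d4; clear -p01 q01 t0 tau tl; lra.
have E2 : expR (- (tau + d) * l) <= expR (- (tau + d') * l) * (1 / 10).
  have -> : - (tau + d) * l = - (tau + d') * l + - ((d - d') * l) by clear -p01 q01 t0 tau; lra.
  rewrite expRD ler_wpM2l ?expR_ge0 //.
  have h : 9 <= (d - d') * l by have := ler_wpM2r (ltW l0) d1; clear -p01 q01 t0 tau dl; lra.
  by rewrite mul1r; apply: expRN_le_inv => //; clear -p01 q01 t0 tau h; lra.
by move=> h; clear -p01 q01 t0 tau h E1 E2; lra.
Unshelve. all: by end_near. Qed.

(** For a fraction k of errors, min(k, 1 - k) >= k (1 - k), and k (1 - k) is half the density of
    ordered pairs with exactly one error. That event ignores the global sign, and flipping one of
    the two labels switches it, so the two-point bound applies to it. *)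
Lemma near_Err_ge (d : R) : 0 < d -> \forall n \near \oo,
  forall est : observation n -> 'I_n -> R,
  expR (- (tau + d) * ln n%:R) <= Err p q (al n) (fun w i => est (observe w) i).
Proof.
move=> d0; have d2 : 0 < d / 2 by rewrite divr_gt0.
near=> n.
have n2 : 2 <= n%:R :> R by near: n; exact: near_natr_ge.
have l1 : 6 / d <= ln n%:R :> R by near: n; exact: near_ln_ge.
have /andP[a0 a1] : 0 < al n <= 2^-1.
  by near: n; apply: near_reveal_prob => //; rewrite invr_gt0.
have a01 : 0 < al n < 1 by rewrite a0 /=; clear -p01 q01 t0 tau a1; lra.
have Hw : forall (u : 'I_n) (wrong : labels n -> pred (observation n)),
    (forall s g, wrong (flip s u) g = ~~ wrong s g) ->
    expR (- (tau + d / 2) * ln n%:R) <=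
    labE (fun s => prodPr (pmf n s) (wrong s)).
  by near: n; exact: near_labE_wrong_ge.
move=> est.
have n0 : 0 < n%:R :> R by apply: lt_le_trans n2.
have npos : (0 < n)%N by rewrite -(ltr_nat R).
rewrite (Err_lab p q (al n) (fun=> est)) -/(labE _).
(* Nonpositive values are read as the label -1. A value other than 1 and -1 already counts as a
   mistake for both global signs, so this reading can only lower both mismatches. *)
pose err (s : labels n) (g : observation n) u : bool := (0 < est g u) != s u.
pose dis s g u v : bool := err s g u (+) err s g v.
set l := ln n%:R in l1 Hw *.
have n1 : n%:R^-1 <= 2^-1 :> R by rewrite lef_pV2 ?posrE.
have ni0 : 0 < n%:R^-1 :> R by rewrite invr_gt0.
have point s g : (2 * n%:R ^+ 2)^-1 * \sum_u \sum_(v | v != u) (dis s g u v)%:R <=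
    Num.min (mismatch (est g) s 1) (mismatch (est g) s (-1)).
  pose k : R := n%:R^-1 * \sum_u (err s g u)%:R.
  have k01 : 0 <= k <= 1.
    have := @mismatch01 n [ffun i => 0 < est g i] s.
    by under eq_bigr do rewrite ffunE.
  have m1 : k <= mismatch (est g) s 1.
    rewrite ler_wpM2l ?(ltW ni0) //; apply: ler_sum => i _; rewrite mul1r /err.
    case: (eqVneq (est g i)) => [->|_]; last by rewrite ler_nat leq_b1.
    by rewrite spin_gt0 eqxx.
  have m2 : 1 - k <= mismatch (est g) s (-1).
    rewrite -[X in X - _](@mulVf _ n%:R) ?gt_eqF // -mulrBr ler_wpM2l ?(ltW ni0) //.
    rewrite -[X in X%:R - _](card_ord n) -sumr_const -sumrB; apply: ler_sum => i _.
    rewrite /err; case: (eqVneq (est g i)) => [->|_]; last by rewrite lerBlDr lerDl.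
    by rewrite -spinN spin_gt0; case: (s i); rewrite /= subrr.
  have -> : (2 * n%:R ^+ 2)^-1 * \sum_u \sum_(v | v != u) (dis s g u v)%:R = k * (1 - k).
    have -> : \sum_u \sum_(v | v != u) (dis s g u v)%:R =
        \sum_u \sum_v ((err s g u)%:R + (err s g v)%:R - 2 * (err s g u)%:R * (err s g v)%:R) :> R.
      apply: eq_bigr => u _; rewrite [RHS](bigD1 u) //= [X in X + _](_ : _ = 0).
        rewrite add0r; apply: eq_bigr => v _; rewrite /dis.
        by case: (err s g u); case: (err s g v) => /=; clear -p01 q01 t0 tau; lra.
      by case: (err s g u); rewrite /=; clear -p01 q01 t0 tau; lra.
    under eq_bigr => u _.
      rewrite sumrB big_split /= -mulr_sumr sumr_const card_ord.
      over.
    rewrite sumrB big_split /= -mulr_suml -mulr_sumr sumrMnl sumr_const card_ord.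
    rewrite /k; set K := \sum_u _; rewrite -(mulr_natr K); field.
    by rewrite gt_eqF.
  case/andP: k01 => k0 k1; rewrite le_min; apply/andP; split.
    by apply: le_trans m1; rewrite ler_piMr // gerBl.
  by apply: le_trans m2; rewrite ler_piMl // subr_ge0.
apply: (@le_trans _ _ (labE (fun s => prodE (pmf n s) (fun g =>
  (2 * n%:R ^+ 2)^-1 * \sum_u \sum_(v | v != u) (dis s g u v)%:R)))); last first.
  by apply: ler_labE => s; apply: ler_prodE => //; exact: obs_pmfP.
have -> : labE (fun s => prodE (pmf n s) (fun g =>
    (2 * n%:R ^+ 2)^-1 * \sum_u \sum_(v | v != u) (dis s g u v)%:R)) =
  (2 * n%:R ^+ 2)^-1 * \sum_u \sum_(v | v != u)
    labE (fun s => prodPr (pmf n s) (fun g => dis s g u v)).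
  under eq_bigr do rewrite -labE_sum.
  rewrite -labE_sum -labEZ; congr (_ * _); apply: eq_bigr => s _.
  rewrite prodE_linear; congr (_ * _); apply: eq_bigr => u _.
  have := prodE_linear (pmf n s) (fun v => v != u) 1
      (fun (v : 'I_n) g => (dis s g u v)%:R).
  rewrite mul1r => h; under [RHS]eq_bigr do rewrite prodPrE.
  by rewrite -h; apply: eq_bigr => g _; rewrite mul1r.
apply: (@le_trans _ _ ((2 * n%:R ^+ 2)^-1 * \sum_(u < n) \sum_(v < n | v != u)
    expR (- (tau + d / 2) * l))); last first.
  rewrite ler_wpM2l ?invr_ge0 ?mulr_ge0 ?exprn_ge0 //.
  apply: ler_sum => u _; apply: ler_sum => v vu; apply: (Hw u) => s g.
  rewrite /dis /err !ffunE eqxx (negPf vu).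
  by case: (0 < _); case: (0 < _); case: (s u); case: (s v).
under eq_bigr => u _.
  rewrite sumr_const (_ : #|[pred v | v != u]| = n.-1); last first.
    by have := cardC1 u; rewrite card_ord.
  over.
rewrite sumr_const card_ord -mulrnA -(mulr_natl (expR _)) natrM mulrA.
have -> : (2 * n%:R ^+ 2)^-1 * (n.-1%:R * n%:R) = (1 - n%:R^-1) / 2 :> R.
  have -> : n.-1%:R = n%:R - 1 :> R by rewrite -subn1 natrB.
  field.
  by rewrite gt_eqF.
have -> : - (tau + d) * l = - (tau + d / 2) * l + - (d / 2 * l) by clear -p01 q01 t0 tau; lra.
rewrite expRD mulrC; apply: ler_wpM2r; first exact: expR_ge0.
have dl : 6 <= d * l by rewrite mulrC -ler_pdivrMr.
apply: (@le_trans _ _ 4^-1); last by clear -p01 q01 t0 tau n1; lra.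
by apply: expRN_le_inv => //; clear -p01 q01 t0 tau dl; lra.
Unshelve. all: by end_near. Qed.

End GenieError.

(** * Quadratic forms *)

Section Vectors.
Context {R : realType} {n : nat}.
Implicit Types (x y z : 'I_n -> R) (a : 'I_n -> 'I_n -> R).

Definition dotp x y : R := \sum_i x i * y i.
Definition norm2 x : R := \sum_i x i ^+ 2.
Definition app a x : 'I_n -> R := fun i => \sum_j a i j * x j.
Definition qform a x : R := \sum_i \sum_j a i j * (x i * x j).
Definition symm a : Prop := forall i j, a i j = a j i.

Lemma norm2_ge0 x : 0 <= norm2 x.
Proof. by apply: sumr_ge0 => i _; exact: sqr_ge0. Qed.

Lemma norm2_eq0 x i : norm2 x = 0 -> x i = 0.
Proof.
move/eqP; rewrite psumr_eq0 => [/allP/(_ i (mem_index_enum _))|j _]; last exact: sqr_ge0.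
by rewrite sqrf_eq0 => /eqP.
Qed.

Lemma dotpC x y : dotp x y = dotp y x.
Proof. by apply: eq_bigr => i _; rewrite mulrC. Qed.

Lemma dotpxx x : dotp x x = norm2 x.
Proof. by apply: eq_bigr => i _; rewrite expr2. Qed.

Lemma qformE a x : qform a x = dotp x (app a x).
Proof.
apply: eq_bigr => i _; rewrite mulr_sumr; apply: eq_bigr => j _.
by rewrite mulrCA.
Qed.

Lemma dotp_app a x y : symm a -> dotp x (app a y) = dotp (app a x) y.
Proof.
move=> sa; rewrite /dotp /app; under eq_bigr do rewrite mulr_sumr.
rewrite exchange_big; apply: eq_bigr => j _ /=; rewrite mulr_suml.
by apply: eq_bigr => i _; rewrite (sa i j) mulrCA mulrA.
Qed.

Lemma dotp_lin (c : R) x y z : dotp (fun i => x i + c * y i) z = dotp x z + c * dotp y z.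
Proof.
by rewrite /dotp mulr_sumr -big_split; apply: eq_bigr => i _ /=; rewrite mulrDl mulrA.
Qed.

Lemma dotp_linr (c : R) x y z : dotp z (fun i => x i + c * y i) = dotp z x + c * dotp z y.
Proof. by rewrite dotpC dotp_lin !(dotpC z). Qed.

Lemma app_lin (c : R) a x y : app a (fun i => x i + c * y i) = (fun i => app a x i + c * app a y i).
Proof.
apply/funext => i; rewrite /app mulr_sumr -big_split; apply: eq_bigr => j _ /=.
by ring.
Qed.

Lemma norm2_lin (c : R) x y :
  norm2 (fun i => x i + c * y i) = norm2 x + 2 * c * dotp x y + c ^+ 2 * norm2 y.
Proof.
by rewrite -!dotpxx dotp_lin !dotp_linr (dotpC y x); ring.
Qed.

Lemma qform_lin (c : R) a x y : symm a ->
  qform a (fun i => x i + c * y i) = qform a x + 2 * c * dotp (app a x) y + c ^+ 2 * qform a y.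
Proof.
move=> sa; rewrite !qformE app_lin dotp_lin !dotp_linr (dotpC y (app a x)) (dotp_app x y sa).
by ring.
Qed.

Lemma qformZ (c : R) a x : qform a (fun i => c * x i) = c ^+ 2 * qform a x.
Proof.
rewrite /qform mulr_sumr; apply: eq_bigr => i _; rewrite mulr_sumr.
by apply: eq_bigr => j _; ring.
Qed.

Lemma norm2Z (c : R) x : norm2 (fun i => c * x i) = c ^+ 2 * norm2 x.
Proof. by rewrite /norm2 mulr_sumr; apply: eq_bigr => i _; rewrite exprMn. Qed.

Lemma dotpZl (c : R) x y : dotp (fun i => c * x i) y = c * dotp x y.
Proof. by rewrite /dotp mulr_sumr; apply: eq_bigr => i _; rewrite mulrA. Qed.

Lemma cauchy_schwarz x y : dotp x y ^+ 2 <= norm2 x * norm2 y.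
Proof.
have [x0|xn0] := eqVneq (norm2 x) 0.
  have xz i := norm2_eq0 i x0.
  by rewrite /dotp big1 ?x0 ?mul0r ?expr0n // => i _; rewrite xz mul0r.
have xp : 0 < norm2 x by rewrite lt_def xn0 norm2_ge0.
have := norm2_ge0 (fun i => y i + (- dotp x y / norm2 x) * x i).
rewrite norm2_lin (dotpC y x).
have -> : norm2 y + 2 * (- dotp x y / norm2 x) * dotp x y +
    (- dotp x y / norm2 x) ^+ 2 * norm2 x = norm2 y - dotp x y ^+ 2 / norm2 x.
  by field.
by rewrite subr_ge0 ler_pdivrMr // mulrC.
Qed.

End Vectors.

(** * Maximisers of the Rayleigh quotient *)

Section Rayleigh.
Context {R : realType}.

Lemma continuous_sumr (T : topologicalType) (I : Type) (r : seq I) (F : I -> T -> R) :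
  (forall i, continuous (F i)) -> continuous (fun x => \sum_(i <- r) F i x).
Proof.
move=> cF; elim: r => [|i r IH] x.
  by under eq_fun do rewrite big_nil; exact: cvg_cst.
by under eq_fun do rewrite big_cons; apply: cvgD; [exact: cF|exact: IH].
Qed.

Lemma continuous_qform n (a : 'I_n -> 'I_n -> R) :
  continuous (fun v : 'rV[R]_n => qform a (fun i => v 0 i)).
Proof.
rewrite /qform.
apply: (@continuous_sumr 'rV[R]_n _ _
  (fun i (v : 'rV[R]_n) => \sum_j a i j * (v 0 i * v 0 j))) => i.
apply: (@continuous_sumr 'rV[R]_n _ _
  (fun j (v : 'rV[R]_n) => a i j * (v 0 i * v 0 j))) => j v.
have c k : {for v, continuous (fun u : 'rV[R]_n => u 0 k)}.
  exact: coord_continuous.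
have h := continuousM (c i) (c j).
exact: (cvgMl_tmp h).
Qed.

Lemma qform_max n (a : 'I_n.+1 -> 'I_n.+1 -> R) : exists v : 'rV[R]_n.+1,
  norm2 (fun i => v 0 i) = 1 /\
  forall x, qform a x <= qform a (fun i => v 0 i) * norm2 x.
Proof.
(* The squared norm is written as the quadratic form of the identity, so that [continuous_qform]
   also shows that the sphere is closed. *)
pose N := fun v : 'rV[R]_n.+1 => qform (fun i j => (i == j)%:R) (fun i => v 0 i).
have NE v : N v = norm2 (fun i => v 0 i).
  rewrite /N /qform; apply: eq_bigr => i _.
  rewrite (bigD1 i) //= eqxx mul1r big1 ?addr0 ?expr2 // => j.
  by rewrite eq_sym => /negPf->; rewrite mul0r.
pose S : set 'rV[R]_n.+1 := N @^-1` [set 1].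
have clS : closed S.
  apply: preimage_closed; last exact: closed_eq.
  by move=> v _; exact: continuous_qform.
have S0 : S !=set0.
  exists (\row_i (i == ord0)%:R); rewrite /S /= NE /norm2 (bigD1 ord0) //= mxE eqxx.
  rewrite big1 ?addr0 ?expr1n // => i /negPf i0.
  by rewrite mxE i0 expr0n.
have cS : compact S.
  pose K : set 'rV[R]_n.+1 := [set v | forall i, `[-1, 1]%classic (v ord0 i)].
  have cK : compact K.
    by apply: (@rV_compact R n.+1 (fun=> `[-1, 1]%classic)) => _; exact: segment_compact.
  apply: subclosed_compact clS cK _ => v; rewrite /S /= NE => v1 i /=.
  rewrite in_itv /= -ler_norml -(ler_pXn2r (n := 2)) ?nnegrE //.
  rewrite expr1n real_normK ?num_real // -v1 /norm2 (bigD1 i) //= lerDl.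
  by apply: sumr_ge0 => j _; exact: sqr_ge0.
have [v vS vmax] := compact_EVT_max S0 cS (continuous_subspaceT (@continuous_qform _ a)).
exists v; rewrite inE in vS; move: (vS); rewrite /S /= NE => v1; split => // x.
have [x0|xn0] := eqVneq (norm2 x) 0.
  have xz i := norm2_eq0 i x0.
  rewrite x0 mulr0 /qform big1 // => i _; rewrite big1 // => j _.
  by rewrite xz mul0r mulr0.
have xp : 0 < norm2 x by rewrite lt_def xn0 norm2_ge0.
pose c := (Num.sqrt (norm2 x))^-1.
have c2 : c ^+ 2 = (norm2 x)^-1 by rewrite /c exprVn sqr_sqrtr // ltW.
have := vmax (\row_i (c * x i)).
have E : (fun i => (\row_i0 (c * x i0)) ord0 i) = (fun i => c * x i).
  by apply/funext => i; rewrite mxE.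
rewrite inE /S /= NE E norm2Z qformZ c2 mulVf // => /(_ erefl).
by rewrite mulrC ler_pdivrMr.
Qed.

(* At a maximiser v of the Rayleigh quotient, the quadratic
   e |-> qform a (v + e y) - mu |v + e y|^2 is nonpositive and vanishes at 0,
   so its linear coefficient, for y = a v - mu v, is zero. *)
Lemma qform_max_eigen n (a : 'I_n -> 'I_n -> R) (v : 'I_n -> R) (mu : R) :
  symm a -> norm2 v = 1 -> qform a v = mu ->
  (forall x, qform a x <= mu * norm2 x) -> forall i, app a v i = mu * v i.
Proof.
move=> sa v1 vmu vmax.
pose y i := app a v i + (- mu) * v i.
have key e : 2 * e * norm2 y + e ^+ 2 * (qform a y - mu * norm2 y) <= 0.
  have := vmax (fun i => v i + e * y i).
  rewrite qform_lin // norm2_lin v1 vmu.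
  have -> : norm2 y = dotp (app a v) y - mu * dotp v y.
    by rewrite -dotpxx {1}/y dotp_lin mulNr.
  lra.
have y0 : norm2 y = 0.
  apply/eqP; rewrite eq_le norm2_ge0 andbT leNgt; apply/negP => yp.
  set c := qform a y - mu * norm2 y in key.
  pose e := norm2 y / (`|c| + 1).
  have d0 : 0 < `|c| + 1 by rewrite ltr_wpDl.
  have e0 : 0 < e by rewrite divr_gt0.
  have := key e; apply/negP; rewrite -ltNge.
  have ec : e * `|c| <= norm2 y.
    by rewrite /e mulrAC ler_pdivrMr // ler_pM2l //; lra.
  have : - (e * `|c|) <= e * c.
    by rewrite -mulrN ler_pM2l // lerNl -normrN ler_norm.
  move=> h; have : 0 < e * (2 * norm2 y + e * c) by rewrite mulr_gt0 //; lra.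
  by rewrite (_ : e * (2 * norm2 y + e * c) = 2 * e * norm2 y + e ^+ 2 * c) //; ring.
by move=> i; apply/eqP; rewrite -subr_eq0 -mulNr; apply/eqP; exact: norm2_eq0 i y0.
Qed.

(** The maximum over the sphere is attained at an eigenvector, so its value is an eigenvalue and is
    at most [a]. This turns the hypothesis on the top eigenvector into a variational bound. *)
Lemma qform_le_eigenvalue n (A : 'M[R]_n) (a : R) :
  symm A -> (forall b, eigenvalue A b -> b <= a) ->
  forall x, qform A x <= a * norm2 x.
Proof.
case: n A => [|n] A sA amax x; first by rewrite /qform /norm2 !big_ord0 mulr0.
have [v [v1 vmax]] := qform_max A.
set mu := qform A _ in vmax.
have Av := qform_max_eigen sA v1 (erefl mu) vmax.
apply: le_trans (vmax x) _; rewrite ler_wpM2r ?norm2_ge0 // amax //.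
apply/eigenvalueP; exists v.
  apply/rowP => i; rewrite !mxE -Av; apply: eq_bigr => j _.
  by rewrite mulrC (sA j i).
apply/eqP => v0; move: v1; rewrite v0 /norm2 big1 => [/eqP|i _].
  by rewrite eq_sym oner_eq0.
by rewrite mxE expr0n.
Qed.

End Rayleigh.

(** * Quadratic forms dominated by a sparse nonnegative matrix *)

Section SparseForms.
Context {R : realType} {n : nat}.
Variable D : 'I_n -> 'I_n -> R.
Hypotheses (D_sym : symm D) (D0 : forall i j, 0 <= D i j).
Implicit Types (x y : 'I_n -> R) (S V : {set 'I_n}).

Lemma amgm_weighted (th a b : R) : 0 < th -> 2 * (`|a| * `|b|) <= th * a ^+ 2 + b ^+ 2 / th.
Proof.
move=> th0; rewrite -(real_normK (num_real a)) -(real_normK (num_real b)).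
set u := `|a|; set v := `|b|.
have : 0 <= (th * u - v) ^+ 2 / th by rewrite divr_ge0 ?sqr_ge0 // ltW.
have -> : (th * u - v) ^+ 2 / th = th * u ^+ 2 + v ^+ 2 / th - 2 * (u * v).
  by field; rewrite gt_eqF.
by rewrite subr_ge0.
Qed.

(** Vertices are removed one at a time, each having degree at most [d] in what remains. By the
    weighted AM-GM inequality an edge charges [th] to the endpoint removed first, which is charged
    at most [d] times, and [1 / th] to the other, which is charged at most its degree times. *)
Lemma degenerate_form_le (d th : R) x S : 0 < th ->
  (forall V, V \subset S -> V != finset.set0 ->
     exists2 i, i \in V & \sum_(j in V) D i j <= d) ->
  \sum_(i in S) \sum_(j in S) D i j * (`|x i| * `|x j|) <=
  \sum_(i in S) (th * d + (\sum_(j in S) D i j) / th) * x i ^+ 2.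
Proof.
move=> th0.
have [k] := ubnP #|S|; elim: k S => // k IH S Sk dS.
have [->|S0] := eqVneq S finset.set0; first by rewrite !big_set0.
have [v vS vd] := dS S (subxx _) S0.
have Sv : (#|S :\ v| < k)%N by rewrite (cardsD1 v) vS in Sk.
have dSv V : V \subset S :\ v -> V != finset.set0 ->
    exists2 i, i \in V & \sum_(j in V) D i j <= d.
  by move=> VS; apply: dS; apply: fintype.subset_trans VS (subsetDl _ _).
have {}IH := IH _ Sv dSv.
have big1D (F : 'I_n -> R) : \sum_(i in S) F i = F v + \sum_(i in S :\ v) F i.
  by rewrite (big_setD1 v).
have -> : \sum_(i in S) (th * d + (\sum_(j in S) D i j) / th) * x i ^+ 2 =
    (th * d + (\sum_(j in S) D v j) / th) * x v ^+ 2 +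
    (\sum_(i in S :\ v) (th * d + (\sum_(j in S :\ v) D i j) / th) * x i ^+ 2 +
    (\sum_(i in S :\ v) D v i * x i ^+ 2) / th).
  rewrite (big1D (fun i => (th * d + (\sum_(j in S) D i j) / th) * x i ^+ 2)).
  congr (_ + _); rewrite mulr_suml -big_split; apply: eq_bigr => i _ /=.
  by rewrite (big1D (D i)) (D_sym v i); ring.
have -> : \sum_(i in S) \sum_(j in S) D i j * (`|x i| * `|x j|) =
    D v v * (`|x v| * `|x v|) + 2 * (\sum_(i in S :\ v) D v i * (`|x v| * `|x i|)) +
    \sum_(i in S :\ v) \sum_(j in S :\ v) D i j * (`|x i| * `|x j|).
  rewrite (big1D (fun i => \sum_(j in S) D i j * (`|x i| * `|x j|))).
  rewrite (big1D (fun j => D v j * (`|x v| * `|x j|))).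
  under [X in _ + X = _]eq_bigr => i _ do rewrite (big1D (fun j => D i j * (`|x i| * `|x j|))).
  rewrite big_split /=.
  have -> : \sum_(i in S :\ v) D i v * (`|x i| * `|x v|) =
     \sum_(i in S :\ v) D v i * (`|x v| * `|x i|).
    by apply: eq_bigr => i _; rewrite (D_sym v i) (mulrC `|x i|).
  by ring.
set A := \sum_(i in S :\ v) D v i * (`|x v| * `|x i|).
set E := \sum_(i in S :\ v) D v i * x i ^+ 2.
have AE : D v v * (`|x v| * `|x v|) + 2 * A <=
    (th * (\sum_(j in S) D v j) + D v v / th) * x v ^+ 2 + E / th.
  have h1 : 2 * A <= th * (\sum_(j in S :\ v) D v j) * x v ^+ 2 + E / th.
    rewrite /A /E mulr_sumr mulr_sumr !mulr_suml -big_split /=; apply: ler_sum => i _.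
    by have := ler_wpM2l (D0 v i) (amgm_weighted (x v) (x i) th0); lra.
  have h2 : D v v * (`|x v| * `|x v|) <= (th * D v v + D v v / th) * x v ^+ 2.
    have := ler_wpM2l (D0 v v) (amgm_weighted (x v) (x v) th0).
    have : 0 <= D v v * (`|x v| * `|x v|) by rewrite !mulr_ge0.
    lra.
  rewrite (big1D (D v)); lra.
have hd : th * (\sum_(j in S) D v j) * x v ^+ 2 <= th * d * x v ^+ 2.
  by rewrite ler_wpM2r ?sqr_ge0 // ler_pM2l.
have hD : D v v / th * x v ^+ 2 <= (\sum_(j in S) D v j) / th * x v ^+ 2.
  rewrite ler_wpM2r ?sqr_ge0 // ler_pM2r ?invr_gt0 // (big1D (D v)) lerDl.
  by apply: sumr_ge0 => j _.
lra.
Qed.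

(** A set of average degree at most [d] has a vertex of degree at most [d], so the removal argument
    runs. Balancing [th] gives order sqrt(d Delta), which is small against the maximal degree
    [Delta] when all heavy sets are sparse. *)
Lemma sparse_form_le (d th Delta : R) x S : 0 < th -> 0 <= d -> 0 <= Delta ->
  (forall V, V \subset S -> V != finset.set0 ->
     \sum_(i in V) \sum_(j in V) D i j <= d * #|V|%:R) ->
  (forall i, \sum_j D i j <= Delta) ->
  \sum_(i in S) \sum_(j in S) D i j * (`|x i| * `|x j|) <=
  (th * d + Delta / th) * norm2 x.
Proof.
move=> th0 d0 Delta0 dS degD.
have dS' V : V \subset S -> V != finset.set0 ->
    exists2 i, i \in V & \sum_(j in V) D i j <= d.
  move=> VS V0; apply/exists_inP; apply: contraT; rewrite negb_exists_in => /forall_inP H.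
  have := dS V VS V0; rewrite leNgt => /negP[].
  rewrite mulr_natr -sumr_const.
  have [v vV] := set0Pn _ V0.
  rewrite (big_setD1 v) //= [ltRHS](big_setD1 v) //=.
  apply: ltr_leD; first by have := H v vV; rewrite -ltNge.
  by apply: ler_sum => i; rewrite !inE => /andP[_ iV]; apply: ltW; have := H i iV; rewrite -ltNge.
apply: (le_trans (degenerate_form_le x th0 dS')).
have SD i : \sum_(j in S) D i j <= Delta.
  by apply: le_trans (degD i); rewrite [leRHS](bigID (mem S)) /= lerDl sumr_ge0.
have c0 : 0 <= th * d + Delta / th by rewrite addr_ge0 ?mulr_ge0 ?invr_ge0 // ltW.
rewrite /norm2 mulr_sumr [leRHS](bigID (mem S)) /= -[leLHS]addr0; apply: lerD.
  by apply: ler_sum => i _; rewrite ler_wpM2r ?sqr_ge0 // lerD2l ler_pM2r ?invr_gt0.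
by apply: sumr_ge0 => i _; rewrite mulr_ge0 // sqr_ge0.
Qed.

Context (B : 'I_n -> 'I_n -> R) (b : R).
Hypotheses (BD : forall i j, `|B i j| <= b * D i j) (b0 : 0 <= b).

(** Truncation at [K'] loses the products with a coordinate above [K']. Either both coordinates
    exceed [K], and the product belongs to the sum over heavy vertices, or one is at most [K], and
    the product is at most [K / K'] times the sum of the two squares. *)
Lemma heavy_light_split (K K' : R) x : 0 < K -> 0 < K' ->
  qform B x <= qform B (fun i => if `|x i| <= K' then x i else 0) +
    b * (\sum_(i in [set i | K < `|x i|]%SET) \sum_(j in [set i | K < `|x i|]%SET)
           D i j * (`|x i| * `|x j|) +
         2 * (K / K') * \sum_i (\sum_j D i j) * x i ^+ 2).
Proof.
move=> K0 K'0; set S := [set i | _]%SET.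
pose xl i := if `|x i| <= K' then x i else 0.
pose SS i j := D i j * (`|x i| * `|x j|) * ((i \in S) && (j \in S))%:R.
apply: (@le_trans _ _ (\sum_i \sum_j (B i j * (xl i * xl j) +
    b * (SS i j + K / K' * (D i j * x i ^+ 2 + D i j * x j ^+ 2))))).
  apply: ler_sum => i _; apply: ler_sum => j _.
  have R0 : 0 <= K / K' * (D i j * x i ^+ 2 + D i j * x j ^+ 2).
    apply: mulr_ge0; [by rewrite divr_ge0 // ltW|by apply: addr_ge0; apply: mulr_ge0 => //; exact: sqr_ge0].
  have S0 : 0 <= SS i j by rewrite !mulr_ge0.
  have [light|] := boolP ((`|x i| <= K') && (`|x j| <= K')).
    rewrite /xl; case/andP: light => -> ->.
    by rewrite lerDl mulr_ge0 // addr_ge0.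
  move=> heavy; have -> : xl i * xl j = 0.
    by move: heavy; rewrite /xl; case: ifP => //= _; [case: ifP => // _ _; rewrite mulr0|rewrite mul0r].
  rewrite mulr0 add0r; apply: le_trans (ler_norm _) _.
  rewrite !normrM; apply: (@le_trans _ _ (b * (D i j * (`|x i| * `|x j|)))).
    by rewrite (mulrA b) ler_wpM2r ?mulr_ge0.
  apply: ler_wpM2l => //.
  have [ij|] := boolP ((i \in S) && (j \in S)).
    by rewrite /SS ij mulr1 lerDl.
  move=> nij; rewrite /SS (negPf nij) mulr0 add0r.
  have half (u v : R) : 0 <= v -> v <= K -> K' < u -> u * v <= K / K' * u ^+ 2.
    move=> v0 vK uK'; have u0 : 0 < u by apply: lt_trans uK'.
    rewrite expr2 mulrA mulrC ler_pM2r // mulrAC ler_pdivlMr //.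
    by apply: ler_pM => //; exact: ltW.
  have {}heavy : (K' < `|x i|) || (K' < `|x j|).
    by move: heavy; rewrite negb_and -!ltNge.
  have {}nij : (`|x i| <= K) || (`|x j| <= K).
    by move: nij; rewrite !inE negb_and -!leNgt.
  suff H : `|x i| * `|x j| <= K / K' * (x i ^+ 2 + x j ^+ 2).
    have -> : K / K' * (D i j * x i ^+ 2 + D i j * x j ^+ 2) =
      D i j * (K / K' * (x i ^+ 2 + x j ^+ 2)) by ring.
    exact: ler_wpM2l.
  rewrite -(real_normK (num_real (x i))) -(real_normK (num_real (x j))).
  have c0 : 0 <= K / K' by rewrite divr_ge0 // ltW.
  have s0 (u : R) : 0 <= K / K' * u ^+ 2 by rewrite mulr_ge0 // sqr_ge0.
  rewrite mulrDr.
  (* either one endpoint is heavy and the other very light, or K' < K and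
     both sides are comparable *)
  move: (normr_ge0 (x i)) (normr_ge0 (x j)) heavy nij.
  set u := `|x i|; set v := `|x j| => u0 v0.
  have [KK|KK] := leP K K'.
    move=> /orP[hu|hv] /orP[lu|lv].
    - by have := lt_le_trans hu (le_trans lu KK); rewrite ltxx.
    - by have := half u v v0 lv hu; have := s0 v; lra.
    - by have := half v u u0 lu hv; rewrite mulrC; have := s0 u; lra.
    - by have := lt_le_trans hv (le_trans lv KK); rewrite ltxx.
  move=> _ _; have c1 : 1 <= K / K' by rewrite ler_pdivlMr // mul1r ltW.
  have : u * v <= u ^+ 2 + v ^+ 2 by nra.
  have := ler_wpM2r (sqr_ge0 u) c1; have := ler_wpM2r (sqr_ge0 v) c1.
  by rewrite !mul1r; lra.
apply: ler_of_eq.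
under eq_bigr => i _ do rewrite big_split -mulr_sumr big_split -mulr_sumr big_split /=.
rewrite big_split /= -mulr_sumr; congr (_ + _ * _).
rewrite big_split /=; congr (_ + _).
  rewrite [RHS]big_mkcond; apply: eq_bigr => i _; rewrite /SS.
  case: (i \in S) => /=; last by rewrite big1 // => j _; rewrite mulr0.
  rewrite [RHS]big_mkcond; apply: eq_bigr => j _.
  by case: (j \in S); rewrite ?mulr1 ?mulr0.
rewrite -mulr_sumr big_split /= [X in _ + X]exchange_big /=.
have -> : \sum_j \sum_i D i j * x j ^+ 2 = \sum_i (\sum_j D i j) * x i ^+ 2.
  by apply: eq_bigr => i _; rewrite mulr_suml; apply: eq_bigr => j _; rewrite (D_sym j i).
under eq_bigr do rewrite -mulr_suml.
by ring.
Qed.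

Lemma rounding_form (del : R) x y :
  (forall i, `|x i - y i| <= del) -> (forall i, `|y i| <= `|x i|) ->
  qform B x <= qform B y + 2 * b * del * \sum_i (\sum_j D i j) * `|x i|.
Proof.
move=> xy yx.
apply: (@le_trans _ _ (\sum_i \sum_j (B i j * (y i * y j) +
    b * del * (D i j * `|x i| + D i j * `|x j|)))).
  apply: ler_sum => i _; apply: ler_sum => j _.
  rewrite -lerBlDl -mulrBr; apply: le_trans (ler_norm _) _; rewrite normrM.
  apply: (@le_trans _ _ (b * D i j * (del * (`|x i| + `|x j|)))); last by apply: ler_of_eq; ring.
  apply: ler_pM => //.
  have -> : x i * x j - y i * y j = (x i - y i) * x j + y i * (x j - y j) by ring.
  apply: le_trans (ler_normD _ _) _; rewrite !normrM mulrDr addrC.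
  by apply: lerD; [rewrite mulrC; apply: ler_pM|apply: ler_pM].
under eq_bigr => i _ do rewrite big_split -mulr_sumr big_split /=.
rewrite big_split /= -mulr_sumr lerD2l big_split /= [X in _ + X]exchange_big /=.
have -> : \sum_j \sum_i D i j * `|x j| = \sum_i (\sum_j D i j) * `|x i|.
  by apply: eq_bigr => i _; rewrite mulr_suml; apply: eq_bigr => j _; rewrite (D_sym j i).
under eq_bigr do rewrite -mulr_suml.
by apply: ler_of_eq; ring.
Qed.

End SparseForms.

(** * Rounding to a finite grid *)

Section Grid.
Context {R : realType}.

Definition grid_point n (del : R) (N : nat) (k : {ffun 'I_n -> 'I_(N.*2.+1)}) :
  'I_n -> R := fun i => del * ((k i)%:R - N%:R).

(** Rounding is towards zero, so that it never increases the norm; the index is shifted by [N] to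
    reach both signs. *)
Lemma grid_round1 (del : R) (N : nat) (x : R) : 0 < del -> `|x| <= del * N%:R ->
  exists k : 'I_(N.*2.+1), `|x - del * (k%:R - N%:R)| <= del /\
    `|del * (k%:R - N%:R)| <= `|x|.
Proof.
move=> d0 xN; pose m := Num.truncn (`|x| / del).
have xd0 : 0 <= `|x| / del by rewrite divr_ge0 // ltW.
have /andP[m1 m2] := truncn_itv xd0; rewrite -/m in m1 m2.
have mx : del * m%:R <= `|x| by rewrite mulrC -ler_pdivlMr.
have xm : `|x| <= del * m%:R + del.
  by move: (ltW m2); rewrite ler_pdivrMr // -natr1 mulrDl mul1r mulrC.
have mN : (m <= N)%N.
  by rewrite -(ler_nat R) -(ler_pM2l d0); apply: le_trans xN.
have dm0 : 0 <= del * m%:R by rewrite mulr_ge0 // ltW.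
have [x0|x0] := leP 0 x.
  have h : (N + m < N.*2.+1)%N by rewrite ltnS -addnn leq_add2l.
  exists (Ordinal h); rewrite /= natrD addrAC subrr add0r.
  rewrite ger0_norm // in mx xm; rewrite (ger0_norm x0) (ger0_norm dm0); split => //.
  by rewrite ger0_norm; lra.
have h : (N - m < N.*2.+1)%N by rewrite ltnS -addnn (leq_trans (leq_subr _ _)) // leq_addr.
exists (Ordinal h); rewrite /= natrB // addrAC subrr add0r mulrN normrN.
rewrite ltr0_norm // in mx xm; rewrite (ltr0_norm x0) (ger0_norm dm0); split => //.
by rewrite opprK ler_norml; lra.
Qed.

Lemma grid_round n (del : R) (N : nat) (x : 'I_n -> R) : 0 < del ->
  (forall i, `|x i| <= del * N%:R) ->
  exists k : {ffun 'I_n -> 'I_(N.*2.+1)},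
    (forall i, `|x i - grid_point del k i| <= del) /\
    (forall i, `|grid_point del k i| <= `|x i|).
Proof.
move=> d0 xN.
have /choice[f fP] : forall i, exists k : 'I_(N.*2.+1),
    `|x i - del * (k%:R - N%:R)| <= del /\ `|del * (k%:R - N%:R)| <= `|x i|.
  by move=> i; exact: grid_round1.
exists [ffun i => f i]; split => i; rewrite /grid_point ffunE; have [] := fP i; done.
Qed.

End Grid.

(** * From grid points to all vectors *)

Section QuadraticBound.
Context {R : realType} {n : nat}.
Context (D B : 'I_n -> 'I_n -> R) (sg : 'I_n -> R) (b l C e1 K del gam c : R) (N : nat).
Hypotheses (D_sym : symm D) (D0 : forall i j, 0 <= D i j)
  (BD : forall i j, `|B i j| <= b * D i j) (b0 : 0 <= b)
  (sg1 : forall i, `|sg i| = 1)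
  (l0 : 0 <= l) (C0 : 0 <= C) (e10 : 0 < e1) (K0 : 0 < K) (del0 : 0 < del)
  (N0 : (0 < N)%N) (gam0 : 0 <= gam) (n0 : (0 < n)%N).
Hypothesis deg : forall i, \sum_j D i j <= C * l.
(** The sets that matter are those of entries above [K] of a vector with squared norm at most [n];
    such sets have at most [n / K ^+ 2] elements. *)
Hypothesis sub : forall V : {set 'I_n}, V != finset.set0 -> #|V|%:R * K ^+ 2 <= n%:R ->
  \sum_(i in V) \sum_(j in V) D i j <= e1 ^+ 2 * l * #|V|%:R.
Hypothesis grid : forall k : {ffun 'I_n -> 'I_(N.*2.+1)},
  norm2 (grid_point del k) <= n%:R ->
  qform B (grid_point del k) <= l * (gam * dotp (grid_point del k) sg ^+ 2 / n%:R + c * n%:R).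

Let K' := del * N%:R.
(** The four errors: the change of the overlap with [sg] under truncation and rounding, the rounding
    of the form, the heavy block, and the products of heavy with light coordinates. *)
Let E := 2 * gam * (del + K'^-1) + 2 * b * C * del + b * e1 * (1 + C) + 2 * b * C * (K / K').

Let K'0 : 0 < K'. Proof. by rewrite mulr_gt0 // ltr0n. Qed.
Let nR0 : 0 < n%:R :> R. Proof. by rewrite ltr0n. Qed.

Lemma sum_norm_le (x : 'I_n -> R) : norm2 x <= n%:R -> \sum_i `|x i| <= n%:R.
Proof.
move=> xn; suff : 2 * \sum_i `|x i| <= 2 * n%:R by rewrite ler_pM2l.
apply: (@le_trans _ _ (n%:R + norm2 x)); last by rewrite mulr_natl mulr2n lerD2l.
rewrite -[X in X%:R + _](card_ord n) -sumr_const -big_split mulr_sumr /=.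
apply: ler_sum => i _; rewrite -(real_normK (num_real (x i))).
by have := sqr_ge0 (`|x i| - 1); lra.
Qed.

Lemma dotp_sg_le (x : 'I_n -> R) : `|dotp x sg| <= \sum_i `|x i|.
Proof.
apply: le_trans (ler_norm_sum _ _ _) _.
by apply: ler_sum => i _; rewrite normrM sg1 mulr1.
Qed.

Lemma qform_ball_le (x : 'I_n -> R) : norm2 x <= n%:R ->
  qform B x <= l * (gam * dotp x sg ^+ 2 / n%:R + (c + E) * n%:R).
Proof.
move=> xn.
pose xl i := if `|x i| <= K' then x i else 0.
have xlx i : `|xl i| <= `|x i| by rewrite /xl; case: ifP => // _; rewrite normr0.
have xlK i : `|xl i| <= del * N%:R by rewrite /xl; case: ifP => // _; rewrite normr0 ltW.
have [k [kx kn]] := grid_round del0 xlK.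
pose y := grid_point del k; rewrite -/y in kx kn.
have yn : norm2 y <= n%:R.
  apply: le_trans xn; apply: ler_sum => i _.
  by apply: ler_sqr_of_norm; apply: le_trans (kn i) _.
have xln : norm2 xl <= n%:R.
  apply: le_trans xn; apply: ler_sum => i _.
  exact: ler_sqr_of_norm.
have Cl0 : 0 <= C * l by rewrite mulr_ge0.
have H1 := heavy_light_split D_sym D0 BD b0 x K0 K'0; rewrite -/xl in H1.
set S := [set i | K < `|x i|]%SET in H1.
have SK : #|S|%:R * K ^+ 2 <= n%:R.
  apply: le_trans xn; rewrite mulr_natl -sumr_const /norm2 [leRHS](bigID (mem S)) /=.
  rewrite -[leLHS]addr0; apply: lerD; last by apply: sumr_ge0 => i _; exact: sqr_ge0.
  apply: ler_sum => i; rewrite inE => Ki; rewrite -(real_normK (num_real (x i))).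
  by rewrite lerXn2r ?nnegrE // ltW.
have H2 : \sum_(i in S) \sum_(j in S) D i j * (`|x i| * `|x j|) <=
    e1 * (1 + C) * l * n%:R.
  have dS (V : {set 'I_n}) : V \subset S -> V != finset.set0 ->
      \sum_(i in V) \sum_(j in V) D i j <= e1 ^+ 2 * l * #|V|%:R.
    move=> VS V0; apply: sub => //; apply: le_trans SK.
    by rewrite ler_wpM2r ?sqr_ge0 // ler_nat subset_leq_card.
  (* The weight [e1^-1] makes both terms of [sparse_form_le], with densities [e1 ^+ 2 * l] and
     [C * l], proportional to [e1]. *)
  have e1i0 : 0 < e1^-1 by rewrite invr_gt0.
  have dn0 : 0 <= e1 ^+ 2 * l by rewrite mulr_ge0 // sqr_ge0.
  have Hs := sparse_form_le D_sym D0 x e1i0 dn0 Cl0 dS deg.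
  apply: (le_trans Hs) => {Hs}.
  have -> : e1^-1 * (e1 ^+ 2 * l) + C * l / e1^-1 = e1 * (1 + C) * l.
    by field; rewrite gt_eqF.
  by rewrite ler_wpM2l // !mulr_ge0 ?addr_ge0 // ltW.
have H3 : \sum_i (\sum_j D i j) * x i ^+ 2 <= C * l * n%:R.
  apply: (@le_trans _ _ (\sum_i (C * l) * x i ^+ 2)).
    by apply: ler_sum => i _; rewrite ler_wpM2r ?sqr_ge0.
  by rewrite -mulr_sumr ler_wpM2l.
have H4 := rounding_form D_sym BD kx kn; rewrite -/y in H4.
have H5 : \sum_i (\sum_j D i j) * `|xl i| <= C * l * n%:R.
  apply: (@le_trans _ _ (\sum_i (C * l) * `|xl i|)).
    by apply: ler_sum => i _; rewrite ler_wpM2r.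
  by rewrite -mulr_sumr ler_wpM2l // sum_norm_le.
have H6 := grid yn; rewrite -/y in H6.
have dn (z : 'I_n -> R) : norm2 z <= n%:R -> `|dotp z sg| <= n%:R.
  by move=> zn; apply: le_trans (dotp_sg_le z) _; exact: sum_norm_le.
have H7 : `|dotp y sg - dotp x sg| <= (del + K'^-1) * n%:R.
  have -> : dotp y sg - dotp x sg = dotp (fun i => y i - x i) sg.
    by rewrite /dotp -sumrB; apply: eq_bigr => i _; rewrite mulrBl.
  apply: le_trans (dotp_sg_le _) _.
  apply: (@le_trans _ _ (\sum_i (del + x i ^+ 2 / K'))).
    apply: ler_sum => i _.
    have -> : y i - x i = (y i - xl i) + (xl i - x i) by ring.
    apply: le_trans (ler_normD _ _) _; apply: lerD; first by rewrite distrC.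
    rewrite /xl; case: (leP `|x i| K') => [_|h] /=.
      by rewrite subrr normr0 divr_ge0 ?sqr_ge0 // ltW.
    rewrite sub0r normrN ler_pdivlMr // -(real_normK (num_real (x i))) expr2.
    by rewrite ler_wpM2l // ltW.
  rewrite big_split /= sumr_const card_ord -mulr_suml mulrDl -(mulr_natr del) lerD2l mulrC.
  by rewrite ler_wpM2l // invr_ge0 ltW.
have H8 : dotp y sg ^+ 2 <= dotp x sg ^+ 2 + 2 * (del + K'^-1) * n%:R * n%:R.
  set u := dotp y sg in H7 *; set v := dotp x sg in H7 *.
  have uv : `|u + v| <= 2 * n%:R.
    by apply: le_trans (ler_normD _ _) _; have := dn _ yn; have := dn _ xn; rewrite -/u -/v; lra.
  rewrite -lerBlDl subr_sqr; apply: le_trans (ler_norm _) _; rewrite normrM.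
  apply: le_trans (ler_pM _ _ H7 uv) _ => //.
  by apply: ler_of_eq; ring.
have H9 : gam * dotp y sg ^+ 2 / n%:R <= gam * dotp x sg ^+ 2 / n%:R + 2 * gam * (del + K'^-1) * n%:R.
  have -> : gam * dotp x sg ^+ 2 / n%:R + 2 * gam * (del + K'^-1) * n%:R =
     gam * (dotp x sg ^+ 2 + 2 * (del + K'^-1) * n%:R * n%:R) / n%:R.
    by field; rewrite !gt_eqF.
  by rewrite ler_pM2r ?invr_gt0 // ler_wpM2l.
have H6' := le_trans H6 (ler_wpM2l l0 (lerD H9 (lexx (c * n%:R)))).
have bd0 : 0 <= 2 * b * del by rewrite !mulr_ge0 // ltW.
have H5' := ler_wpM2l bd0 H5.
have KK0 : 0 <= 2 * (K / K') by rewrite mulr_ge0 // divr_ge0 // ltW.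
have H3' := ler_wpM2l KK0 H3.
have H23 := ler_wpM2l b0 (lerD H2 H3').
apply: (le_trans H1); apply: (le_trans (lerD H4 H23)).
rewrite /E; move: H5' H6'; lra.
Qed.

Lemma qform_le x : qform B x <= l * (gam * dotp x sg ^+ 2 / n%:R + (c + E) * norm2 x).
Proof.
have [x0|xn0] := eqVneq (norm2 x) 0.
  have xz i := norm2_eq0 i x0.
  rewrite x0 mulr0 addr0 /qform big1 => [|i _]; last by rewrite big1 // => j _; rewrite xz mul0r mulr0.
  by rewrite mulr_ge0 // divr_ge0 // mulr_ge0 // sqr_ge0.
have xp : 0 < norm2 x by rewrite lt_def xn0 norm2_ge0.
pose s := Num.sqrt (n%:R / norm2 x).
have s2 : s ^+ 2 = n%:R / norm2 x by rewrite sqr_sqrtr // divr_ge0 // ltW.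
have s20 : 0 < s ^+ 2 by rewrite s2 divr_gt0.
have := @qform_ball_le (fun i => s * x i).
rewrite norm2Z s2 divfK // => /(_ (lexx _)).
rewrite qformZ dotpZl exprMn => H.
rewrite -(ler_pM2l s20); apply: le_trans H _.
apply: ler_of_eq.
have E2 : s ^+ 2 * norm2 x = n%:R by rewrite s2 divfK.
by rewrite (_ : (c + E) * n%:R = s ^+ 2 * ((c + E) * norm2 x)); [ring|rewrite -E2; ring].
Qed.

End QuadraticBound.

(** * Leave-one-out vectors *)

Section Mask.
Context {R : realType} {n : nat}.
Implicit Types (x y : 'I_n -> R) (A : 'I_n -> 'I_n -> R).

Definition zero_at (j : 'I_n) x : 'I_n -> R := fun i => if i == j then 0 else x i.

(** Erasing keeps the dimension, so the masked matrix is that of an observation in which every pair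
    at [j] is censored. *)
Definition mask_at (j : 'I_n) A : 'I_n -> 'I_n -> R :=
  fun i k => if (i == j) || (k == j) then 0 else A i k.

Lemma app_mask j A x : app (mask_at j A) x = zero_at j (app A (zero_at j x)).
Proof.
apply/funext => i; rewrite /app /zero_at /mask_at; case: (i == j) => /=.
  by rewrite big1 // => k _; rewrite mul0r.
by apply: eq_bigr => k _; case: (k == j); rewrite ?mul0r ?mulr0.
Qed.

Lemma qform_mask j A x : qform (mask_at j A) x = qform A (zero_at j x).
Proof.
rewrite !qformE app_mask; apply: eq_bigr => i _; rewrite /zero_at.
by case: (i == j); rewrite ?mulr0 ?mul0r.
Qed.

Lemma norm2_zero_at j x : norm2 (zero_at j x) <= norm2 x.
Proof.
apply: ler_sum => i _; rewrite /zero_at; case: (i == j) => //.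
by rewrite expr0n sqr_ge0.
Qed.

Lemma norm2B x y : norm2 (fun i => x i - y i) = norm2 x - 2 * dotp x y + norm2 y.
Proof.
have := norm2_lin (-1) x y; under eq_fun do rewrite mulN1r.
by move=> ->; ring.
Qed.

Lemma norm_le_norm2 x i : x i ^+ 2 <= norm2 x.
Proof.
by rewrite /norm2 (bigD1 i) //= lerDl sumr_ge0 // => j _; exact: sqr_ge0.
Qed.

Lemma sum_norm_sqr_le x : (\sum_i `|x i|) ^+ 2 <= n%:R * norm2 x.
Proof.
have := cauchy_schwarz (fun=> 1) (fun i => `|x i|).
have -> : norm2 (fun _ : 'I_n => 1 : R) = n%:R.
  by rewrite /norm2; under eq_bigr do rewrite expr1n; rewrite sumr_const card_ord.
have -> : norm2 (fun i => `|x i|) = norm2 x.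
  by apply: eq_bigr => i _; rewrite real_normK ?num_real.
by rewrite /dotp; under eq_bigr do rewrite mul1r.
Qed.

End Mask.

(** * Comparison with the leave-one-out eigenvectors *)

Section LeaveOneOut.
Context {R : realType} {n : nat}.
Context (D B : 'I_n -> 'I_n -> R) (sg : 'I_n -> R) (b l C gam c eps : R).
Hypotheses (B_sym : symm B) (D0 : forall i j, 0 <= D i j) (D1 : forall i j, D i j <= 1)
  (Bdiag : forall i, B i i = 0)
  (BD : forall i j, `|B i j| <= b * D i j) (b0 : 0 < b)
  (sg1 : forall i, `|sg i| = 1) (l0 : 0 < l) (C0 : 0 < C) (gam0 : 0 < gam)
  (c0 : 0 <= c) (eps0 : 0 < eps) (epsg : 16 * eps <= gam) (n0 : (0 < n)%N)
  (Cl1 : 1 <= C * l) (nbig : 2 * b * C <= eps * n%:R).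
Hypothesis deg : forall i, \sum_j D i j <= C * l.
Hypothesis QF : forall x, qform B x <= l * (gam * dotp x sg ^+ 2 / n%:R + (c + eps) * norm2 x).
Hypothesis QS : (gam + c - eps) * n%:R * l <= qform B sg.

Let nR0 : 0 < n%:R :> R. Proof. by rewrite ltr0n. Qed.

Let consts : [/\ 0 <= c, 0 < eps, 16 * eps <= gam & 0 < gam]. Proof. by []. Qed.

Let norm2_sg : norm2 sg = n%:R.
Proof.
rewrite /norm2 (eq_bigr (fun=> 1)) ?sumr_const ?card_ord // => i _.
by rewrite -(real_normK (num_real (sg i))) sg1 expr1n.
Qed.

(** The squared norm is that of [sg], and the last clause fixes the sign of the eigenvector;
    maximality is stated for the quadratic form, the shape in which it is used. *)
Definition top_vector (A : 'I_n -> 'I_n -> R) (lam : R) (U : 'I_n -> R) : Prop :=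
  [/\ norm2 U = n%:R, app A U = (fun i => lam * U i),
      forall x, qform A x <= lam * norm2 x & 0 <= dotp U sg].

(** The lower bound at [sg] and the upper bound at [U] squeeze the top eigenvalue. The level [c] is
    common to both and cancels, which leaves a lower bound on the overlap of [U] with [sg]. *)
Lemma top_vector_close A lam U e :
  (gam + c - e) * n%:R * l <= qform A sg ->
  qform A U <= l * (gam * dotp U sg ^+ 2 / n%:R + (c + eps) * norm2 U) ->
  top_vector A lam U ->
  (gam + c - e) * l <= lam /\ norm2 (fun i => U i - sg i) <= 2 * (e + eps) / gam * n%:R.
Proof.
move=> As Aq [Un AU Amax Us].
have lamn : lam * n%:R = qform A U.
  rewrite qformE AU -Un -dotpxx /dotp mulr_sumr; apply: eq_bigr => i _.
  by rewrite mulrCA.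
have le1 : (gam + c - e) * n%:R * l <= lam * n%:R by have := le_trans As (Amax sg); rewrite norm2_sg.
have lamb : (gam + c - e) * l <= lam.
  by move: le1; rewrite mulrAC ler_pM2r.
split => //.
set s := dotp U sg in Us Aq.
have sn : s <= n%:R.
  have := cauchy_schwarz U sg; rewrite -/s Un norm2_sg -expr2 => h.
  by rewrite -(ler_pXn2r (n := 2)) ?nnegrE // ltW.
have h1 : (gam - e - eps) * n%:R <= gam * s ^+ 2 / n%:R.
  have := le_trans le1 (eq_ind_r (fun z => z <= _) Aq lamn).
  rewrite Un [X in _ <= X]mulrC ler_pM2r //; lra.
have h2 : s ^+ 2 / n%:R <= s.
  by rewrite ler_pdivrMr // expr2 ler_wpM2l.
have h3 : (gam - e - eps) * n%:R <= gam * s.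
  by apply: le_trans h1 _; rewrite -mulrA ler_pM2l.
rewrite norm2B Un norm2_sg -/s.
have -> : 2 * (e + eps) / gam * n%:R = 2 * (n%:R - (gam - e - eps) * n%:R / gam).
  by field; rewrite gt_eqF.
have : (gam - e - eps) * n%:R / gam <= s by rewrite ler_pdivrMr // [s * _]mulrC.
lra.
Qed.

Lemma row_app_le j (x : 'I_n -> R) : `|app B x j| <= b * \sum_k D j k * `|x k|.
Proof.
apply: le_trans (ler_norm_sum _ _ _) _; rewrite mulr_sumr; apply: ler_sum => k _.
by rewrite normrM mulrA ler_wpM2r.
Qed.

Lemma row_sqr_le j : \sum_k B j k ^+ 2 <= b ^+ 2 * (C * l).
Proof.
apply: (@le_trans _ _ (b ^+ 2 * \sum_k D j k)); last by rewrite ler_wpM2l ?sqr_ge0.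
rewrite mulr_sumr; apply: ler_sum => k _.
apply: (@le_trans _ _ ((b * D j k) ^+ 2)).
  by apply: ler_sqr_of_norm; apply: le_trans (BD j k) (ler_norm _).
rewrite exprMn ler_wpM2l ?sqr_ge0 // expr2 -[leRHS]mulr1 ler_wpM2l //.
Qed.

Lemma app_sg_le j : `|app B sg j| <= b * (C * l).
Proof.
apply: le_trans (row_app_le j sg) _; rewrite ler_pM2l //.
by apply: le_trans (deg j); apply: ler_sum => k _; rewrite sg1 mulr1.
Qed.

Lemma top_le lam U : top_vector B lam U -> lam <= b * (C * l).
Proof.
move=> [Un AU _ _].
have lamn : lam * n%:R = qform B U.
  rewrite qformE AU -Un -dotpxx /dotp mulr_sumr; apply: eq_bigr => i _.
  by rewrite mulrCA.
rewrite -(ler_pM2r nR0) lamn.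
suff : 2 * qform B U <= 2 * (b * (C * l) * n%:R) by rewrite ler_pM2l.
apply: (@le_trans _ _ (\sum_i \sum_j (b * (D i j * U i ^+ 2) + b * (D j i * U j ^+ 2)))).
  rewrite /qform mulr_sumr; apply: ler_sum => i _; rewrite mulr_sumr; apply: ler_sum => j _.
  apply: le_trans (ler_norm _) _; rewrite !normrM ger0_norm //.
  have h : 0 <= (`|U i| - `|U j|) ^+ 2 by exact: sqr_ge0.
  have h1 := BD i j; have h2 := BD j i; rewrite (B_sym j i) in h2.
  rewrite -(real_normK (num_real (U i))) -(real_normK (num_real (U j))).
  have : `|B i j| * (2 * (`|U i| * `|U j|)) <= `|B i j| * (`|U i| ^+ 2 + `|U j| ^+ 2).
    by apply: ler_wpM2l => //; lra.
  have := ler_wpM2r (sqr_ge0 `|U i|) h1; have := ler_wpM2r (sqr_ge0 `|U j|) h2; lra.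
under eq_bigr do rewrite big_split /=.
rewrite big_split /= [X in _ + X]exchange_big /=.
have H : \sum_i \sum_j b * (D i j * U i ^+ 2) <= b * (C * l) * n%:R.
  rewrite -Un /norm2 mulr_sumr; apply: ler_sum => i _.
  rewrite -mulr_sumr -mulr_suml -mulrA ler_pM2l //.
  by rewrite ler_wpM2r ?sqr_ge0.
have -> : \sum_j \sum_i b * (D j i * U j ^+ 2) = \sum_i \sum_j b * (D i j * U i ^+ 2) by [].
by move: H; lra.
Qed.

Section OneVertex.
Context (lam : R) (U : 'I_n -> R) (j : 'I_n) (mu : R) (V : 'I_n -> R).
Hypotheses (topU : top_vector B lam U) (topV : top_vector (mask_at j B) mu V).

Lemma lam_ge : gam / 2 * l <= lam.
Proof.
have [hc he hg hgam] := consts.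
have [h _] := top_vector_close QS (QF U) topU.
by apply: le_trans h; rewrite ler_pM2r //; lra.
Qed.

Lemma U_close : norm2 (fun i => U i - sg i) <= 6 * eps / gam * n%:R.
Proof.
have [hc he hg hgam] := consts.
have [_ h] := top_vector_close QS (QF U) topU; apply: le_trans h _.
by rewrite ler_pM2r // ler_pM2r ?invr_gt0 //; lra.
Qed.

(** Masking changes the form at [sg] by twice entry j of [app B sg], up to sign, which [nbig]
    absorbs into [eps]; so [V] is close to [sg] for the same reason as [U]. It also gives mu > 0,
    and since row j of the masked matrix is zero, the eigenequation forces [V j = 0]. *)
Let V_aux : V j = 0 /\ norm2 (fun i => V i - sg i) <= 6 * eps / gam * n%:R.
Proof.
have [hc he hg hgam] := consts.
have Qs : (gam + c - 2 * eps) * n%:R * l <= qform (mask_at j B) sg.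
  rewrite qform_mask.
  have -> : zero_at j sg = (fun i => sg i + (- sg j) * (i == j)%:R).
    by apply/funext => i; rewrite /zero_at; case: eqP => [->|]; rewrite ?mulr1 ?subrr ?mulr0 ?addr0.
  rewrite qform_lin //.
  have -> : qform B (fun i => (i == j)%:R) = 0.
    rewrite /qform big1 // => i _; rewrite big1 // => k _.
    case: (eqVneq i j) => [->|]; last by rewrite mul0r mulr0.
    by case: (eqVneq k j) => [->|]; rewrite ?mulr0 // Bdiag mul0r.
  have -> : dotp (app B sg) (fun i => (i == j)%:R) = app B sg j.
    rewrite /dotp (bigD1 j) //= eqxx mulr1 big1 ?addr0 // => i /negPf->.
    by rewrite mulr0.
  have h : `|2 * - sg j * app B sg j| <= 2 * (b * (C * l)).
    by rewrite !normrM normrN sg1 mulr1 ger0_norm // ler_pM2l // app_sg_le.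
  rewrite mulr0 addr0; have := ler_wpM2r (ltW l0) nbig.
  move: h; rewrite ler_norml => /andP[h _]; move: QS h; lra.
have mu0 : 0 < mu.
  case: topV => Vn VV Vmax Vs; have := Vmax sg; rewrite norm2_sg => h.
  have h2 := le_trans Qs h.
  have : 0 < (gam + c - 2 * eps) * n%:R * l by rewrite !mulr_gt0 //; lra.
  by move=> /lt_le_trans/(_ h2); rewrite pmulr_lgt0.
have Vj : V j = 0.
  case: topV => _ + _ _; rewrite app_mask => /(congr1 (fun f => f j)).
  by rewrite /zero_at eqxx => /esym/eqP; rewrite mulf_eq0 gt_eqF //= => /eqP.
have Vz : zero_at j V = V by apply/funext => i; rewrite /zero_at; case: eqP => [->|].
split => //.
have Vq : qform (mask_at j B) V <= l * (gam * dotp V sg ^+ 2 / n%:R + (c + eps) * norm2 V).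
  by rewrite qform_mask Vz; exact: QF.
have [_ h] := top_vector_close Qs Vq topV; apply: le_trans h _.
by rewrite ler_pM2r // ler_pM2r ?invr_gt0 //; lra.
Qed.

Lemma V_close : norm2 (fun i => V i - sg i) <= 6 * eps / gam * n%:R.
Proof. by case: V_aux. Qed.

(* A Davis-Kahan argument: the part z of U orthogonal to V satisfies
   (lam - mask_at j B) z = (B - mask_at j B) U in the direction z, and the
   right-hand side is proportional to U j. *)
Lemma leave_one_out_dist :
  norm2 (fun i => U i - V i) <= (4 * b * C / gam) ^+ 2 * U j ^+ 2.
Proof.
have [hc he hg hgam] := consts.
have [Vj0 _] := V_aux; have Vc := V_close; have Uc := U_close.
have [Un BU Umax Us] := topU; have [Vn BV Vmax Vs] := topV.
pose r := dotp U V / n%:R.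
pose z i := U i + (- r) * V i.
have zV : dotp z V = 0 by rewrite /z dotp_lin dotpxx Vn /r; field; rewrite gt_eqF.
have Bm_sym : symm (mask_at j B) by move=> i k; rewrite /mask_at orbC (B_sym i k).
pose f i := app B U i - app (mask_at j B) U i.
have step1 : lam * norm2 z - qform (mask_at j B) z = dotp z f.
  have zU : dotp z U = norm2 z.
    have := dotp_linr (- r) U V z; rewrite -[X in dotp z X = _]/z dotpxx.
    by move=> ->; rewrite zV mulr0 addr0.
  have zBU : dotp z (app (mask_at j B) U) = qform (mask_at j B) z.
    have UE : U = (fun i => z i + r * V i).
      by apply/funext => i; rewrite /z; ring.
    rewrite [in LHS]UE app_lin dotp_linr BV -qformE.
    have -> : dotp z (fun i => mu * V i) = mu * dotp z V.
      by rewrite dotpC dotpZl dotpC.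
    by rewrite zV !mulr0 addr0.
  rewrite -zBU -zU /f BU /dotp mulr_sumr -sumrB; apply: eq_bigr => i _.
  by ring.
have fE i : f i = if i == j then lam * U j else B i j * U j.
  rewrite /f app_mask /zero_at; case: eqP => [->|/eqP ij]; first by rewrite BU subr0.
  rewrite /app -sumrB (bigD1 j) //= eqxx mulr0 subr0 big1 ?addr0 // => k /negPf->.
  by rewrite subrr.
have lamCl := top_le topU; have lam0 := lam_ge.
have lamp : 0 <= lam by apply: le_trans lam0; rewrite mulr_ge0 ?divr_ge0 // ltW.
have f2 : norm2 f <= 2 * (b * (C * l)) ^+ 2 * U j ^+ 2.
  rewrite /norm2 (bigD1 j) //= fE eqxx exprMn.
  have h1 : lam ^+ 2 <= (b * (C * l)) ^+ 2.
    by rewrite lerXn2r ?nnegrE // mulr_ge0 ?(ltW b0) ?mulr_ge0 // ltW.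
  have h2 : \sum_(i | i != j) f i ^+ 2 <= (b * (C * l)) ^+ 2 * U j ^+ 2.
    apply: (@le_trans _ _ ((\sum_k B j k ^+ 2) * U j ^+ 2)).
      rewrite mulr_suml [leRHS](bigD1 j) //= -[leLHS]add0r; apply: lerD.
        by rewrite mulr_ge0 ?sqr_ge0.
      by apply: ler_sum => i /negPf ij; rewrite fE ij exprMn (B_sym i j).
    rewrite ler_wpM2r ?sqr_ge0 //; apply: le_trans (row_sqr_le j) _.
    rewrite exprMn ler_wpM2l ?sqr_ge0 // expr2 ler_peMl //.
    by apply: le_trans Cl1.
  by have := ler_wpM2r (sqr_ge0 (U j)) h1; lra.
(* As [V j = 0], erasing entry j of [z] keeps it orthogonal to [V], hence almost orthogonal to [sg];
   the signal term of [QF] is then negligible on [z]. *)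
have zVs : dotp (zero_at j z) sg ^+ 2 <= norm2 z * (6 * eps / gam * n%:R).
  have -> : dotp (zero_at j z) sg = - dotp (zero_at j z) (fun i => V i - sg i).
    have -> : dotp (zero_at j z) (fun i => V i - sg i) =
        dotp (zero_at j z) V - dotp (zero_at j z) sg.
      by rewrite /dotp -sumrB; apply: eq_bigr => i _; rewrite mulrBr.
    have -> : dotp (zero_at j z) V = dotp z V.
      apply: eq_bigr => i _; rewrite /zero_at; case: eqP => [->|//].
      by rewrite Vj0 !mulr0.
    by rewrite zV sub0r opprK.
  rewrite sqrrN; apply: le_trans (cauchy_schwarz _ _) _.
  by apply: ler_pM; rewrite ?norm2_ge0 ?norm2_zero_at.
have Qz : qform (mask_at j B) z <= l * (7 * eps + c) * norm2 z.
  rewrite qform_mask; apply: le_trans (QF _) _.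
  rewrite -(mulrA l) ler_pM2l //.
  have h : gam * dotp (zero_at j z) sg ^+ 2 / n%:R <= 6 * eps * norm2 z.
    rewrite ler_pdivrMr //; apply: le_trans (_ : gam * (norm2 z * (6 * eps / gam * n%:R)) <= _).
      by rewrite ler_pM2l.
    by apply: ler_of_eq; field; rewrite gt_eqF.
  have := ler_wpM2l (addr_ge0 c0 (ltW eps0)) (norm2_zero_at j z).
  lra.
have lam2 : (gam + c - eps) * l <= lam.
  by have [] := top_vector_close QS (QF U) topU.
(* The spectral gap: lam >= (gam + c - eps) l against at most (7 eps + c) l on [z], and 8 eps <= gam
   / 2. *)
have gl : gam * l / 2 * norm2 z <= dotp z f.
  rewrite -step1.
  have := ler_wpM2r (norm2_ge0 z) lam2.
  have : 0 <= l * norm2 z by rewrite mulr_ge0 ?norm2_ge0 // ltW.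
  have := ler_wpM2r (mulr_ge0 (ltW l0) (norm2_ge0 z)) epsg.
  lra.
have z2 : norm2 z <= 4 / (gam * l) ^+ 2 * norm2 f.
  have g0 : 0 < gam * l by rewrite mulr_gt0.
  have := norm2_ge0 (fun i => gam * l / 2 * z i - f i).
  rewrite norm2B norm2Z dotpZl.
  have := ler_wpM2l (ltW g0) gl.
  set nz := norm2 z; set nf := norm2 f => h1 h2.
  rewrite mulrAC ler_pdivlMr ?exprn_gt0 //; lra.
(* Both vectors are close to [sg], which rules out that [U] is close to [- V]. *)
have Ur : 0 <= dotp U V <= n%:R.
  apply/andP; split; last first.
    have := cauchy_schwarz U V; rewrite Un Vn -expr2 => h.
    have [h0|h0] := leP 0 (dotp U V); last exact: le_trans (ltW h0) (ltW nR0).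
    by rewrite -(ler_pXn2r (n := 2)) ?nnegrE // ltW.
  have e6 : 6 * eps / gam <= 2^-1 by rewrite ler_pdivrMr //; lra.
  have uv : norm2 (fun i => U i - V i) <= 2 * n%:R.
    apply: (@le_trans _ _ (2 * (norm2 (fun i => U i - sg i) + norm2 (fun i => V i - sg i)))).
      rewrite /norm2 -big_split mulr_sumr; apply: ler_sum => i _ /=.
      by have := sqr_ge0 ((U i - sg i) + (V i - sg i)); lra.
    have := ler_wpM2r (ltW nR0) e6; lra.
  by move: uv; rewrite norm2B Un Vn; lra.
(* With d the overlap, the left side is 2 (n - d) and [norm2 z] is n - d^2 / n; the inequality d^2 /
   n <= d needs 0 <= d <= n. *)
have zUV : norm2 (fun i => U i - V i) <= 2 * norm2 z.
  rewrite norm2B /z norm2_lin Un Vn.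
  case/andP: Ur => u0 u1; set d := dotp U V in u0 u1 *.
  have rd : d ^+ 2 / n%:R <= d by rewrite ler_pdivrMr // expr2 ler_wpM2l.
  have -> : n%:R + 2 * - r * d + (- r) ^+ 2 * n%:R = n%:R - d ^+ 2 / n%:R.
    by rewrite /r -/d; field; rewrite gt_eqF.
  lra.
apply: le_trans zUV _; apply: (@le_trans _ _ (2 * (4 / (gam * l) ^+ 2 * (2 * (b * (C * l)) ^+ 2 * U j ^+ 2)))).
  rewrite ler_pM2l //; apply: le_trans z2 _; by rewrite ler_wpM2l // divr_ge0 // sqr_ge0.
by apply: ler_of_eq; field; rewrite !gt_eqF.
Qed.

End OneVertex.

Context (lam : R) (U : 'I_n -> R) (mu : 'I_n -> R) (V : 'I_n -> 'I_n -> R).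
Hypotheses (topU : top_vector B lam U) (topV : forall j, top_vector (mask_at j B) (mu j) (V j)).
Context (eta e3 del : R).
Let c3 := 4 * b * C / gam.
Hypotheses (eta0 : 0 < eta) (e30 : 0 < e3) (e3eps : 6 * eps / gam <= e3 ^+ 2)
  (etaC : eta <= C) (etac : 8 * b * eta * (1 + c3) <= gam)
  (etadel : b * eta * (1 + (1 + c3) * (4 * c3)) <= del)
  (lbig : 16 * b ^+ 2 * C * c3 ^+ 2 <= gam ^+ 2 * l).
(** In the application this holds with high probability because [V j] is independent of row j of [D]
    and close to [sg] in l1. *)
Hypothesis row : forall j M, 1 <= M ->
  (forall k, `|V j k - sg k| <= M) -> \sum_k `|V j k - sg k| <= e3 * n%:R ->
  \sum_k D j k * `|V j k - sg k| <= eta * M * l.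

Let c30 : 0 < c3. Proof. by rewrite /c3 !mulr_gt0 ?invr_gt0. Qed.
Let lam_lb : gam / 2 * l <= lam.
Proof. exact: lam_ge topU. Qed.
Let lam0 : 0 < lam.
Proof. by apply: lt_le_trans lam_lb; rewrite mulr_gt0 // divr_gt0. Qed.

Lemma loo_dist j : norm2 (fun i => U i - V j i) <= c3 ^+ 2 * U j ^+ 2.
Proof.
exact: leave_one_out_dist topU (topV j).
Qed.

Lemma loo_dist_entry j k : `|U k - V j k| <= c3 * `|U j|.
Proof.
have h := mulr_ge0 (ltW c30) (normr_ge0 (U j)).
rewrite -(ler_pXn2r (n := 2)) ?nnegrE //.
rewrite exprMn !real_normK ?num_real //; apply: le_trans (loo_dist j).
exact: (norm_le_norm2 (fun i => U i - V j i)).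
Qed.

Lemma loo_W_sum j : \sum_k `|V j k - sg k| <= e3 * n%:R.
Proof.
have Vc := V_close (topV j).
rewrite -(ler_pXn2r (n := 2)) ?nnegrE ?sumr_ge0 ?mulr_ge0 ?(ltW e30) //.
apply: le_trans (sum_norm_sqr_le _) _.
rewrite exprMn [n%:R ^+ 2]expr2 mulrA mulrC ler_pM2r //.
by apply: le_trans Vc _; rewrite ler_pM2r.
Qed.

(** Row j of [B] has l2 norm of order sqrt l, so by Cauchy-Schwarz replacing [U] by [V j] costs
    order sqrt l times |U_j|, while [lam] has order l. [lbig] is the resulting condition. *)
Lemma loo_entry j : `|lam * U j - app B (V j) j| <= lam / 2 * `|U j|.
Proof.
have [Un BU _ _] := topU.
have -> : lam * U j - app B (V j) j = dotp (B j) (fun k => U k - V j k).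
  have -> : lam * U j = app B U j by rewrite BU.
  rewrite /app /dotp -sumrB.
  by apply: eq_bigr => k _; rewrite mulrBr.
rewrite -(ler_pXn2r (n := 2)) ?nnegrE ?mulr_ge0 ?invr_ge0 ?(ltW lam0) //.
rewrite exprMn !real_normK ?num_real //; apply: le_trans (cauchy_schwarz _ _) _.
apply: (@le_trans _ _ (b ^+ 2 * (C * l) * (c3 ^+ 2 * U j ^+ 2))).
  by apply: ler_pM; rewrite ?norm2_ge0 ?loo_dist // row_sqr_le.
rewrite mulrA ler_wpM2r ?sqr_ge0 //.
apply: (@le_trans _ _ ((gam / 2 * l / 2) ^+ 2)); last first.
  have h : 0 <= gam / 2 * l / 2 by rewrite !mulr_ge0 ?invr_ge0 // ltW.
  have h2 : 0 <= lam / 2 by rewrite divr_ge0 // ltW.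
  by rewrite lerXn2r ?nnegrE // ler_pM2r ?invr_gt0.
by have := ler_wpM2r (ltW l0) lbig; lra.
Qed.

Lemma app_W_le j M : 1 <= M -> (forall k, `|V j k - sg k| <= M) ->
  `|app B (V j) j - app B sg j| <= b * eta * M * l.
Proof.
move=> M1 VM; have -> : app B (V j) j - app B sg j = app B (fun k => V j k - sg k) j.
  by rewrite /app -sumrB; apply: eq_bigr => k _; rewrite mulrBr.
apply: le_trans (row_app_le _ _) _.
have := row M1 VM (loo_W_sum j); rewrite -(ler_pM2l b0) => h.
by apply: le_trans h _; rewrite !mulrA.
Qed.

Lemma W_entry_le (m : R) : (forall k, `|U k| <= m) ->
  forall j k, `|V j k - sg k| <= 1 + (1 + c3) * m.
Proof.
move=> Um j k.
have -> : V j k - sg k = - (U k - V j k) + (U k + - sg k) by ring.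
apply: le_trans (ler_normD _ _) _; rewrite normrN.
apply: le_trans (lerD (loo_dist_entry j k) (ler_normD _ _)) _; rewrite normrN sg1.
have := ler_wpM2l (ltW c30) (Um j); have := Um k; lra.
Qed.

(** At an entry of largest modulus m the eigenequation gives lam m / 2 <= |(B V)_j|. The row
    estimate bounds the part of this due to [V - sg] by a small multiple of (1 + m) l, absorbed on
    the left by [etac]; the rest is [app B sg j], at most b C l. *)
Lemma sup_bound i : `|U i| <= 4 * c3.
Proof.
pose j := [arg max_(k > i) `|U k|]%O.
have Uj k : `|U k| <= `|U j|.
  by rewrite /j; case: arg_maxP => // x _; exact.
apply: le_trans (Uj i) _; set m := `|U j|.
have m0 : 0 <= m by exact: normr_ge0.
pose M := 1 + (1 + c3) * m.
have c3p := c30.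
have M1 : 1 <= M by rewrite /M lerDl mulr_ge0 // addr_ge0 // ltW.
have W := app_W_le M1 (W_entry_le Uj j).
have S := app_sg_le j.
have E := loo_entry j.
have h1 : lam / 2 * m <= `|app B (V j) j|.
  have : `|lam * U j| <= `|lam * U j - app B (V j) j| + `|app B (V j) j|.
    by rewrite -[X in `|X| <= _](subrK (app B (V j) j)) ler_normD.
  rewrite normrM (gtr0_norm lam0) -/m; move: E; rewrite -/m; lra.
have h2 : `|app B (V j) j| <= b * eta * M * l + b * (C * l).
  by rewrite -[X in `|X| <= _](subrK (app B sg j)); apply: le_trans (ler_normD _ _) (lerD W S).
have h3 := le_trans h1 h2.
have h4 : gam / 4 * m * l <= (b * eta * M + b * C) * l.
  have := ler_wpM2r m0 lam_lb; lra.
have h5 : gam / 4 * m <= b * eta * M + b * C by move: h4; rewrite ler_pM2r.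
have h6 : b * eta <= b * C by rewrite ler_pM2l.
have h7 := ler_wpM2r m0 etac.
have h8 : gam / 8 * m <= 2 * (b * C) by move: h5; rewrite /M; lra.
rewrite /c3 mulrA ler_pdivlMr //; lra.
Qed.

(** When U_i has the wrong sign, sg_i lam U_i = - lam |U_i|, and [loo_entry] loses only half of it,
    so sg_i (B V)_i <= 0. Passing from [V] to [sg] costs at most [del * l], now that [sup_bound]
    makes the deviation of [V] from [sg] bounded. *)
Lemma sign_error_llr i : sg i * U i <= 0 -> sg i * app B sg i <= del * l.
Proof.
move=> sU.
have c3p := c30; have lam0' := lam0.
pose M := 1 + (1 + c3) * (4 * c3).
have M1 : 1 <= M.
  rewrite /M lerDl; apply: mulr_ge0; [apply: addr_ge0 => //|apply: mulr_ge0 => //]; exact: ltW.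
have W := app_W_le M1 (W_entry_le sup_bound i).
have E := loo_entry i.
have sgE x : `|sg i * x| = `|x| by rewrite normrM sg1 mul1r.
have sUE : `|U i| = - (sg i * U i) by rewrite -sgE ler0_norm.
have E' : `|sg i * (lam * U i - app B (V i) i)| <= lam / 2 * `|U i| by rewrite sgE.
have W' : `|sg i * (app B (V i) i - app B sg i)| <= b * eta * M * l by rewrite sgE.
move: E' W'; rewrite !ler_norml => /andP[E' _] /andP[W' _].
have : lam / 2 * `|U i| >= 0 by rewrite mulr_ge0 // divr_ge0 // ltW.
have := ler_wpM2r (ltW l0) etadel; rewrite -/M.
move: E' W'; rewrite sUE; lra.
Qed.

End LeaveOneOut.

(** * Bad events *)

Section Scalar.
Context {R : realType}.

Lemma expR_chord (th x : R) : 0 <= x <= 1 -> expR (th * x) - 1 <= x * (expR th - 1).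
Proof.
move=> /andP[x0 x1].
have h1 := expR_ge1Dx (th - th * x); have h2 := expR_ge1Dx (- (th * x)).
have p := expR_gt0 (th * x).
have e1 : expR th = expR (th * x) * expR (th - th * x) by rewrite -expRD; congr expR; ring.
have e2 : 1 = expR (th * x) * expR (- (th * x)) by rewrite -expRD subrr expR0.
have k1 := ler_wpM2l (ltW p) h1; have k2 := ler_wpM2l (ltW p) h2.
rewrite -e1 in k1; rewrite -e2 in k2.
have q1 := ler_wpM2l x0 k1.
have x10 : 0 <= 1 - x by lra.
have q2 := ler_wpM2l x10 k2.
set E := expR (th * x) in q1 q2 *; set T := expR th in q1 *; lra.
Qed.

Lemma expR1_le4 : expR (1 : R) <= 4.
Proof.
have h : expR (2^-1 : R) <= 2 by have := @expR_le_quad R 2^-1 (lexx _); lra.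
have -> : (1 : R) = 2^-1 + 2^-1 by lra.
rewrite expRD; have := ler_pM (expR_ge0 _) (expR_ge0 _) h h; lra.
Qed.

End Scalar.

(** * Kullback-Leibler divergence of two Bernoulli laws *)

Section Divergence.
Context {R : realType}.

Definition kl (p q : R) : R := p * ln (p / q) + (1 - p) * ln ((1 - p) / (1 - q)).

Lemma ln_lt_sub1 (x : R) : 0 < x -> x != 1 -> ln x < x - 1.
Proof.
move=> x0 x1; have l0 : ln x != 0.
  by apply: contra x1 => /eqP h; rewrite -[x]lnK ?posrE // h expR0.
by have := expR_gt1Dx l0; rewrite lnK ?posrE //; lra.
Qed.

Lemma kl_gt0 (p q : R) : 0 < p < 1 -> 0 < q < 1 -> p != q -> 0 < kl p q.
Proof.
move=> /andP[p0 p1] /andP[q0 q1] pq.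
have p1' : 0 < 1 - p by lra. have q1' : 0 < 1 - q by lra.
have e1 : ln (p / q) = - ln (q / p) by rewrite -lnV ?posrE ?divr_gt0 // invf_div.
have e2 : ln ((1 - p) / (1 - q)) = - ln ((1 - q) / (1 - p)).
  by rewrite -lnV ?posrE ?divr_gt0 // invf_div.
have h1 : ln (q / p) < q / p - 1.
  apply: ln_lt_sub1; first by rewrite divr_gt0.
  by apply: contra pq => /eqP h; rewrite -[q](divfK (lt0r_neq0 p0)) h mul1r.
have h2 : ln ((1 - q) / (1 - p)) < (1 - q) / (1 - p) - 1.
  apply: ln_lt_sub1; first by rewrite divr_gt0.
  apply: contra pq => /eqP h.
  have : 1 - q = 1 - p by rewrite -[1 - q](divfK (lt0r_neq0 p1')) h mul1r.
  by move=> h'; apply/eqP; lra.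
have k1 : p * ln (q / p) < p * (q / p - 1) by rewrite ltr_pM2l.
have k2 : (1 - p) * ln ((1 - q) / (1 - p)) < (1 - p) * ((1 - q) / (1 - p) - 1) by rewrite ltr_pM2l.
have f1 : p * (q / p - 1) = q - p by field; rewrite gt_eqF.
have f2 : (1 - p) * ((1 - q) / (1 - p) - 1) = p - q by field; rewrite gt_eqF.
rewrite /kl e1 e2; move: k1 k2; rewrite f1 f2; lra.
Qed.

End Divergence.

(** * Tail bounds for the revealed pairs *)

Section BadEvents.
Context {R : realType} (p q t : R) {n : nat}.
Hypotheses (p01 : 0 < p < 1) (q01 : 0 < q < 1) (pq : p != q) (t0 : 0 < t)
  (a01 : 0 < reveal_prob t n < 1) (n2 : (2 <= n)%N).
Notation al := (reveal_prob t n).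
Notation l := (ln (n%:R : R)).
Notation pmf := (obs_pmf p q al).
Implicit Types (s : labels n) (g : observation n) (e : upair n).

Let nR0 : 0 < n%:R :> R. Proof. by rewrite ltr0n; apply: leq_trans n2. Qed.
Lemma ln_natr_gt0 : 0 < l.
Proof. by rewrite ln_gt0 // ltr1n. Qed.
Lemma al_nE : al * n%:R = t * l.
Proof. by rewrite /reveal_prob divfK ?gt_eqF. Qed.

(** [rmx] and [lmx] are the matrices [D] and [B] of the deterministic estimates above. *)
Definition rmx g (i j : 'I_n) : R := (status g [set i; j]%SET != None)%:R.
Definition lmx g (i j : 'I_n) : R := llr p q (status g [set i; j]%SET).

Lemma rmx_sym g : symm (rmx g).
Proof. by move=> i j; rewrite /rmx finset.setUC. Qed.
Lemma lmx_sym g : symm (lmx g).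
Proof. by move=> i j; rewrite /lmx finset.setUC. Qed.
Lemma rmx_diag g i : rmx g i i = 0.
Proof. by rewrite /rmx status_diag. Qed.
Lemma lmx_diag g i : lmx g i i = 0.
Proof. by rewrite /lmx status_diag. Qed.
Lemma rmx_ge0 g i j : 0 <= rmx g i j.
Proof. exact: ler0n. Qed.
Lemma rmx_le1 g i j : rmx g i j <= 1.
Proof. by rewrite /rmx lern1 leq_b1. Qed.
Lemma lmx_le g i j : `|lmx g i j| <= llr_bound p q * rmx g i j.
Proof.
rewrite /lmx /rmx; case E: (status _ _) => [v|]; last by rewrite normr0 mulr0.
by have := llr_boundP p q (Some v); rewrite mulr1.
Qed.

Lemma sum_obs_pmf_revealed s e (c : R) :
  \sum_v pmf s e v * expR (c * (v != None)%:R) <= expR (al * (expR c - 1)).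
Proof.
rewrite sum_option_bool /= mulr0 expR0 !mulr1 /bernoulli_pmf.
apply: le_trans (expR_ge1Dx _); apply: ler_of_eq.
by ring.
Qed.

(* The weights may depend on the pairs outside J, which are independent of the
   pairs in J. *)
Lemma revealed_mgf s (J : pred (upair n)) (c : observation n -> upair n -> R) (K : R) :
  (forall g k e, c (mix J g k) e = c g e) -> (forall g e, ~~ J e -> c g e = 0) ->
  (forall g, \sum_e (expR (c g e) - 1) <= K) ->
  prodE (pmf s) (fun g => expR (\sum_e c g e * (g e != None)%:R)) <=
  expR (al * K).
Proof.
move=> cmix c0 cK; have fP := obs_pmfP p01 q01 a01 s.
pose H g e (v : option bool) : R := expR (c g e * (v != None)%:R).
have := prodE_indep_le (J := J) (H := H) (c := expR (al * K)) fP.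
have -> : prodE (pmf s) (fun g => \prod_e H g e (g e)) =
    prodE (pmf s) (fun g => expR (\sum_e c g e * (g e != None)%:R)).
  by apply: eq_bigr => g _; rewrite expR_sum.
apply => [g k e v|g e v Je|g].
- by rewrite /H cmix.
- by rewrite /H c0 // mul0r expR0.
apply: (@le_trans _ _ (\prod_e expR (al * (expR (c g e) - 1)))).
  apply: ler_prod => e _; rewrite sum_obs_pmf_revealed andbT.
  by apply: sumr_ge0 => v _; rewrite mulr_ge0 ?expR_ge0 ?(fP.1).
rewrite -expR_sum ler_expR -mulr_sumr ler_wpM2l //.
by case/andP: a01 => /ltW.
Qed.

Lemma revealed_tail s (J : pred (upair n)) (c : observation n -> upair n -> R) (K x : R)
    (A : pred (observation n)) :
  (forall g k e, c (mix J g k) e = c g e) -> (forall g e, ~~ J e -> c g e = 0) ->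
  (forall g, \sum_e (expR (c g e) - 1) <= K) ->
  (forall g, A g -> x <= \sum_e c g e * (g e != None)%:R) ->
  prodPr (pmf s) A <= expR (al * K - x).
Proof.
move=> cmix c0 cK cA; have fP := obs_pmfP p01 q01 a01 s.
rewrite expRD mulrC; apply: le_trans (ler_wpM2l (expR_ge0 _) (revealed_mgf s cmix c0 cK)).
rewrite -prodEZ; apply: prodPr_markov => [//|g|g /cA h]; first by rewrite mulr_ge0 ?expR_ge0.
by rewrite -expRD -[leLHS]expR0 ler_expR; lra.
Qed.

Lemma natr_expR_ln : n%:R = expR l.
Proof. by rewrite lnK. Qed.

Lemma sum_rmx_row g i : \sum_j rmx g i j = \sum_(e : upair n | i \in val e) (g e != None)%:R.
Proof.
rewrite (bigD1 i) //= rmx_diag add0r.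
rewrite -(big_upair_row _ (fun S => (status g S != None)%:R)).
by apply: eq_bigr => e _; rewrite status_val.
Qed.

(** The constant comes from Chernoff with exponent 1: e - 1 <= 3 gives n^(3 t), so the threshold (5
    + 3 t) l leaves n^-5 for each vertex. *)
Definition bad_degree g : bool := [exists i, (5 + 3 * t) * l < \sum_j rmx g i j].

Lemma bad_degree_le s : prodPr (pmf s) bad_degree <= expR (- 4 * l).
Proof.
have fP := obs_pmfP p01 q01 a01 s.
apply: le_trans (prodPr_union _ fP) _.
apply: (@le_trans _ _ (\sum_(i < n) expR (- 5 * l))); last first.
  rewrite sumr_const card_ord -(mulr_natl (expR _)) [X in X * _]natr_expR_ln -expRD ler_expR; lra.
apply: ler_sum => i _.
pose c g e : R := (i \in val e)%:R.
(* The weights do not depend on the observation; the fully censored one only fills the argument. *)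
have H := @revealed_tail s (fun e => i \in val e) (fun=> c (finfun (fun=> None))) (3 * n%:R) ((5 + 3 * t) * l) (fun g => (5 + 3 * t) * l < \sum_j rmx g i j).
apply: le_trans (H _ _ _ _) _ => //.
- by move=> _ e /negPf; rewrite /c => ->.
- move=> _; rewrite /c.
  apply: (@le_trans _ _ (\sum_(e : upair n | i \in val e) 3)).
    rewrite [leRHS]big_mkcond /=; apply: ler_sum => e _; case: (i \in val e).
      by rewrite lerBlDr (_ : 3 + 1 = 4 :> R); [exact: expR1_le4|ring].
    by rewrite expR0 subrr.
  rewrite sumr_const -(mulr_natl 3) mulrC ler_pM2l // card_upair_row ler_nat leq_pred //.
- move=> g /ltW h; apply: (le_trans h); rewrite sum_rmx_row big_mkcond.
  by apply: ler_sum => e _; rewrite /c; case: (i \in val e); rewrite ?mul1r ?mul0r.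
by rewrite mulrCA al_nE ler_expR; have := ln_natr_gt0; clear H; lra.
Qed.

Lemma sum_rmx_set g (V : {set 'I_n}) :
  \sum_(i in V) \sum_(j in V) rmx g i j =
  \sum_(e : upair n) (2 * (val e \subset V)%:R) * (g e != None)%:R.
Proof.
pose F (S : {set 'I_n}) : R := (S \subset V)%:R * (status g S != None)%:R.
transitivity (\sum_i \sum_(j | j != i) F [set i; j]%SET).
  rewrite big_mkcond; apply: eq_bigr => i _.
  case: (boolP (i \in V)) => iV; last first.
    rewrite big1 // => j _; rewrite /F finset.subUset finset.sub1set (negPf iV) /=.
    by rewrite mul0r.
  rewrite (bigID (fun j => j == i)) /= big1 ?add0r; last first.
    by move=> j /andP[_ /eqP->]; rewrite rmx_diag.
  rewrite [RHS](bigID (mem V)) /= [X in _ = _ + X]big1 ?addr0; last first.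
    move=> j /andP[_ /negPf jV]; rewrite /F finset.subUset !finset.sub1set jV andbF.
    by rewrite mul0r.
  apply: eq_big => [j|j /andP[jV _]]; first by rewrite andbC.
  by rewrite /F finset.subUset !finset.sub1set iV jV mul1r.
rewrite upair_double_sum -[LHS]mulr_natl mulr_sumr; apply: eq_bigr => e _.
by rewrite /F status_val mulrA.
Qed.

Lemma sum_upair_subset (V : {set 'I_n}) :
  2 * \sum_(e : upair n) (val e \subset V)%:R <= #|V|%:R ^+ 2 :> R.
Proof.
rewrite mulr_natl -(upair_double_sum (fun S => (S \subset V)%:R)).
apply: (@le_trans _ _ (\sum_(i in V) \sum_(j in V) 1)); last first.
  by rewrite sumr_const sumr_const -mulrnA natrM expr2.
rewrite [leRHS]big_mkcond; apply: ler_sum => i _.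
case: (boolP (i \in V)) => iV; last first.
  by rewrite big1 // => j _; rewrite finset.subUset finset.sub1set (negPf iV).
rewrite [leLHS]big_mkcond [leRHS]big_mkcond; apply: ler_sum => j _.
by rewrite finset.subUset !finset.sub1set iV; case: (j != i); case: (j \in V).
Qed.

Lemma sum_pow_card (x : R) : \sum_(V : {set 'I_n}) x ^+ #|V| = (1 + x) ^+ n.
Proof.
have := @bigA_distr R 0 1 *%R +%R 'I_n (fun=> x) (fun=> 1).
rewrite prodr_const card_ord addrC => ->; apply: eq_bigr => V _.
by rewrite -big_mkcond /= prodr_const.
Qed.

Definition bad_subset (e1 K : R) g : bool :=
  [exists V : {set 'I_n}, [&& V != finset.set0, #|V|%:R * K ^+ 2 <= n%:R &
     e1 ^+ 2 * l * #|V|%:R < \sum_(i in V) \sum_(j in V) rmx g i j]].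

(** A set V of at most n / K^2 vertices contains so few pairs that the exponential moment costs at
    most n^|V|. The tilt gains n^(7 |V|), so V fails with probability at most n^(-6 |V|); summed
    over all nonempty V this is (1 + n^-6)^n - 1. *)
Lemma bad_subset_le s (e1 K : R) : 0 < e1 -> 0 < K ->
  t * expR (14 / e1 ^+ 2) <= 2 * K ^+ 2 ->
  prodPr (pmf s) (bad_subset e1 K) <= expR (- 4 * l).
Proof.
move=> e10 K0 HK; have fP := obs_pmfP p01 q01 a01 s.
have l0 := ln_natr_gt0.
have K20 : 0 < K ^+ 2 by rewrite exprn_gt0.
apply: le_trans (prodPr_union _ fP) _.
apply: (@le_trans _ _ (\sum_(V : {set 'I_n} | V != finset.set0) expR (- 6 * l) ^+ #|V|)).
  rewrite [leRHS]big_mkcond /=; apply: ler_sum => V _.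
  case: eqP => [->|/eqP V0] /=; first by rewrite /prodPr big1.
  set A := fun g => _.
  have [VK|VK] := boolP (#|V|%:R * K ^+ 2 <= n%:R); last first.
    by rewrite /prodPr big1 ?exprn_ge0 ?expR_ge0 // => g; rewrite /A (negPf VK).
  pose th : R := 7 / e1 ^+ 2.
  have th0 : 0 < th by rewrite divr_gt0 // exprn_gt0.
  pose c e : R := 2 * th * (val e \subset V)%:R.
  have sumc g : \sum_e c e * (g e != None)%:R = th * \sum_(i in V) \sum_(j in V) rmx g i j.
    by rewrite sum_rmx_set mulr_sumr; apply: eq_bigr => e _; rewrite /c; ring.
  have H := @revealed_tail s xpredT (fun=> c) (#|V|%:R * n%:R * expR (2 * th) / (2 * K ^+ 2))
     (th * (e1 ^+ 2 * l * #|V|%:R)) A.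
  apply: le_trans (H _ _ _ _) _ => //.
  - move=> _; apply: (@le_trans _ _ (\sum_(e : upair n) (val e \subset V)%:R * expR (2 * th))).
      apply: ler_sum => e _; rewrite /c; case: (val e \subset V).
        by rewrite mulr1 mul1r lerBlDr lerDl.
      by rewrite mulr0 expR0 subrr mul0r.
    rewrite -mulr_suml mulrAC ler_wpM2r ?expR_ge0 // ler_pdivlMr ?mulr_gt0 //.
    rewrite mulrA [_ * 2]mulrC; apply: le_trans (ler_wpM2r (ltW K20) (sum_upair_subset V)) _.
    by rewrite expr2 -mulrA ler_wpM2l.
  - by move=> g; rewrite /A => /andP[_ /ltW h]; rewrite sumc ler_pM2l.
  rewrite -expRM_natl ler_expR.
  have -> : al * (#|V|%:R * n%:R * expR (2 * th) / (2 * K ^+ 2)) =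
     (t * expR (2 * th)) / (2 * K ^+ 2) * l * #|V|%:R.
    have -> : al * (#|V|%:R * n%:R * expR (2 * th) / (2 * K ^+ 2)) =
      (al * n%:R) * (#|V|%:R * expR (2 * th) / (2 * K ^+ 2)) by ring.
    by rewrite al_nE; ring.
  have -> : th * (e1 ^+ 2 * l * #|V|%:R) = 7 * l * #|V|%:R.
    by rewrite /th; field; rewrite gt_eqF.
  have h : t * expR (2 * th) / (2 * K ^+ 2) <= 1.
    rewrite ler_pdivrMr ?mulr_gt0 // mul1r; apply: le_trans HK.
    by rewrite ler_wpM2l ?(ltW t0) // ler_expR /th; clear H; lra.
  have vl : 0 <= l * #|V|%:R by rewrite mulr_ge0 // ltW.
  have := ler_wpM2r vl h; clear H; lra.
set x := expR (- 6 * l).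
have x0 : 0 <= x by exact: expR_ge0.
have -> : \sum_(V : {set 'I_n} | V != finset.set0) x ^+ #|V| = (1 + x) ^+ n - 1.
  rewrite -sum_pow_card [X in _ = X - _](bigD1 finset.set0) //= cards0 expr0.
  by rewrite addrAC subrr add0r.
have nx : n%:R * x = expR (- 5 * l).
  by rewrite [X in X * _]natr_expR_ln /x -expRD; congr expR; lra.
have half : expR (- l) <= 2^-1.
  by rewrite expRN -natr_expR_ln lef_pV2 ?posrE // ler_nat.
have y4 : expR (- 5 * l) <= expR (- 4 * l) / 2.
  rewrite (_ : - 5 * l = - 4 * l + - l); last lra.
  by rewrite expRD ler_wpM2l ?expR_ge0.
have y2 : expR (- 5 * l) <= 2^-1.
  by apply: le_trans half; rewrite ler_expR; lra.
have : (1 + x) ^+ n <= expR (n%:R * x).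
  by rewrite expRM_natl lerXn2r ?nnegrE ?expR_ge0 ?addr_ge0 // expR_ge1Dx.
rewrite nx; set y := expR (- 5 * l) in y2 y4 *.
have y0 : 0 <= y by exact: expR_ge0.
have := expR_le_quad y2; have := ler_wpM2l y0 y2; rewrite expr2.
by move: (expR y) => z; lra.
Qed.

(** Whatever is computed from [censor j g] is independent of the pairs at [j]; applying the
    estimator's own eigenvector map to it yields the leave-one-out vector. *)
Definition censor (j : 'I_n) g : observation n :=
  [ffun e : upair n => if j \in val e then None else g e].

Lemma censor_mix j g k : censor j (mix (fun e : upair n => j \in val e) g k) = censor j g.
Proof. by apply/ffunP => e; rewrite !ffunE; case: (j \in val e). Qed.

Definition maxabs (w : 'I_n -> R) : R := \big[Num.max/1]_k `|w k|.

Lemma maxabs_ge1 w : 1 <= maxabs w.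
Proof. by rewrite /maxabs; elim/big_rec: _ => // k x _ h; rewrite le_max h orbT. Qed.

Lemma maxabs_ge w k : `|w k| <= maxabs w.
Proof. by rewrite /maxabs (bigD1 k) //= le_max lexx. Qed.

Lemma maxabs_le w M : 1 <= M -> (forall k, `|w k| <= M) -> maxabs w <= M.
Proof.
by move=> M1 wM; rewrite /maxabs; elim/big_rec: _ => // k x _ h; rewrite ge_max wM.
Qed.

Definition bad_row (eta e3 : R) (w : 'I_n -> observation n -> 'I_n -> R) g : bool :=
  [exists j, (\sum_k `|w j (censor j g) k| <= e3 * n%:R) &&
    (eta * maxabs (w j (censor j g)) * l < \sum_k rmx g j k * `|w j (censor j g) k|)].

(** Given the pairs away from [j], row j is fresh and the weights |W k| / max lie in [0, 1]. The
    chord of the exponential makes the cost proportional to their l1 norm, at most e3 n, so the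
    moment is at most n; the tilt 6 / eta gains n^6, leaving n^-5 for each vertex. *)
Lemma bad_row_le s (eta e3 : R) w : 0 < eta -> 0 < e3 ->
  t * e3 * expR (6 / eta) <= 1 ->
  prodPr (pmf s) (bad_row eta e3 w) <= expR (- 4 * l).
Proof.
move=> eta0 e30 He3; have fP := obs_pmfP p01 q01 a01 s.
have l0 := ln_natr_gt0.
apply: le_trans (prodPr_union _ fP) _.
apply: (@le_trans _ _ (\sum_(i < n) expR (- 5 * l))); last first.
  rewrite sumr_const card_ord -(mulr_natl (expR _)) [X in X * _]natr_expR_ln.
  by rewrite -expRD ler_expR; lra.
apply: ler_sum => j _; set A := fun g => _.
pose th : R := 6 / eta.
have th0 : 0 < th by rewrite divr_gt0.
pose W g := w j (censor j g).
(* The moment bound must hold for every observation, so the weights are switched off where the l1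
   condition fails; this condition also depends on pairs away from [j] only. *)
pose cond g : bool := \sum_k `|W g k| <= e3 * n%:R.
(* The product over [S :\ j] has one factor when [S] is a pair at [j]: it reads off the entry at the
   other endpoint without naming it. *)
pose F g (S : {set 'I_n}) : R := th * ((\prod_(k in S :\ j) `|W g k|) / maxabs (W g)).
pose c g e : R := if (j \in val e) && cond g then F g (val e) else 0.
have M0 g : 0 < maxabs (W g) by apply: lt_le_trans (maxabs_ge1 _).
have Fj g k : k != j -> F g [set j; k]%SET = th * (`|W g k| / maxabs (W g)).
  move=> kj; rewrite /F (_ : [set j; k] :\ j = [set k])%SET ?big_set1 //.
  apply/setP => i; rewrite !inE; case: (eqVneq i j) => [->|] //=.
  by rewrite eq_sym (negPf kj).
have H := @revealed_tail s (fun e => j \in val e) c (e3 * n%:R * expR th) (th * (eta * l)) A.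
apply: le_trans (H _ _ _ _) _.
- by move=> g k e; rewrite /c /cond /F /W !censor_mix.
- by move=> g e /negPf je; rewrite /c je.
- move=> g; rewrite /c; case: (boolP (cond g)) => cg; last first.
    rewrite big1 => [|e _]; first by rewrite !mulr_ge0 ?expR_ge0 // ltW.
    by rewrite andbF expR0 subrr.
  rewrite (bigID (fun e : upair n => j \in val e)) /= [X in _ + X]big1 ?addr0; last first.
    by move=> e /negPf->; rewrite expR0 subrr.
  apply: (@le_trans _ _ (\sum_(e : upair n | j \in val e) (expR (F g (val e)) - 1))).
    by apply: ler_sum => e ->.
  rewrite (big_upair_row _ (fun S => expR (F g S) - 1)).
  apply: (@le_trans _ _ (\sum_(k | k != j) `|W g k| * expR th)).
    apply: ler_sum => k kj; rewrite Fj //.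
    have Wk : 0 <= `|W g k| / maxabs (W g) <= 1.
      by rewrite divr_ge0 ?(ltW (M0 g)) //= ler_pdivrMr // mul1r maxabs_ge.
    apply: le_trans (expR_chord th Wk) _; apply: ler_pM.
    - by case/andP: Wk.
    - by rewrite subr_ge0 -[leLHS]expR0 ler_expR ltW.
    - by rewrite ler_pdivrMr // ler_peMr // maxabs_ge1.
    - by rewrite lerBlDr lerDl.
  rewrite -mulr_suml ler_wpM2r ?expR_ge0 //; apply: le_trans cg.
  by rewrite [leRHS](bigD1 j) //= lerDr.
- move=> g; rewrite /A => /andP[cg /ltW h].
  have -> : \sum_e c g e * (g e != None)%:R =
      th / maxabs (W g) * \sum_k rmx g j k * `|W g k|.
    transitivity (\sum_(e : upair n | j \in val e) F g (val e) * (status g (val e) != None)%:R).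
      rewrite [RHS]big_mkcond; apply: eq_bigr => e _; rewrite /c /cond cg andbT status_val.
      by case: (j \in val e); rewrite ?mul0r.
    rewrite (big_upair_row _ (fun S => F g S * (status g S != None)%:R)).
    rewrite [in RHS](bigD1 j) //= rmx_diag mul0r add0r mulr_sumr.
    by apply: eq_bigr => k kj; rewrite Fj // -/(rmx g j k); ring.
  have -> : th * (eta * l) = th / maxabs (W g) * (eta * maxabs (W g) * l).
    by have := gt_eqF (M0 g); move: (maxabs (W g)) => M Mn; field; rewrite Mn.
  by rewrite ler_wpM2l // divr_ge0 ?(ltW th0) ?(ltW (M0 g)).
rewrite ler_expR.
have -> : al * (e3 * n%:R * expR th) = (t * e3 * expR th) * l.
  have -> : al * (e3 * n%:R * expR th) = (al * n%:R) * (e3 * expR th) by ring.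
  by rewrite al_nE; ring.
have -> : th * (eta * l) = 6 * l by rewrite /th; field; rewrite gt_eqF.
have := ler_wpM2r (ltW l0) He3; rewrite -/th; clear H; lra.
Qed.

(** * Deviations of the log-likelihood quadratic form *)

Notation b := (llr_bound p q).
Implicit Types (Y : 'I_n -> R).

Definition spins s : 'I_n -> R := fun i => spin R (s i).
Lemma norm2_spins s : norm2 (spins s) = n%:R.
Proof.
by rewrite /norm2 (eq_bigr (fun=> 1)) ?sumr_const ?card_ord // => i _; rewrite spin_sqr.
Qed.

(** A revealed pair has mean log-ratio [kl p q] if its labels agree and [- kl q p] otherwise, that
    is [offset + drift * pair_sign]. These are the weights of the all-ones matrix and of s s^T in
    the mean matrix, up to the factor [al]. *)
Definition drift : R := (kl p q + kl q p) / 2.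
Definition offset : R := (kl p q - kl q p) / 2.

Definition pair_prod Y e : R := \prod_(k in val e) Y k.

Lemma pair_prod_sum (F : {set 'I_n} -> R) Y :
  2 * \sum_e F (val e) * pair_prod Y e =
  \sum_i \sum_(j | j != i) F [set i; j]%SET * (Y i * Y j).
Proof.
transitivity ((\sum_(e : upair n) F (val e) * \prod_(k in val e) Y k) *+ 2).
  by rewrite mulr_natl.
rewrite -(upair_double_sum (fun S => F S * \prod_(k in S) Y k)).
apply: eq_bigr => i _; apply: eq_bigr => j ji; congr (_ * _).
by rewrite big_setU1 ?inE 1?eq_sym //= big_set1.
Qed.

Lemma sum_pair_prod Y : 2 * \sum_e pair_prod Y e = (\sum_i Y i) ^+ 2 - norm2 Y.
Proof.
have := pair_prod_sum (fun=> 1) Y; under eq_bigr do rewrite mul1r.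
move=> ->; rewrite expr2 mulr_suml /norm2 -sumrB; apply: eq_bigr => i _.
rewrite [in RHS](bigD1 i) //= mulrDr -expr2 addrAC subrr add0r mulr_sumr.
by apply: eq_bigr => j _; rewrite mul1r.
Qed.

Lemma pair_prodM Y Z e : pair_prod (fun i => Y i * Z i) e = pair_prod Y e * pair_prod Z e.
Proof. by rewrite /pair_prod big_split. Qed.

Lemma pair_prod_spins s e : pair_prod (spins s) e = pair_sign s e.
Proof.
have [i [j [ji E]]] := upair_setP e.
by rewrite (pair_signE s E) /pair_prod E big_setU1 ?inE 1?eq_sym //= big_set1.
Qed.

Lemma pair_prod_le Y (K : R) e : (forall i, `|Y i| <= K) -> `|pair_prod Y e| <= K ^+ 2.
Proof.
move=> YK; have [i [j [ji E]]] := upair_setP e.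
rewrite /pair_prod E big_setU1 ?inE 1?eq_sym //= big_set1 normrM expr2.
by apply: ler_pM.
Qed.

Lemma qform_lmx g Y : qform (lmx g) Y = 2 * \sum_e pair_prod Y e * llr p q (g e).
Proof.
have := pair_prod_sum (fun S => llr p q (status g S)) Y.
under eq_bigr do rewrite status_val mulrC.
move=> ->; apply: eq_bigr => i _.
by rewrite [LHS](bigD1 i) //= lmx_diag mul0r add0r.
Qed.

(** Times [al], the mean of [qform (lmx g) Y]. The last term removes the diagonal, since
    [drift + offset] is [kl p q]. *)
Definition quad_mean s Y : R :=
  drift * (dotp Y (spins s) ^+ 2) + offset * (\sum_i Y i) ^+ 2 - kl p q * norm2 Y.

Lemma kl_sym : q * ln (p / q) + (1 - q) * ln ((1 - p) / (1 - q)) = - kl q p.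
Proof.
have /andP[p0 p1] := p01; have /andP[q0 q1] := q01.
have p1' : 0 < 1 - p by lra. have q1' : 0 < 1 - q by lra.
have e1 : ln (q / p) = - ln (p / q) by rewrite -lnV ?posrE ?divr_gt0 // invf_div.
have e2 : ln ((1 - q) / (1 - p)) = - ln ((1 - p) / (1 - q)).
  by rewrite -lnV ?posrE ?divr_gt0 // invf_div.
by rewrite /kl e1 e2; ring.
Qed.

Lemma sum_obs_pmf_llr s e (c : R) : `|c| * b <= 2^-1 ->
  \sum_v pmf s e v * expR (c * llr p q v) <=
  expR (al * (c * (offset + drift * pair_sign s e) + 2 * c ^+ 2 * b ^+ 2)).
Proof.
move=> cb; have /andP[a0 a1] := a01.
have /andP[p0 p1] := p01; have /andP[q0 q1] := q01.
have b0 : 0 <= b by rewrite addr_ge0.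
have quad v : expR (c * llr p q v) <= 1 + c * llr p q v + 2 * c ^+ 2 * b ^+ 2.
  have lv : `|c * llr p q v| <= `|c| * b by rewrite normrM ler_wpM2l // llr_boundP.
  apply: le_trans (expR_le_quad _) _; first exact: le_trans (ler_norm _) (le_trans lv cb).
  rewrite lerD2l -mulrA ler_pM2l // -exprMn; apply: ler_sqr_of_norm.
  by rewrite (normrM c b) (ger0_norm b0).
apply: le_trans (expR_ge1Dx _).
rewrite sum_option_bool /= mulr0 expR0 mulr1.
have h1 := quad (Some true); have h2 := quad (Some false).
rewrite /= in h1 h2; set T := 2 * c ^+ 2 * b ^+ 2 in h1 h2 *.
set E1 := expR _ in h1 *; set E2 := expR _ in h2 *.
set k1 := ln (p / q) in h1; set k2 := ln ((1 - p) / (1 - q)) in h2.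
have comb r : 0 < r < 1 -> r * k1 + (1 - r) * k2 = offset + drift * pair_sign s e ->
    1 - al + (al * r * E1 + al * (1 - r) * E2) <=
    1 + al * (c * (offset + drift * pair_sign s e) + T).
  move=> /andP[r0 r1] <-.
  have ar0 : 0 <= al * r by rewrite mulr_ge0 // ltW.
  have ar1 : 0 <= al * (1 - r) by rewrite mulr_ge0 // ltW // subr_gt0.
  by have := ler_wpM2l ar0 h1; have := ler_wpM2l ar1 h2; lra.
have := comb (edge_prob p q s e) (edge_prob01 p01 q01 s e).
rewrite /bernoulli_pmf; apply.
have := kl_sym; rewrite /k1 /k2 /pair_sign /edge_prob /offset /drift; case: ifP => _ h.
  by rewrite mulr1 -[LHS]/(kl p q); field.
by rewrite h; field.
Qed.

Lemma llr_tail s (c : upair n -> R) (x : R) (A : pred (observation n)) :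
  (forall e, `|c e| * b <= 2^-1) ->
  (forall g, A g -> x <= \sum_e c e * llr p q (g e)) ->
  prodPr (pmf s) A <=
  expR (al * (\sum_e (c e * (offset + drift * pair_sign s e) + 2 * c e ^+ 2 * b ^+ 2)) - x).
Proof.
move=> cb cA; have fP := obs_pmfP p01 q01 a01 s.
apply: (@le_trans _ _ (expR (- x) * prodE (pmf s)
    (fun g => \prod_e expR (c e * llr p q (g e))))).
  rewrite -prodEZ; apply: prodPr_markov => [//|g|g /cA h].
    by rewrite -expR_sum mulr_ge0 ?expR_ge0.
  by rewrite -expR_sum -expRD -[leLHS]expR0 ler_expR; lra.
rewrite expRD mulrC ler_wpM2r ?expR_ge0 //.
rewrite (prodE_prod (pmf s) (fun e v => expR (c e * llr p q v))).
rewrite mulr_sumr expR_sum; apply: ler_prod => e _; rewrite sum_obs_pmf_llr // andbT.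
by apply: sumr_ge0 => v _; rewrite mulr_ge0 ?expR_ge0 // ltW // obs_pmf_gt0.
Qed.

(** The sign of [th] is free: positive for the upper bound on the grid, negative for the lower bound
    at the labels. The exponents stay in the quadratic range because the entries of [Y] are bounded,
    which is why heavy coordinates are cut off beforehand. *)
Lemma qform_tail s Y (th x K : R) (A : pred (observation n)) :
  (forall i, `|Y i| <= K) -> 2 * `|th| * K ^+ 2 * b <= 2^-1 ->
  norm2 Y <= n%:R ->
  (forall g, A g -> x <= th * qform (lmx g) Y) ->
  prodPr (pmf s) A <=
  expR (al * (th * quad_mean s Y + 4 * th ^+ 2 * b ^+ 2 * n%:R ^+ 2) - x).
Proof.
move=> YK thK Yn YA; have /andP[a0 a1] := a01.
have b0 : 0 <= b by rewrite addr_ge0.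
pose c e := 2 * th * pair_prod Y e.
have H := @llr_tail s c x A; apply: le_trans (H _ _) _.
- move=> e; apply: le_trans thK; rewrite /c !normrM (@ger0_norm _ 2) //.
  by rewrite ler_wpM2r // ler_wpM2l ?mulr_ge0 // pair_prod_le.
- move=> g /YA h; apply: (le_trans h); rewrite qform_lmx; apply: ler_of_eq.
  by rewrite mulrCA mulr_sumr mulr_sumr; apply: eq_bigr => e _; rewrite /c; ring.
rewrite ler_expR lerD2r ler_wpM2l ?(ltW a0) //.
have -> : \sum_e (c e * (offset + drift * pair_sign s e) + 2 * c e ^+ 2 * b ^+ 2) =
    th * (offset * (2 * \sum_e pair_prod Y e) +
          drift * (2 * \sum_e pair_prod (fun i => Y i * spins s i) e)) +
    4 * th ^+ 2 * b ^+ 2 * (2 * \sum_e pair_prod (fun i => Y i * Y i) e).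
  rewrite big_split /=; congr (_ + _).
    rewrite !mulr_sumr -big_split /= mulr_sumr.
    by apply: eq_bigr => e _; rewrite pair_prodM pair_prod_spins /c; ring.
  by rewrite !mulr_sumr; apply: eq_bigr => e _; rewrite pair_prodM /c; ring.
rewrite !sum_pair_prod; apply: lerD.
  apply: ler_of_eq; congr (_ * _).
  have -> : norm2 (fun i => Y i * spins s i) = norm2 Y.
    by apply: eq_bigr => i _; rewrite exprMn spin_sqr mulr1.
  rewrite /quad_mean /dotp (_ : kl p q = offset + drift); first by ring.
  by rewrite /offset /drift; field.
apply: ler_wpM2l.
  by apply: mulr_ge0; [apply: mulr_ge0 => //|]; exact: sqr_ge0.
apply: (@le_trans _ _ (norm2 Y ^+ 2)); last by rewrite lerXn2r ?nnegrE ?norm2_ge0.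
rewrite (eq_bigr (fun i => Y i ^+ 2)) => [|i _]; last by rewrite expr2.
by rewrite lerBlDr lerDl norm2_ge0.
Qed.

(** Bessel's inequality for the label vector and the all-ones vector, which are almost orthogonal
    when the labels are balanced. *)
Lemma bessel_spins s Y (eb : R) : 0 <= eb -> balanced eb s ->
  dotp Y (spins s) ^+ 2 + (\sum_i Y i) ^+ 2 <= (1 + eb) * n%:R * norm2 Y.
Proof.
move=> eb0; rewrite /balanced -/(spins s) => bal.
set S := dotp Y _; set T := \sum_i Y i; set be := \sum_i spin R (s i) in bal.
(* The larger eigenvalue of the Gram matrix of the two vectors, with diagonal [n] and off-diagonal
   entry [be]. *)
pose k := n%:R + `|be|.
have k0 : 0 < k by rewrite ltr_wpDr.
have kb : k <= (1 + eb) * n%:R by rewrite /k mulrDl mul1r lerD2l.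
have ss := norm2_spins s.
have n1 : norm2 (fun _ : 'I_n => 1 : R) = n%:R.
  by rewrite /norm2 (eq_bigr (fun=> 1)) ?sumr_const ?card_ord // => i _; rewrite expr1n.
have d1 : dotp (fun _ : 'I_n => 1) (spins s) = be.
  by apply: eq_bigr => i _; rewrite mul1r.
have dT : dotp Y (fun=> 1) = T by apply: eq_bigr => i _; rewrite mulr1.
have := norm2_ge0 (fun i => (Y i + (- (S / k)) * spins s i) + (- (T / k)) * 1).
rewrite (norm2_lin _ (fun i => Y i + _ * spins s i) (fun=> 1)) norm2_lin dotp_lin.
rewrite n1 ss (dotpC (spins s)) d1 dT -/S => h.
have h2 : 2 * (S * T * be) <= `|be| * (S ^+ 2 + T ^+ 2).
  apply: le_trans (ler_norm _) _; rewrite !normrM ger0_norm //.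
  rewrite -(real_normK (num_real S)) -(real_normK (num_real T)).
  have := sqr_ge0 (`|S| - `|T|) => h3.
  have : 2 * (`|S| * `|T|) <= `|S| ^+ 2 + `|T| ^+ 2 by lra.
  by move=> /(ler_wpM2l (normr_ge0 be)); lra.
have h4 : 0 <= norm2 Y * k - (S ^+ 2 + T ^+ 2).
  have : 0 <= norm2 Y * k - 2 * (S ^+ 2 + T ^+ 2) +
      (n%:R * (S ^+ 2 + T ^+ 2) + 2 * (S * T * be)) / k.
    have := mulr_ge0 h (ltW k0); congr (_ <= _).
    by field; rewrite gt_eqF.
  have : (n%:R * (S ^+ 2 + T ^+ 2) + 2 * (S * T * be)) / k <= S ^+ 2 + T ^+ 2.
    by rewrite ler_pdivrMr // /k; move: h2; lra.
  lra.
have := ler_wpM2l (norm2_ge0 Y) kb; lra.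
Qed.

(** A positive offset rewards the all-ones direction as well. By Bessel, [excess] times both squared
    overlaps is charged to the norm, which gives [level]; what is left along the labels is [gap],
    positive since [drift - excess] is the minimum of [drift] and [kl q p]. *)
Definition excess : R := Num.max 0 (offset).
Definition gap : R := t * (drift - excess).
Definition level : R := t * excess.

Lemma excess_ge0 : 0 <= excess. Proof. by rewrite le_max lexx. Qed.
Lemma offset_le_excess : offset <= excess. Proof. by rewrite le_max lexx orbT. Qed.

Lemma gap_gt0 : 0 < gap.
Proof.
rewrite mulr_gt0 // subr_gt0 gt_max.
have h1 := kl_gt0 p01 q01 pq; have h2 : 0 < kl q p by apply: kl_gt0 => //; rewrite eq_sym.
by rewrite /drift /offset; apply/andP; split; lra.
Qed.

Lemma level_ge0 : 0 <= level. Proof. by rewrite mulr_ge0 ?excess_ge0 // ltW. Qed.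

Lemma gap_level : gap + level = t * drift.
Proof. by rewrite /gap /level; ring. Qed.

Definition bad_grid s (del eps : R) (N : nat) g : bool :=
  [exists k : {ffun 'I_n -> 'I_(N.*2.+1)}, (norm2 (grid_point del k) <= n%:R) &&
    (l * (gap * dotp (grid_point del k) (spins s) ^+ 2 / n%:R + (level + eps) * n%:R) <
     qform (lmx g) (grid_point del k))].

Definition bad_signal s (eps : R) g : bool :=
  qform (lmx g) (spins s) < (gap + level - eps) * n%:R * l.

Context (th eps eb : R).
Hypotheses (th0 : 0 < th) (eps0 : 0 < eps) (eb0 : 0 <= eb) (eb1 : eb <= 1)
  (ebc : level * eb <= eps / 2) (thb : 4 * t * th * b ^+ 2 <= eps / 4)
  (nbig : 4 <= n%:R * (th * eps / 8)).

Lemma al_bernstein : al * (4 * th ^+ 2 * b ^+ 2 * n%:R ^+ 2) <= th * eps / 4 * l * n%:R.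
Proof.
have l0 := ln_natr_gt0.
have -> : al * (4 * th ^+ 2 * b ^+ 2 * n%:R ^+ 2) =
   (al * n%:R) * (4 * th ^+ 2 * b ^+ 2 * n%:R) by ring.
rewrite (al_nE).
have h : 0 <= th * (l * n%:R) by rewrite !mulr_ge0 // ltW.
have := ler_wpM2l h thb; lra.
Qed.

(** The allowed deviation has order l n, so one grid point fails with probability exp(- const l n).
    This beats the (2N + 1)^n grid points as soon as l exceeds a constant multiple of ln(2N + 1),
    because the grid does not depend on n. *)
Lemma bad_grid_le s (del : R) (N : nat) : balanced eb s -> 0 < del ->
  2 * th * (del * N%:R) ^+ 2 * b <= 2^-1 -> ln (N.*2.+1%:R) <= l * (th * eps / 8) ->
  prodPr (pmf s) (bad_grid s del eps N) <= expR (- 4 * l).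
Proof.
move=> bal del0 thK lN; have fP := obs_pmfP p01 q01 a01 s.
have l0 := ln_natr_gt0.
apply: le_trans (prodPr_union _ fP) _.
apply: (@le_trans _ _ (\sum_(k : {ffun 'I_n -> 'I_(N.*2.+1)}) expR (- (th * eps / 4 * l * n%:R)))).
  apply: ler_sum => k _; set Y := grid_point del k; set A := fun g => _.
  have [Yn|/negPf Yn] := boolP (norm2 Y <= n%:R); last first.
    by rewrite /prodPr big1 ?expR_ge0 // => g; rewrite /A Yn.
  set S2 := dotp Y (spins s) ^+ 2 in A *.
  have YK i : `|Y i| <= del * N%:R.
    rewrite /Y /grid_point normrM gtr0_norm // ler_pM2l // ler_norml.
    have kN : (k i)%:R <= 2 * N%:R :> R.
      by rewrite -natrM mul2n ler_nat; exact: (ltn_ord (k i)).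
    have k0 : 0 <= (k i)%:R :> R by [].
    apply/andP; split; lra.
  have thK' : 2 * `|th| * (del * N%:R) ^+ 2 * b <= 2^-1 by rewrite gtr0_norm.
  have H := @qform_tail s Y th (th * (l * (gap * S2 / n%:R + (level + eps) * n%:R)))
     (del * N%:R) A YK thK' Yn.
  apply: le_trans (H _) _.
    by move=> g; rewrite /A => /andP[_ /ltW h]; rewrite ler_pM2l.
  rewrite ler_expR.
  have QM : quad_mean s Y <= (drift - excess) * S2 + excess * ((1 + eb) * n%:R * n%:R).
    have B := bessel_spins Y eb0 bal; rewrite -/S2 in B.
    have kl0 : 0 <= kl p q * norm2 Y by rewrite mulr_ge0 ?norm2_ge0 // ltW // kl_gt0.
    have o := ler_wpM2r (sqr_ge0 (\sum_i Y i)) offset_le_excess.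
    have e := ler_wpM2l excess_ge0 B.
    have nb : (1 + eb) * n%:R * norm2 Y <= (1 + eb) * n%:R * n%:R.
      by rewrite ler_wpM2l // mulr_ge0 // addr_ge0.
    have e2 := ler_wpM2l excess_ge0 nb.
    rewrite /quad_mean -/S2; clear H; lra.
  have aQ : al * (th * quad_mean s Y) <=
      th * l * (gap * S2 / n%:R + level * (1 + eb) * n%:R).
    have a0 : 0 <= al by case/andP: a01 => /ltW.
    apply: (@le_trans _ _ (al * (th * ((drift - excess) * S2 + excess * ((1 + eb) * n%:R * n%:R))))).
      by rewrite ler_wpM2l // ler_pM2l.
    have -> : al = t * l / n%:R by [].
    rewrite /gap /level; apply: ler_of_eq.
    by field; rewrite gt_eqF.
  have bern := al_bernstein.
  have tln : 0 <= th * (l * n%:R) by rewrite !mulr_ge0 // ltW.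
  have e1 := ler_wpM2l tln ebc.
  rewrite mulrDr; clear H; lra.
rewrite sumr_const card_ffun !card_ord -(mulr_natl (expR _)) natrX.
rewrite -[X in X ^+ _]lnK ?posrE ?ltr0n // -expRM_natl -expRD ler_expR.
have h1 := ler_wpM2l (ltW nR0) lN; have h2 := ler_wpM2l (ltW l0) nbig.
by lra.
Qed.

Lemma bad_signal_le s : balanced eb s -> 2 * th * b <= 2^-1 ->
  t * `|offset| * eb <= eps / 4 -> t * kl p q <= eps / 4 * n%:R ->
  prodPr (pmf s) (bad_signal s eps) <= expR (- 4 * l).
Proof.
move=> bal th1 oeb kln; have l0 := ln_natr_gt0.
have Y1 i : `|spins s i : R| <= 1 by rewrite norm_spin.
have Yn : norm2 (spins s : 'I_n -> R) = n%:R by exact: norm2_spins.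
have th1' : 2 * `|- th| * 1 ^+ 2 * b <= 2^-1 by rewrite normrN gtr0_norm // expr1n mulr1.
have Yn' : norm2 (spins s : 'I_n -> R) <= n%:R by rewrite Yn.
have H := @qform_tail s (spins s) (- th)
  (- th * ((gap + level - eps) * n%:R * l)) 1 (bad_signal s eps) Y1 th1' Yn'.
apply: le_trans (H _) _.
  by move=> g; rewrite /bad_signal => /ltW h; rewrite !mulNr lerN2 ler_pM2l.
rewrite ler_expR sqrrN mulrDr.
have QM : drift * n%:R ^+ 2 - `|offset| * eb * n%:R ^+ 2 - kl p q * n%:R <=
    quad_mean s (spins s).
  rewrite /quad_mean Yn dotpxx Yn lerD2r lerD2l.
  have bal2 : (\sum_i spins s i) ^+ 2 <= eb * n%:R ^+ 2.
    apply: (@le_trans _ _ ((eb * n%:R) ^+ 2)).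
      by apply: ler_sqr_of_norm; apply: le_trans bal (ler_norm _).
    by rewrite exprMn ler_wpM2r ?sqr_ge0 // expr2 ler_piMl.
  have h := ler_wpM2l (normr_ge0 (offset)) bal2.
  have : - (`|offset| * (\sum_i spins s i) ^+ 2) <= offset * (\sum_i spins s i) ^+ 2.
    by rewrite -mulNr ler_wpM2r ?sqr_ge0 // lerNl -normrN ler_norm.
  by clear H; lra.
set Q := _ - kl p q * n%:R in QM.
have aQ : - (th * l * n%:R * (gap + level - eps / 4 - eps / 4)) >= al * (- th * quad_mean s (spins s)).
  have a0 : 0 <= al by case/andP: a01 => /ltW.
  rewrite mulNr mulrN lerN2.
  apply: (@le_trans _ _ (al * (th * Q))); last first.
    by rewrite ler_wpM2l // ler_pM2l.
  have -> : al * (th * Q) =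
      th * l * ((gap + level) * n%:R - t * `|offset| * eb * n%:R - t * kl p q).
    by rewrite gap_level /Q /reveal_prob; field; rewrite gt_eqF.
  have tl : 0 <= th * l by rewrite mulr_ge0 // ltW.
  rewrite -mulrA ler_wpM2l //.
  have := ler_wpM2r (ltW nR0) oeb; clear H; lra.
have bern := al_bernstein.
have h2 := ler_wpM2l (ltW l0) nbig.
clear H; lra.
Qed.

End BadEvents.

(** * The spectral estimator *)

Section SpectralVector.
Context {R : realType} (p q : R) {n : nat}.
Hypotheses (p01 : 0 < p < 1) (q01 : 0 < q < 1) (pq : p != q) (n0 : (0 < n)%N).
Implicit Types (s : labels n) (g : observation n).

Let nR0 : 0 < n%:R :> R. Proof. by rewrite ltr0n. Qed.

Lemma ln_ratio_neq0 : ln (p / q) != 0.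
Proof.
have /andP[p0 _] := p01; have /andP[q0 _] := q01.
apply: contra pq => /eqP h; have : p / q = 1 by rewrite -[LHS]lnK ?posrE ?divr_gt0 // h expR0.
by move=> h1; rewrite -[p](divfK (lt0r_neq0 q0)) h1 mul1r.
Qed.

Lemma llr_bound_gt0 : 0 < llr_bound p q.
Proof. by rewrite /llr_bound ltr_wpDr // normr_gt0 ln_ratio_neq0. Qed.

Lemma signed_spec_mxE g i j :
  lmx p q g i j = `|ln (p / q)| * signed_spec_mx p q g i j.
Proof.
have /andP[p0 p1] := p01; have /andP[q0 q1] := q01.
have p1' : 0 < 1 - p by lra. have q1' : 0 < 1 - q by lra.
have specE : spec_mx p q g i j = lmx p q g i j / ln (p / q).
  rewrite /spec_mx mxE /lmx /status; case: insubP => [e _ _|_] /=; last by rewrite mul0r.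
  case: (g e) => [[]|] /=; rewrite ?mul0r ?divff ?ln_ratio_neq0 // /spec_y.
  have -> : ln ((1 - p) / (1 - q)) = - ln ((1 - q) / (1 - p)).
    by rewrite -lnV ?posrE ?divr_gt0 // invf_div.
  by rewrite mulNr.
have h := ln_ratio_neq0.
rewrite /signed_spec_mx; case: ltP => qp.
  rewrite gtr0_norm; first by rewrite specE mulrC divfK.
  by rewrite ln_gt0 // ltr_pdivlMr // mul1r.
have pq' : p < q by rewrite lt_neqAle pq.
rewrite ltr0_norm; first by rewrite mxE specE mulNr mulrN opprK mulrC divfK.
by rewrite ln_lt0 // divr_gt0 //= ltr_pdivrMr // mul1r.
Qed.

(** An eigenvector has no preferred sign; here it is chosen with the help of the true labels, which
    is legitimate because [Err] takes the better of the two global signs. *)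
Definition orientation (sg u : 'I_n -> R) : R := if 0 <= dotp u sg then 1 else -1.

Definition spec_vector (u : 'rV[R]_n) (sg : 'I_n -> R) : 'I_n -> R :=
  fun i => orientation sg (fun i => u 0 i) * Num.sqrt n%:R * u 0 i.

Lemma spec_vector_top (sg : 'I_n -> R) g (u : 'rV[R]_n) :
  top_unit_eigenvector (signed_spec_mx p q g) u ->
  exists lam, top_vector sg (lmx p q g) lam (spec_vector u sg).
Proof.
move=> [a [_ amax ua u1]]; exists (`|ln (p / q)| * a).
set o := orientation sg (fun i => u 0 i).
have o2 : o ^+ 2 = 1 by rewrite /o /orientation; case: ifP => _; rewrite ?sqrrN expr1n.
have L0 : 0 <= `|ln (p / q)| by exact: normr_ge0.
have Asym : symm (signed_spec_mx p q g).
  have Lp : `|ln (p / q)| != 0 by rewrite normr_eq0 ln_ratio_neq0.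
  by move=> i j; apply: (mulfI Lp); rewrite -!signed_spec_mxE lmx_sym.
split.
- rewrite /spec_vector norm2Z exprMn o2 mul1r sqr_sqrtr // /norm2 u1 mulr1 //.
- apply/funext => i; rewrite /app /spec_vector.
  have := congr1 (fun v : 'rV_n => v 0 i) (elimT eigenspaceP ua); rewrite !mxE => h.
  have -> : `|ln (p / q)| * a * (o * Num.sqrt n%:R * u 0 i) =
    `|ln (p / q)| * (o * Num.sqrt n%:R) * (a * u 0 i) by ring.
  rewrite -h mulr_sumr; apply: eq_bigr => j _.
  by rewrite signed_spec_mxE (Asym i j) -/o; ring.
- move=> x; have := qform_le_eigenvalue Asym amax x.
  have -> : qform (lmx p q g) x = `|ln (p / q)| * qform (signed_spec_mx p q g) x.
    rewrite /qform mulr_sumr; apply: eq_bigr => i _; rewrite mulr_sumr.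
    by apply: eq_bigr => j _; rewrite signed_spec_mxE -mulrA.
  by move=> h; rewrite -mulrA ler_wpM2l.
- rewrite /spec_vector dotpZl -/o /o /orientation; case: ifP => [h|/negbT].
    by rewrite mul1r mulr_ge0 // sqrtr_ge0.
  rewrite -ltNge => h; rewrite mulN1r mulNr oppr_ge0.
  by rewrite mulr_ge0_le0 ?sqrtr_ge0 // ltW.
Qed.

Lemma lmx_censor j g : lmx p q (censor j g) = mask_at j (lmx p q g).
Proof.
apply/funext => i; apply/funext => k; rewrite /mask_at.
case: (eqVneq k i) => [->|ki]; first by rewrite !lmx_diag; case: ifP.
rewrite /lmx; pose e : upair n := exist _ [set i; k]%SET (upair_card2 ki).
rewrite (_ : [set i; k]%SET = val e) // !status_val ffunE /= !inE ![j == _]eq_sym.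
by case: ifP.
Qed.

Lemma spec_mismatch_le (u : 'rV[R]_n) s :
  mismatch (fun i => Num.sg (u 0 i)) s (orientation (spins s) (fun i => u 0 i)) <=
  n%:R^-1 * \sum_i (spins s i * spec_vector u (spins s) i <= 0)%R%:R.
Proof.
rewrite ler_wpM2l ?invr_ge0 ?(ltW nR0) //; apply: ler_sum => i _.
rewrite ler_nat; set o := orientation _ _.
case: (boolP (_ <= 0)) => [_|]; first by rewrite leq_b1.
rewrite -ltNge /spec_vector -/o => h; rewrite leqn0 eqb0 negbK.
have s0 : 0 < Num.sqrt n%:R :> R by rewrite sqrtr_gt0.
have {}h : 0 < spins s i * o * u 0 i.
  move: h; have -> : spins s i * (o * Num.sqrt n%:R * u 0 i) = Num.sqrt n%:R * (spins s i * o * u 0 i) by ring.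
  by rewrite (pmulr_rgt0 _ s0).
have := h; rewrite /spins /o /orientation; case: (0 <= dotp _ _); rewrite /spin; case: (s i).
- by rewrite !mul1r => h'; rewrite gtr0_sg.
- by rewrite mulr1 mulN1r oppr_gt0 mul1r => h'; rewrite ltr0_sg.
- by rewrite mul1r mulN1r oppr_gt0 mulr1 => h'; rewrite ltr0_sg.
- by rewrite mulrN1 opprK mul1r => h'; rewrite gtr0_sg.
Qed.

Lemma mismatch_le1 (est : 'I_n -> R) s x : mismatch est s x <= 1.
Proof.
rewrite /mismatch mulrC ler_pdivrMr // mul1r -[in leRHS](card_ord n) -sumr_const.
by apply: ler_sum => i _; rewrite lern1 leq_b1.
Qed.

Lemma vertex_llr_lmx s g i :
  spins s i * app (lmx p q g) (spins s) i = vertex_llr p q s g i.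
Proof.
rewrite vertex_llrE; congr (_ * _); rewrite /app (bigD1 i) //= lmx_diag mul0r add0r.
by apply: eq_bigr => j _; rewrite mulrC.
Qed.

End SpectralVector.

(** * Sign errors outside the bad events *)

Section GoodEvent.
Context {R : realType} (p q t : R).
Hypotheses (p01 : 0 < p < 1) (q01 : 0 < q < 1) (pq : p != q) (t0 : 0 < t).
Context (u1 : forall n : nat, observation n -> 'rV[R]_n)
  (hu1 : forall (n : nat) (g : observation n), (0 < n)%N ->
       top_unit_eigenvector (signed_spec_mx p q g) (u1 n g)).
Context {n : nat} (n2 : (2 <= n)%N).
Notation l := (ln (n%:R : R)).
Notation b := (llr_bound p q).
Notation C := (5 + 3 * t).
Let c3 := 4 * b * C / gap p q t.

(** The vertex enters through [bad_row], which evaluates this deviation at [censor j g]. *)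
Definition loo_vector (s : labels n) (j : 'I_n) (g : observation n) : 'I_n -> R :=
  fun k => spec_vector (u1 g) (spins s) k - spins s k.

Context (eps eps' eta e3 e1 K dg del : R) (N : nat).
Let K' := dg * N%:R.
Hypotheses (eps0 : 0 < eps) (epsg : 16 * eps <= gap p q t) (eps'2 : 2 * eps' = eps)
  (eta0 : 0 < eta) (e30 : 0 < e3) (e3eps : 6 * eps / gap p q t <= e3 ^+ 2)
  (etaC : eta <= C) (etac : 8 * b * eta * (1 + c3) <= gap p q t)
  (etadel : b * eta * (1 + (1 + c3) * (4 * c3)) <= del)
  (e10 : 0 < e1) (K0 : 0 < K) (dg0 : 0 < dg) (N0 : (0 < N)%N)
  (Ele : 2 * gap p q t * (dg + K'^-1) + 2 * b * C * dg + b * e1 * (1 + C) +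
     2 * b * C * (K / K') <= eps')
  (Cl1 : 1 <= C * l) (nbig : 2 * b * C <= eps * n%:R)
  (lbig : 16 * b ^+ 2 * C * c3 ^+ 2 <= gap p q t ^+ 2 * l).

(** The complements of the five bad events are the hypotheses of the deterministic estimates. Half
    of [eps] is spent on the grid bound and half on extending it to all vectors. *)
Lemma good_event_sign s g i :
  ~~ bad_degree t g -> ~~ bad_subset e1 K g -> ~~ bad_grid p q t s dg eps' N g ->
  ~~ bad_signal p q t s eps' g -> ~~ bad_row eta e3 (loo_vector s) g ->
  spins s i * spec_vector (u1 g) (spins s) i <= 0 -> vertex_llr p q s g i <= del * l.
Proof.
move=> /existsPn nd /existsPn ns /existsPn ng; rewrite /bad_signal -leNgt => nsig /existsPn nr sU.
have n0 : (0 < n)%N by apply: leq_trans n2.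
have l0 : 0 < l by exact: ln_natr_gt0.
have C0 : 0 < C by have := t0; lra.
have b0 : 0 < b by exact: llr_bound_gt0.
have gam0 : 0 < gap p q t by exact: gap_gt0.
have c0 : 0 <= level p q t by exact: level_ge0.
have deg i' : \sum_j rmx g i' j <= C * l by rewrite leNgt; exact: nd.
have sub (V : {set 'I_n}) : V != finset.set0 -> #|V|%:R * K ^+ 2 <= n%:R ->
    \sum_(i in V) \sum_(j in V) rmx g i j <= e1 ^+ 2 * l * #|V|%:R.
  by move=> V0 VK; have := ns V; rewrite V0 VK /= -leNgt.
have grid (k : {ffun 'I_n -> 'I_(N.*2.+1)}) : norm2 (grid_point dg k) <= n%:R ->
    qform (lmx p q g) (grid_point dg k) <=
    l * (gap p q t * dotp (grid_point dg k) (spins s) ^+ 2 / n%:R + (level p q t + eps') * n%:R).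
  by move=> kn; have := ng k; rewrite kn /= -leNgt.
have sg1 j : `|spins s j : R| = 1 by exact: norm_spin.
have BD : forall i j, `|lmx p q g i j| <= b * rmx g i j by move=> i' j'; exact: lmx_le.
have QF x : qform (lmx p q g) x <= l * (gap p q t * dotp x (spins s) ^+ 2 / n%:R +
    (level p q t + eps) * norm2 x).
  have := qform_le (rmx_sym g) (rmx_ge0 g) BD (ltW b0) sg1 (ltW l0) (ltW C0) e10 K0 dg0 N0
    (ltW gam0) n0 deg sub grid x.
  move=> /le_trans; apply; apply: ler_wpM2l; first exact: ltW.
  rewrite lerD2l ler_wpM2r ?norm2_ge0 // -addrA lerD2l.
  by move: Ele eps'2; rewrite -/K'; lra.
have QS : (gap p q t + level p q t - eps) * n%:R * l <= qform (lmx p q g) (spins s).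
  apply: le_trans nsig; rewrite ler_wpM2r ?(ltW l0) // ler_wpM2r //.
  by move: (eps0) (eps'2); lra.
have [lam topU] := spec_vector_top p01 q01 pq (spins s) (hu1 g n0).
pose V j := spec_vector (u1 (censor j g)) (spins s).
have /choice[mu topV] : forall j, exists mu,
    top_vector (spins s) (mask_at j (lmx p q g)) mu (V j).
  move=> j; rewrite -(lmx_censor p q j g).
  exact: (spec_vector_top p01 q01 pq (spins s) (hu1 (censor j g) n0)).
have row j M : 1 <= M ->
    (forall k, `|V j k - spins s k| <= M) -> \sum_k `|V j k - spins s k| <= e3 * n%:R ->
    \sum_k rmx g j k * `|V j k - spins s k| <= eta * M * l.
  move=> M1 VM Ve; have := nr j; rewrite /loo_vector -/(V j) Ve /= -leNgt => h.
  apply: le_trans h _; rewrite ler_wpM2r ?(ltW l0) // ler_wpM2l ?(ltW eta0) //.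
  exact: maxabs_le.
have H := sign_error_llr (lmx_sym p q g) (rmx_ge0 g) (rmx_le1 g) (lmx_diag p q g) BD b0 sg1 l0
  C0 gam0 c0 eps0 epsg n0 Cl1 nbig deg QF QS topU topV e30 e3eps etaC etac etadel lbig row sU.
by move: H; rewrite vertex_llr_lmx.
Qed.

End GoodEvent.

(** * Choice of constants *)

Lemma exists_small (R : realType) (a m : R) : 0 <= a -> 0 < m ->
  exists2 x : R, 0 < x <= 1 & a * x <= m.
Proof.
move=> a0 m0; have a1 : 0 < a + 1 by rewrite ltr_wpDl.
exists (Num.min 1 (m / (a + 1))).
  by rewrite lt_min ltr01 divr_gt0 //= ge_min lexx.
apply: (@le_trans _ _ (a * (m / (a + 1)))).
  by rewrite ler_wpM2l // ge_min lexx orbT.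
by rewrite mulrA ler_pdivrMr // mulrC ler_wpM2l ?(ltW m0) // lerDl.
Qed.

(** There is no circularity: [eta] depends on [del], [e3] on [eta], [eps] on [e3], then [e1] and
    [dg] on [eps], [K] on [e1], [N] on [K] and [dg], and [eb], [th] come last. None depends on the
    number of vertices. *)
Lemma spectral_constants (R : realType) (t b C gam lev off del : R) :
  0 < t -> 0 < b -> 0 < C -> 0 < gam -> 0 <= lev -> 0 <= off -> 0 < del ->
  exists (eps eps' eta e3 e1 K dg eb th : R) (N : nat),
  [/\ [/\ 0 < eps, 16 * eps <= gam, 2 * eps' = eps & 0 < eps'],
      [/\ 0 < eta, eta <= C, 8 * b * eta * (1 + 4 * b * C / gam) <= gam &
          b * eta * (1 + (1 + 4 * b * C / gam) * (4 * (4 * b * C / gam))) <= del],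
      [/\ 0 < e3, 6 * eps / gam <= e3 ^+ 2 & t * e3 * expR (6 / eta) <= 1],
      [/\ 0 < e1, 0 < K, 0 < dg, (0 < N)%N & t * expR (14 / e1 ^+ 2) <= 2 * K ^+ 2] &
      [/\ 2 * gam * (dg + (dg * N%:R)^-1) + 2 * b * C * dg + b * e1 * (1 + C) +
            2 * b * C * (K / (dg * N%:R)) <= eps',
          0 < eb <= 1, lev * eb <= eps' / 2 /\ t * off * eb <= eps' / 4 &
          [/\ 0 < th, 4 * t * th * b ^+ 2 <= eps' / 4, 2 * th * (dg * N%:R) ^+ 2 * b <= 2^-1 &
            2 * th * b <= 2^-1]]].
Proof.
move=> t0 b0 C0 gam0 lev0 off0 del0.
set c3 := 4 * b * C / gam.
have c30 : 0 < c3 by rewrite /c3 divr_gt0 // !mulr_gt0.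
have [eta [eta0 etaC eta1 eta2]] : exists eta : R, [/\ 0 < eta, eta <= C,
    8 * b * eta * (1 + c3) <= gam & b * eta * (1 + (1 + c3) * (4 * c3)) <= del].
  have A0 : 0 <= 8 * b * (1 + c3) by rewrite !mulr_ge0 ?addr_ge0 // ltW.
  have A1 : 0 <= b * (1 + (1 + c3) * (4 * c3)).
    apply: mulr_ge0; [exact: ltW|apply: addr_ge0 => //; apply: mulr_ge0].
      by rewrite addr_ge0 // ltW.
    by rewrite mulr_ge0 // ltW.
  have C1 : 0 <= C^-1 by rewrite invr_ge0 ltW.
  have [x /andP[x0 x1] hx] := exists_small A0 gam0.
  have [y /andP[y0 y1] hy] := exists_small A1 del0.
  have [z /andP[z0 z1] hz] := exists_small C1 ltr01.
  have {}hz : z <= C by move: hz; rewrite mulrC ler_pdivrMr // mul1r.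
  exists (Num.min z (Num.min x y)); split.
  - by rewrite !lt_min z0 x0.
  - by rewrite ge_min hz.
  - have mx : Num.min z (Num.min x y) <= x by rewrite !ge_min lexx orbT.
    by apply: le_trans hx; rewrite mulrAC ler_wpM2l.
  - have my : Num.min z (Num.min x y) <= y by rewrite !ge_min lexx !orbT.
    by apply: le_trans hy; rewrite mulrAC ler_wpM2l.
have [e3 [e30 He3]] : exists e3 : R, 0 < e3 /\ t * e3 * expR (6 / eta) <= 1.
  have T0 : 0 < t * expR (6 / eta) by rewrite mulr_gt0 ?expR_gt0.
  exists (t * expR (6 / eta))^-1; split; first by rewrite invr_gt0.
  by rewrite mulrAC divff // gt_eqF.
have [eps [eps0 eps1 eps2]] : exists eps : R, [/\ 0 < eps, 16 * eps <= gam & 6 * eps / gam <= e3 ^+ 2].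
  have e32 : 0 < e3 ^+ 2 by rewrite exprn_gt0.
  have A0 : 0 <= 6 / gam by rewrite divr_ge0 // ltW.
  have [x /andP[x0 _] hx] := exists_small A0 e32.
  have [y /andP[y0 _] hy] := @exists_small R 16 gam (ler0n _ _) gam0.
  exists (Num.min x y); split.
  - by rewrite lt_min x0.
  - by apply: le_trans hy; rewrite ler_wpM2l // ge_min lexx orbT.
  - apply: le_trans hx; rewrite mulrAC ler_wpM2l // ge_min lexx //.
pose e := eps / 2; have e0 : 0 < e by rewrite divr_gt0.
have e16 : 0 < e / 8 by rewrite divr_gt0.
have [e1 /andP[e10 _] He1] : exists2 e1 : R, 0 < e1 <= 1 & b * (1 + C) * e1 <= e / 8.
  by apply: exists_small => //; rewrite mulr_ge0 ?addr_ge0 // ltW.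
have [dg /andP[dg0 _] Hdg] : exists2 dg : R, 0 < dg <= 1 & (2 * gam + 2 * b * C) * dg <= e / 8.
  by apply: exists_small => //; rewrite addr_ge0 ?mulr_ge0 // ltW.
pose T := t * expR (14 / e1 ^+ 2).
have T0 : 0 < T by rewrite mulr_gt0 ?expR_gt0.
pose K := 1 + T; have K0 : 0 < K by rewrite addr_gt0.
have HK : T <= 2 * K ^+ 2 by rewrite /K; have := sqr_ge0 T; lra.
pose N := (Num.truncn ((2 * gam + 2 * b * C * K) / (e / 8 * dg))).+1.
have K'0 : 0 < dg * N%:R by rewrite mulr_gt0.
have HN : 2 * gam + 2 * b * C * K <= e / 8 * (dg * N%:R).
  have := @truncn_itv R ((2 * gam + 2 * b * C * K) / (e / 8 * dg)).
  have ed : 0 < e / 8 * dg by rewrite mulr_gt0.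
  case/(_ _)/andP => [|_].
    by rewrite divr_ge0 ?(ltW ed) // addr_ge0 ?mulr_ge0 // ltW.
  rewrite -/N ltr_pdivrMr // => /ltW h; apply: le_trans h _.
  by rewrite mulrC mulrA.
have [eb [/andP[eb0 eb1] Heb1 Heb2]] : exists eb : R,
    [/\ 0 < eb <= 1, lev * eb <= e / 2 & t * off * eb <= e / 4].
  have h2 : 0 < e / 2 by rewrite divr_gt0.
  have h4 : 0 < e / 4 by rewrite divr_gt0.
  have to0 : 0 <= t * off by rewrite mulr_ge0 // ltW.
  have [x /andP[x0 x1] hx] := exists_small lev0 h2.
  have [y /andP[y0 y1] hy] := exists_small to0 h4.
  exists (Num.min x y); split.
  - by rewrite lt_min x0 y0 /= ge_min x1.
  - by apply: le_trans hx; rewrite ler_wpM2l // ge_min lexx.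
  - by apply: le_trans hy; rewrite ler_wpM2l // ge_min lexx orbT.
have [th [th0 Hth1 Hth2 Hth3]] : exists th : R, [/\ 0 < th, 4 * t * th * b ^+ 2 <= e / 4,
    2 * th * (dg * N%:R) ^+ 2 * b <= 2^-1 & 2 * th * b <= 2^-1].
  have h4 : 0 < e / 4 by rewrite divr_gt0.
  have h2 : 0 < 2^-1 :> R by rewrite invr_gt0.
  have s1 : 0 <= b ^+ 2 by exact: sqr_ge0.
  have s2 : 0 <= (dg * N%:R) ^+ 2 by exact: sqr_ge0.
  have A0 : 0 <= 4 * t * b ^+ 2 by rewrite mulr_ge0 // mulr_ge0 // ltW.
  have A1 : 0 <= 2 * (dg * N%:R) ^+ 2 * b by rewrite mulr_ge0 ?(ltW b0) // mulr_ge0.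
  have A2 : 0 <= 2 * b by rewrite mulr_ge0 // ltW.
  have [x /andP[x0 x1] hx] := exists_small A0 h4.
  have [y /andP[y0 y1] hy] := exists_small A1 h2.
  have [z /andP[z0 z1] hz] := exists_small A2 h2.
  set th := Num.min x (Num.min y z).
  have tx : th <= x by rewrite ge_min lexx.
  have ty : th <= y by rewrite !ge_min lexx orbT.
  have tz : th <= z by rewrite !ge_min lexx !orbT.
  exists th; split.
  - by rewrite !lt_min x0 y0.
  - by apply: le_trans hx; rewrite (_ : 4 * t * th * b ^+ 2 = 4 * t * b ^+ 2 * th); [rewrite ler_wpM2l|ring].
  - apply: le_trans hy; rewrite (_ : 2 * th * (dg * N%:R) ^+ 2 * b = 2 * (dg * N%:R) ^+ 2 * b * th); last by ring.
    by rewrite ler_wpM2l.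
  - by apply: le_trans hz; rewrite mulrAC ler_wpM2l.
exists eps, e, eta, e3, e1, K, dg, eb, th, N.
split.
- by split => //; rewrite /e; lra.
- by split.
- by split.
- by split.
split.
- have H1 : 2 * gam / (dg * N%:R) + 2 * b * C * (K / (dg * N%:R)) <= e / 8.
    rewrite (_ : _ + _ = (2 * gam + 2 * b * C * K) / (dg * N%:R)); last by ring.
    by rewrite ler_pdivrMr.
  by move: He1 Hdg H1 e0; clear; lra.
- by rewrite eb0.
- by split.
- by split.
Qed.

Lemma prodED (R : realType) (I V : finType) (f : I -> V -> R)
  (F G : {ffun I -> V} -> R) :
  prodE f (fun g => F g + G g) = prodE f F + prodE f G.
Proof. by rewrite /prodE -big_split; apply: eq_bigr => g _; rewrite mulrDr. Qed.

Lemma prodPr_or (R : realType) (I V : finType) (f : I -> V -> R)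
  (A B : pred {ffun I -> V}) : is_pmf f ->
  prodPr f (fun g => A g || B g) <= prodPr f A + prodPr f B.
Proof.
move=> fP; rewrite !prodPrE -prodED; apply: ler_prodE => // g.
by case: (A g); case: (B g); rewrite /= ?addr0 ?add0r // lerDl.
Qed.

Lemma prodPr_or5 (R : realType) (I V : finType) (f : I -> V -> R)
  (A1 A2 A3 A4 A5 : pred {ffun I -> V}) (x : R) : is_pmf f ->
  prodPr f A1 <= x -> prodPr f A2 <= x -> prodPr f A3 <= x -> prodPr f A4 <= x ->
  prodPr f A5 <= x ->
  prodPr f (fun g => [|| A1 g, A2 g, A3 g, A4 g | A5 g]) <= 5 * x.
Proof.
move=> fP k1 k2 k3 k4 k5.
have h1 := prodPr_or A1 (fun g => [|| A2 g, A3 g, A4 g | A5 g]) fP.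
have h2 := prodPr_or A2 (fun g => [|| A3 g, A4 g | A5 g]) fP.
have h3 := prodPr_or A3 (fun g => A4 g || A5 g) fP.
have h4 := prodPr_or A4 A5 fP.
lra.
Qed.

Lemma expR1_ge2 (R : realType) : 2 <= expR (1 : R).
Proof. by have := expR_ge1Dx (1 : R); lra. Qed.

Lemma unbalanced_exponent (R : realType) (c x l : R) :
  l <= c / 64 * x -> 16 <= x * c -> 1 + - (c / 8) * x <= - 4 * l.
Proof. lra. Qed.

(** * Upper bound for the spectral error *)

Section SpectralUpperBound.
Context {R : realType} (p q t : R).
Hypotheses (p01 : 0 < p < 1) (q01 : 0 < q < 1) (pq : p != q) (t0 : 0 < t).
Context (u1 : forall n : nat, observation n -> 'rV[R]_n)
  (hu1 : forall (n : nat) (g : observation n), (0 < n)%N ->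
       top_unit_eigenvector (signed_spec_mx p q g) (u1 n g)).
Let tau := t * (1 - affinity p q).
Notation al n := (reveal_prob t n).
Notation pmf n := (obs_pmf p q (al n)).

Lemma Err_spec_le n (d : R) (a01 : 0 < al n < 1) (n0 : (0 < n)%N) (bad : labels n -> pred (observation n))
    (good : pred (labels n)) (x y : R) :
  0 <= x ->
  (forall s g i, ~~ bad s g ->
     spins s i * spec_vector (u1 g) (spins s) i <= 0 -> vertex_llr p q s g i <= d * ln n%:R) ->
  (forall s, good s -> prodPr (pmf n s) (bad s) <= x) ->
  labE (fun s => (~~ good s)%:R) <= y ->
  Err p q (al n) (sigma_spec (@u1 n)) <=
  y + x + expR (d * ln n%:R / 2) * (1 - al n * (1 - affinity p q)) ^+ n.-1.
Proof.
move=> x0 Hbad Hgood Hlab.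
rewrite (Err_lab p q (al n) (fun _ g i => Num.sg (u1 g 0 i))) -/(labE _).
set z := expR _ * _.
apply: (@le_trans _ _ (labE (fun s : labels n => (~~ good s)%:R + (x + z)))); last first.
  by rewrite labED labE_cst addrA !lerD2r.
apply: ler_labE => s; have fP := obs_pmfP p01 q01 a01 s.
have z0 : 0 <= z.
  apply: le_trans (vertex_llr_tail p01 q01 a01 s (Ordinal n0) (d * ln n%:R)).
  exact: prodPr_ge0.
case: (boolP (good s)) => [gs|_] /=; last first.
  apply: (@le_trans _ _ (prodE (pmf n s) (fun=> 1))).
    by apply: ler_prodE => // g; rewrite ge_min mismatch_le1.
  by rewrite prodE_cst // lerDl addr_ge0.
rewrite add0r.
apply: (@le_trans _ _ (prodE (pmf n s) (fun g => (bad s g)%:R +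
   n%:R^-1 * \sum_i (vertex_llr p q s g i <= d * ln n%:R)%R%:R))).
  apply: ler_prodE => // g; have [bg|gg] /= := boolP (bad s g).
    rewrite ge_min; apply/orP; left; apply: (@le_trans _ _ 1); first exact: mismatch_le1.
    by rewrite lerDl mulr_ge0 ?invr_ge0 ?sumr_ge0.
  rewrite add0r; apply: (@le_trans _ _ (n%:R^-1 * \sum_i
      (spins s i * spec_vector (u1 g) (spins s) i <= 0)%R%:R)).
    apply: le_trans (spec_mismatch_le n0 (u1 g) s).
    by rewrite ge_min /orientation; case: ifP => _; rewrite lexx ?orbT.
  rewrite ler_wpM2l ?invr_ge0 //; apply: ler_sum => i _; rewrite ler_nat.
  by case: (boolP (_ <= 0)) => // /(Hbad _ _ _ gg) ->.
rewrite prodED -prodPrE prodE_linear; apply: lerD; first exact: Hgood.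
rewrite mulrC ler_pdivrMr ?ltr0n //.
have -> : z * n%:R = \sum_(i < n) z by rewrite sumr_const card_ord mulr_natr.
apply: ler_sum => i _; rewrite -prodPrE.
exact: vertex_llr_tail.
Qed.

(** Half of [d] pays for the threshold [d * l], which costs n^(d/2) in Chernoff's bound, and half
    for the asymptotics of the affinity. *)
Lemma near_Err_spec_le (d : R) : 0 < d -> \forall n \near \oo,
  Err p q (al n) (sigma_spec (@u1 n)) <= expR (- (tau - d) * ln n%:R) + n%:R ^- 3.
Proof.
move=> d0.
have b0 := llr_bound_gt0 p01 q01 pq.
have C0 : 0 < 5 + 3 * t by move: (t0); lra.
have gam0 := gap_gt0 p01 q01 pq t0.
have lev0 := @level_ge0 R p q t t0.
have [eps [eps' [eta [e3 [e1 [K [dg [eb [th [N HH]]]]]]]]]] :=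
  spectral_constants t0 b0 C0 gam0 lev0 (normr_ge0 (offset p q)) d0.
case: HH => [[eps0 epsg eps'2 eps'0] [eta0 etaC eta1 eta2] [e30 e3eps He3]
  [e10 K0 dg0 N0 HK] [HE /andP[eb0 eb1] [Heb1 Heb2] [th0 Hth1 Hth2 Hth3]]].
set b := llr_bound p q in b0 HE eta1 eta2 Hth1 Hth2 Hth3.
set C := 5 + 3 * t in C0 etaC eta1 eta2 HE.
set gam := gap p q t in gam0 epsg e3eps eta1 eta2 HE.
have d2 : 0 < d / 2 by rewrite divr_gt0.
have te0 : 0 < th * eps' / 8 by rewrite divr_gt0 // mulr_gt0.
near=> n.
(* Five bad events and the unbalanced labels contribute 6 n^-4, at most n^-3. *)
have n6 : 6 <= n%:R :> R by near: n; exact: near_natr_ge.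
have nb1 : 2 * b * C / eps <= n%:R by near: n; exact: near_natr_ge.
have nb2 : 4 / (th * eps' / 8) <= n%:R by near: n; exact: near_natr_ge.
have nb3 : t * kl p q / (eps' / 4) <= n%:R by near: n; exact: near_natr_ge.
have nb4 : 16 / eb ^+ 2 <= n%:R by near: n; exact: near_natr_ge.
have nl : ln n%:R <= eb ^+ 2 / 64 * n%:R.
  by near: n; apply: near_ln_le; rewrite divr_gt0 // exprn_gt0.
have l1 : 1 / C <= ln n%:R by near: n; exact: near_ln_ge.
have l2 : 16 * b ^+ 2 * C * (4 * b * C / gam) ^+ 2 / gam ^+ 2 <= ln n%:R.
  by near: n; exact: near_ln_ge.
have l3 : ln (N.*2.+1%:R) / (th * eps' / 8) <= ln n%:R by near: n; exact: near_ln_ge.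
have /andP[a0 a1] : 0 < al n <= 2^-1.
  by near: n; apply: near_reveal_prob => //; rewrite invr_gt0.
have bpow : forall k, (k <= 2)%N ->
    (1 - al n * (1 - affinity p q)) ^+ (n - k) <= expR (- (tau - d / 2) * ln n%:R).
  by near: n; exact: near_affinity_pow_le.
have a01 : 0 < al n < 1 by rewrite a0 /=; apply: le_lt_trans a1 _; rewrite invf_lt1 // ltr1n.
have n2 : (2 <= n)%N by rewrite -(ler_nat R); apply: le_trans n6; rewrite ler_nat.
have n0 : (0 < n)%N by apply: leq_trans n2.
have nR0 : 0 < n%:R :> R by rewrite ltr0n.
have l0 := @ln_natr_gt0 R n n2.
have n1 := @natr_expR_ln R n n2.
have {}nb1 : 2 * b * C <= eps * n%:R by rewrite [eps * _]mulrC -ler_pdivrMr.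
have {}nb2 : 4 <= n%:R * (th * eps' / 8) by rewrite -ler_pdivrMr.
have {}nb3 : t * kl p q <= eps' / 4 * n%:R.
  by rewrite [eps' / 4 * _]mulrC -ler_pdivrMr // divr_gt0.
have {}nb4 : 16 <= n%:R * eb ^+ 2 by rewrite -ler_pdivrMr // exprn_gt0.
have {}l1 : 1 <= C * ln n%:R by rewrite mulrC -ler_pdivrMr.
have {}l2 : 16 * b ^+ 2 * C * (4 * b * C / gam) ^+ 2 <= gam ^+ 2 * ln n%:R.
  by rewrite [gam ^+ 2 * _]mulrC -ler_pdivrMr // exprn_gt0.
have {}l3 : ln (N.*2.+1%:R) <= ln n%:R * (th * eps' / 8) by rewrite -ler_pdivrMr.
pose bad (s : labels n) g := [|| bad_degree t g, bad_subset e1 K g, bad_grid p q t s dg eps' N g,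
  bad_signal p q t s eps' g | bad_row eta e3 (loo_vector u1 s) g].
set l := ln n%:R in nl l0 n1 l1 l2 l3 bpow *.
have x0 : 0 <= 5 * expR (- 4 * l) by rewrite mulr_ge0 // expR_ge0.
have := @Err_spec_le n d a01 n0 bad (balanced eb) (5 * expR (- 4 * l)) (expR (- 4 * l)) x0 _ _ _.
have -> : n%:R ^- 3 = expR (- 3 * l) :> R.
  by rewrite n1 -expRM_natl -expRN; congr expR; ring.
have E : expR (d * l / 2) * (1 - al n * (1 - affinity p q)) ^+ n.-1 <= expR (- (tau - d) * l).
  have := bpow 1%N isT; rewrite subn1 => /(ler_wpM2l (expR_ge0 (d * l / 2))).
  rewrite -expRD (_ : d * l / 2 + - (tau - d / 2) * l = - (tau - d) * l) //.
  by field.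
have E2 : expR (- 4 * l) + 5 * expR (- 4 * l) <= expR (- 3 * l).
  rewrite (_ : - 3 * l = l + - 4 * l); last by ring.
  rewrite expRD -n1; apply: le_trans (ler_wpM2r (expR_ge0 (- 4 * l)) n6).
  by apply: ler_of_eq; ring.
move=> /(_ _ _ _) H.
apply: le_trans (H _ _ _) _ => {H}.
- move=> s g i; rewrite /bad !negb_or => /and5P[h1 h2 h3 h4 h5].
  exact: (good_event_sign p01 q01 pq t0 hu1 n2 eps0 epsg eps'2 eta0 e30 e3eps etaC eta1 eta2
    e10 K0 dg0 N0 HE l1 nb1 l2 h1 h2 h3 h4 h5).
- move=> s bs; have fP := obs_pmfP p01 q01 a01 s.
  have := bad_degree_le p01 q01 a01 n2 s.
  have := bad_subset_le p01 q01 t0 a01 n2 s e10 K0 HK.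
  have := bad_grid_le p01 q01 pq a01 n2 th0 (ltW eb0) Heb1 Hth1 nb2 bs dg0 Hth2 l3.
  have := bad_signal_le p01 q01 a01 n2 th0 (ltW eb0) eb1 Hth1 nb2 bs Hth3 Heb2 nb3.
  have := bad_row_le p01 q01 a01 n2 s (loo_vector u1 s) eta0 e30 He3.
  move=> k1 k2 k3 k4 k5.
  exact: (prodPr_or5 fP k5 k4 k3 k2 k1).
- have eb01 : 0 < eb <= 1 by rewrite eb0.
  apply: le_trans (@labE_unbalanced R n eb eb01) _.
  apply: le_trans (ler_wpM2r (expR_ge0 _) (@expR1_ge2 R)) _; rewrite -expRD ler_expR.
  exact: unbalanced_exponent nl nb4.
rewrite addrC; apply: lerD; [exact: E|exact: E2].
Unshelve. all: by end_near. Qed.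

End SpectralUpperBound.

Lemma powR_natr (R : realType) (n : nat) (x : R) : (0 < n)%N ->
  n%:R `^ x = expR (x * ln n%:R).
Proof. by move=> n0; rewrite /powR pnatr_eq0 eqn0Ngt n0. Qed.

(** * From two-sided bounds to the exponents *)

Section Rates.
Context {R : realType} (tau : R) (X Y : nat -> R).
Notation l n := (ln (n%:R : R)).
Hypotheses (tau0 : 0 < tau)
  (X_ge : forall d, 0 < d -> \forall n \near \oo, expR (- (tau + d) * l n) <= X n)
  (X_le : forall d, 0 < d -> \forall n \near \oo, X n <= expR (- (tau - d) * l n) + n%:R ^- 3)
  (Y_ge : forall d, 0 < d -> \forall n \near \oo, expR (- (tau + d) * l n) <= Y n)
  (Y_le : forall d, 0 < d -> \forall n \near \oo, Y n <= expR (- (tau - d) * l n)).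

(* X with its O(n^-3) part removed, whenever that part dominates n^-tau. *)
Definition main_part (n : nat) : R :=
  Num.max (Num.min (X n) (expR (- tau * l n))) (X n - n%:R ^- 3).

Lemma main_part_dist n : (0 < n)%N -> `|X n - main_part n| <= n%:R ^- 3.
Proof.
move=> n0; have c0 : 0 <= n%:R ^- 3 :> R by rewrite invr_ge0 exprn_ge0.
have h1 : main_part n <= X n by rewrite ge_max ge_min lexx /= gerBl.
have h2 : X n - n%:R ^- 3 <= main_part n by rewrite le_max lexx orbT.
by rewrite ger0_norm; lra.
Qed.

Lemma ln_rate (Z : nat -> R) :
  (forall d, 0 < d -> \forall n \near \oo, expR (- (tau + d) * l n) <= Z n) ->
  (forall d, 0 < d -> \forall n \near \oo, Z n <= expR (- (tau - d) * l n)) ->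
  forall d, 0 < d -> \forall n \near \oo, `|ln (Z n) / l n + tau| <= d.
Proof.
move=> Z_ge Z_le d d0; near=> n.
have l1 : 1 <= l n by near: n; exact: near_ln_ge.
have h1 : expR (- (tau + d) * l n) <= Z n by near: n; exact: Z_ge.
have h2 : Z n <= expR (- (tau - d) * l n) by near: n; exact: Z_le.
have l0 : 0 < l n by apply: lt_le_trans l1.
have Z0 : 0 < Z n by apply: lt_le_trans h1; exact: expR_gt0.
have k1 : - (tau + d) <= ln (Z n) / l n.
  by rewrite ler_pdivlMr // -[leLHS]expRK ler_ln ?posrE ?expR_gt0.
have k2 : ln (Z n) / l n <= - (tau - d).
  by rewrite ler_pdivrMr // -[leRHS]expRK ler_ln ?posrE ?expR_gt0.
by rewrite ler_norml; apply/andP; split; lra.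
Unshelve. all: by end_near. Qed.

Lemma main_part_ge d : 0 < d ->
  \forall n \near \oo, expR (- (tau + d) * l n) <= main_part n.
Proof.
move=> d0; near=> n.
have l1 : 0 <= l n by near: n; exact: near_ln_ge.
have h1 : expR (- (tau + d) * l n) <= X n by near: n; exact: X_ge.
rewrite le_max le_min h1 /= ler_expR ler_wpM2r ?orTb // lerN2 lerDl; exact: ltW.
Unshelve. all: by end_near. Qed.

Lemma main_part_le d : 0 < d ->
  \forall n \near \oo, main_part n <= expR (- (tau - d) * l n).
Proof.
move=> d0; near=> n.
have l1 : 0 <= l n by near: n; exact: near_ln_ge.
have h1 : X n <= expR (- (tau - d) * l n) + n%:R ^- 3 by near: n; exact: X_le.
rewrite ge_max lerBlDr h1 andbT ge_min; apply/orP; right.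
by rewrite ler_expR ler_wpM2r // lerN2 gerBl ltW.
Unshelve. all: by end_near. Qed.

(** [main_part] obeys the two-sided bounds without the n^-3 and stays within n^-3 of [X]. The
    exponents are obtained by solving both identities for them with the same remainder, and they
    vanish in the limit because [main_part] and [Y] have the logarithmic rate [- tau]. *)
Lemma rate_decomposition : exists eps1 eps2 r1 r2 : nat -> R,
    [/\ eps1 @ \oo --> 0,
        eps2 @ \oo --> 0,
        exists C : R, forall n : nat, (0 < n)%N -> `|r1 n| <= C * n%:R ^- 3,
        exists C : R, forall n : nat, (0 < n)%N -> `|r2 n| <= C * n%:R ^- 3 &
        \forall n \near \oo,
          X n = n%:R `^ eps1 n * Y n + r1 n /\
          X n = n%:R `^ (- ((1 + eps2 n) * tau)) + r2 n].
Proof.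
have V_rate := ln_rate main_part_ge main_part_le.
have Y_rate := ln_rate Y_ge Y_le.
exists (fun n => ln (main_part n) / l n - ln (Y n) / l n),
  (fun n => - (ln (main_part n) / l n) / tau - 1),
  (fun n => X n - main_part n), (fun n => X n - main_part n).
split.
- apply/cvgrPdist_le => e e0; have e2 : 0 < e / 2 by rewrite divr_gt0.
  near=> n.
  have h1 : `|ln (main_part n) / l n + tau| <= e / 2 by near: n; exact: V_rate.
  have h2 : `|ln (Y n) / l n + tau| <= e / 2 by near: n; exact: Y_rate.
  rewrite sub0r normrN (_ : _ - _ = (ln (main_part n) / l n + tau) - (ln (Y n) / l n + tau)); last by ring.
  by apply: le_trans (ler_normB _ _) _; lra.
- apply/cvgrPdist_le => e e0; near=> n.
  have h1 : `|ln (main_part n) / l n + tau| <= e * tau.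
    by near: n; apply: V_rate; rewrite mulr_gt0.
  rewrite (_ : 0 - _ = (ln (main_part n) / l n + tau) / tau).
    by rewrite normrM (@ger0_norm _ tau^-1) ?invr_ge0 ?(ltW tau0) // ler_pdivrMr ?tau0.
  by rewrite mulrDl divff ?gt_eqF // mulNr; ring.
- by exists 1 => n n0; rewrite mul1r main_part_dist.
- by exists 1 => n n0; rewrite mul1r main_part_dist.
have d1 : 0 < 1 :> R by [].
near=> n.
have l1 : 1 <= l n by near: n; exact: near_ln_ge.
have n1 : 1 <= n%:R :> R by near: n; exact: near_natr_ge.
have V0 : 0 < main_part n.
  have h : expR (- (tau + 1) * l n) <= main_part n by near: n; exact: main_part_ge.
  by apply: lt_le_trans h; exact: expR_gt0.
have Y0 : 0 < Y n.
  have h : expR (- (tau + 1) * l n) <= Y n by near: n; exact: Y_ge.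
  by apply: lt_le_trans h; exact: expR_gt0.
have l0 : l n != 0 by rewrite gt_eqF // (lt_le_trans d1).
have n0 : (0 < n)%N by rewrite -(ltr_nat R); apply: lt_le_trans n1.
rewrite !powR_natr //; split.
  rewrite mulrBl !divfK // expRB !lnK ?posrE // divfK ?gt_eqF //.
  by rewrite addrC subrK.
rewrite addrC (_ : - _ * l n = ln (main_part n)); first by rewrite lnK ?posrE // subrK.
by rewrite addrCA subrr addr0 divfK ?gt_eqF // opprK divfK.
Unshelve. all: by end_near. Qed.

End Rates.

Theorem theorem2p3 (R : realType) (p q t : R)
    (hp : 0 < p < 1) (hq : 0 < q < 1) (hpq : p != q) (ht : 0 < t)
    (u1 : forall n : nat, observation n -> 'rV[R]_n)
    (hu1 : forall (n : nat) (g : observation n), (0 < n)%N ->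
       top_unit_eigenvector (signed_spec_mx p q g) (u1 n g)) :
  exists eps1 eps2 r1 r2 : nat -> R,
    [/\ eps1 @ \oo --> 0,
        eps2 @ \oo --> 0,
        exists C : R, forall n : nat, (0 < n)%N -> `|r1 n| <= C * n%:R ^- 3,
        exists C : R, forall n : nat, (0 < n)%N -> `|r2 n| <= C * n%:R ^- 3 &
        \forall n \near \oo,
          let a := reveal_prob t n in
          let err_spec := Err p q a (sigma_spec (u1 n)) in
          let err_best := Err p q a (@sigma_best R p q a n) in
          err_spec = n%:R `^ eps1 n * err_best + r1 n /\
          err_spec = n%:R `^ (- ((1 + eps2 n) * (t / t_c p q))) + r2 n].
Proof.
rewrite div_t_c //.
apply: (rate_decomposition
  (X := fun n => Err p q (reveal_prob t n) (sigma_spec (u1 n)))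
  (Y := fun n => Err p q (reveal_prob t n) (@sigma_best R p q (reveal_prob t n) n))).
- by rewrite mulr_gt0 // subr_gt0 affinity_lt1.
(* The lower bound uses nothing spectral: it holds for every function of the observation. *)
- move=> d d0; have := near_Err_ge hp hq ht d0.
  apply: filterS => n /(_ (fun g i => Num.sg (u1 n g 0 i))).
  exact.
- by move=> d d0; exact: near_Err_spec_le.
- by move=> d d0; exact: near_Err_best_ge.
- by move=> d d0; exact: near_Err_best_le.
Qed.
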